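(* Let $G$ be a finite connected graph of minimal degree at least $2$ which is not a cycle, with maximal degree $D$, and let $W:V(G)\to\mathbb{R}$. Let $\psi_\lambda$ be an eigenfunction of $H_G=\mathcal{A}_G+W$ with eigenvalue $\lambda$ and $\|\psi_\lambda\|_2=1$. (1) If $\lambda$ is in the bulk spectrum, then $\|\psi_\lambda\|_\infty\le \frac{8D\,z_\lambda(G)^{-4}}{\sqrt{\ell_G}}$. (2) If $\lambda\notin\sigma(H_{\widetilde G})$ and $\delta_\lambda=\operatorname{dist}(\lambda,\sigma(H_{\widetilde G}))$, then $\|\psi_\lambda\|_\infty\le \frac{8D}{\delta_\lambda}\left(1+\frac{\delta_\lambda}{2D}\right)^{-\ell_G}$.
   Context: $\mathcal{A}_G$ is the adjacency matrix of $G$ and $H_G=\mathcal{A}_G+W$ acts on $\ell^2(V(G))$. $(\widetilde G,\widetilde W)$ is the universal cover of $G$ (a tree) with covering map $\pi$ and lifted potential $\widetilde W=W\circ\pi$; $H_{\widetilde G}=\mathcal{A}_{\widetilde G}+\widetilde W$ on $\ell^2(V(\widetilde G))$. For a tree $\mathcal{T}$ with potential and adjacent vertices $v\sim w$, let $\mathcal{T}^{(v|w)}$ be the connected component containing $v$ of $\mathcal{T}$ with the edge $\{v,w\}$ removed, $H^{(v|w)}$ the restriction of the Schr\''odinger operator to it, and for $\Im\gamma>0$ set $\zeta^\gamma_w(v)=-(H^{(v|w)}-\gamma)^{-1}(v,v)$. For an oriented edge $(x,y)$ of $G$ set $\zeta^\gamma_y(x):=\zeta^\gamma_{\tilde y}(\tilde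 x)$ for adjacent lifts $\tilde x\sim\tilde y$ in $\widetilde G$ (independent of the choice), and $\zeta^{\lambda+i0}_y(x)=\lim_{\eta\downarrow0}\zeta^{\lambda+i\eta}_y(x)$. Under the assumptions (connected, minimal degree $\ge2$, not a cycle), $\sigma(H_{\widetilde G})=(J_1\cup\dots\cup J_\ell)\sqcup\mathfrak F\sqcup\mathfrak F'$ with $J_r$ finitely many (at least one) disjoint open intervals on which the spectrum is absolutely continuous, $\mathfrak F$ a finite set of eigenvalues, and $\mathfrak F'$ the set of endpoints of the $J_r$; $\lambda$ is in the bulk spectrum if $\lambda\in\bigcup_r J_r$, and then all limits $\zeta^{\lambda+i0}_y(x)$ exist with nonzero imaginary part. Define $z_\lambda(G)=\min_{(x,y)}|\Im\zeta^{\lambda+i0}_y(x)|$, the minimum over oriented edges of $G$. $\ell_G$ is the largest integer $\ell$ such that every ball $B_G(x,\ell)$ (graph distance) contains at most one cycle. *)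

(* Defs.v *)
From HB Require Import structures.
From mathcomp Require Import all_boot all_order all_algebra.
From mathcomp Require Import all_classical all_reals all_analysis.
From mathcomp Require Import complex.
Set Implicit Arguments.
Unset Strict Implicit.
Unset Printing Implicit Defensive.
Import Order.TTheory GRing.Theory Num.Theory numFieldNormedType.Exports.
Local Open Scope ring_scope.
Local Open Scope classical_set_scope.

(* Finite simple graphs: vertex set a finType T, adjacency a symmetric,    *)
(* irreflexive relation adj.                                                *)
Section FiniteGraph.
Variables (T : finType) (adj : rel T).

Definition deg (x : T) : nat := #|[set y | adj x y]%SET|.

Definition max_deg : nat := \max_(x : T) deg x.

Definition connected_graph : Prop := forall x y : T, connect adj x y.

Definition min_deg_ge2 : Prop := forall x : T, (2 <= deg x)%N.

Definition is_cycle_graph : Prop :=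
  exists s : seq T, [/\ uniq s, (forall x, x \in s), (3 <= size s)%N &
    forall x y, adj x y = (y == next s x) || (x == next s y)].

Definition ball (x : T) (l : nat) : {set T} :=
  iter l (fun S : {set T} => S :|: [set y | [exists z in S, adj z y]]%SET) [set x]%SET.

Definition cycle_in (S : {set T}) (c : seq T) : bool :=
  [&& uniq c, (3 <= size c)%N, all (fun v => v \in S) c & path.cycle adj c].

Definition cycle_edges (c : seq T) : pred (T * T) :=
  fun p => ((p.1 \in c) && (p.2 == next c p.1))
        || ((p.2 \in c) && (p.1 == next c p.2)).

Definition at_most_one_cycle (S : {set T}) : Prop :=
  forall c1 c2, cycle_in S c1 -> cycle_in S c2 ->
    cycle_edges c1 =i cycle_edges c2.

Definition is_ellG (l : nat) : Prop :=
  (forall x, at_most_one_cycle (ball x l)) /\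
  (forall m : nat, (forall x, at_most_one_cycle (ball x m)) -> (m <= l)%N).

End FiniteGraph.

(* Universal cover.  The universal cover of G rooted at x is the tree whose *)
(* vertices are the non-backtracking walks x = v0, v1, ..., vn in G,        *)
(* represented by the list [:: v1; ...; vn] (the root is [::]); the         *)
(* covering map sends a walk to its endpoint, two walks are adjacent iff    *)
(* one extends the other by one step.                                       *)
Section UniversalCover.
Variables (R : realType) (T : finType) (adj : rel T) (W : T -> R).

Definition nbwalk (x : T) (s : seq T) : bool :=
  path adj x s &&
  [forall i : 'I_(size s).+1,
     (i.+2 <= size s)%N ==> (nth x (x :: s) i != nth x (x :: s) i.+2)].

Definition cover_map (x : T) (s : seq T) : T := last x s.

Definition tparent (s : seq T) : seq T := take (size s).-1 s.

(* The Schroedinger operator A + W~ restricted to a subtree with vertex set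
   V (V a set of vertices of the cover rooted at x, closed under parent
   except for its own root), acting on functions seq T -> C. *)
Definition Hop (x : T) (V : pred (seq T)) (f : seq T -> R[i]) (s : seq T)
  : R[i] :=
  (W (cover_map x s))%:C%C * f s
  + (if (s != [::]) && V (tparent s) then f (tparent s) else 0)
  + \sum_(z : T | V (rcons s z)) f (rcons s z).

Definition l2 (V : pred (seq T)) (f : seq T -> R[i]) : Prop :=
  (forall s, ~~ V s -> f s = 0) /\
  (\esum_(s in [set: seq T]) ((complex.Re (f s)) ^+ 2 + (complex.Im (f s)) ^+ 2)%:E < +oo)%E.

(* the matrix entry (H_V - g)^{-1}(r, r), Im g > 0 : value at r of the
   unique l^2 solution f of (H_V - g) f = delta_r *)
Definition resolvent_entry (x : T) (V : pred (seq T)) (r : seq T) (g : R[i])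
  : R[i] :=
  xget 0 [set c | exists f, [/\ l2 V f,
     (forall s, V s -> Hop x V f s - g * f s = (s == r)%:R) & f r = c]].

Definition UC (x0 : T) : pred (seq T) := nbwalk x0.

(* spectrum of H_{G~} on l^2(V(G~)) (as a subset of R; H is self-adjoint) *)
Definition in_spectrum (x0 : T) (lam : R) : Prop :=
  ~ (forall g, l2 (UC x0) g -> exists! f, l2 (UC x0) f /\
       forall s, UC x0 s -> Hop x0 (UC x0) f s - (lam%:C)%C * f s = g s).

Definition spectrum (x0 : T) : set R := [set lam | in_spectrum x0 lam].

Definition dist_spectrum (x0 : T) (lam : R) : R :=
  inf [set `|lam - s| | s in spectrum x0].

(* For the oriented edge (x,y): lifts x~ = [::] (root of the cover rooted at
   x) and y~ = [:: y]; the component of x~ in the tree with the edge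
   {x~,y~} removed is the set of walks not starting with the step to y. *)
Definition subtree (x y : T) : pred (seq T) :=
  fun s => nbwalk x s && ((s == [::]) || (head x s != y)).

Definition zeta (x y : T) (g : R[i]) : R[i] :=
  - resolvent_entry x (subtree x y) [::] g.

Definition zeta_limit (x y : T) (lam : R) (c : R[i]) : Prop :=
  ((fun eta : R => complex.Re (zeta x y (lam +i* eta)%C)) @ 0^'+ --> complex.Re c) /\
  ((fun eta : R => complex.Im (zeta x y (lam +i* eta)%C)) @ 0^'+ --> complex.Im c).

(* mu is the spectral measure of H_{G~} at the vertex v: its Stieltjes
   transform int dmu(t)/(t - gamma) is the resolvent entry
   (H_{G~} - gamma)^{-1}(v,v), for all gamma = a + i b, b > 0
   (real and imaginary parts written separately) *)
Definition is_spectral_measure (x0 : T) (v : seq T)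
  (mu : {measure set (measurableTypeR R) -> \bar R}) : Prop :=
  forall a b : R, 0 < b ->
    (\int[mu]_t ((t - a) / ((t - a) ^+ 2 + b ^+ 2))%:E
       = (complex.Re (resolvent_entry x0 (UC x0) v (a +i* b)%C))%:E)%E /\
    (\int[mu]_t (b / ((t - a) ^+ 2 + b ^+ 2))%:E
       = (complex.Im (resolvent_entry x0 (UC x0) v (a +i* b)%C))%:E)%E.

(* the spectrum of H_{G~} in ]a,b[ is (purely) absolutely continuous: all
   spectral measures at vertices (which span l^2) are absolutely
   continuous w.r.t. Lebesgue measure on ]a,b[ *)
Definition ac_spectrum_on (x0 : T) (a b : R) : Prop :=
  forall v, UC x0 v ->
  forall mu, is_spectral_measure x0 v mu ->
  forall A : set (measurableTypeR R), measurable A -> A `<=` `]a, b[ ->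
    (lebesgue_measure A = 0)%E -> (mu A = 0)%E.

Definition bulk_spectrum (x0 : T) (lam : R) : Prop :=
  (exists a b : R, [/\ a < lam < b, `]a, b[ `<=` spectrum x0 &
                       ac_spectrum_on x0 a b]) /\
  (forall x y, adj x y -> exists c, zeta_limit x y lam c /\ complex.Im c != 0).

Definition is_z_lambda (lam z : R) : Prop :=
  (exists x y c, [/\ adj x y, zeta_limit x y lam c & z = `|complex.Im c|]) /\
  (forall x y c, adj x y -> zeta_limit x y lam c -> z <= `|complex.Im c|).

End UniversalCover.

Definition sup_norm (R : realType) (T : finType) (psi : T -> R[i]) : R :=
  \big[Num.max/0]_(x : T) ComplexField.Normc.normc (psi x).

Definition l2_norm_sq (R : realType) (T : finType) (psi : T -> R[i]) : R :=
  \sum_(x : T) ((complex.Re (psi x)) ^+ 2 + (complex.Im (psi x)) ^+ 2).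

(* Main.v *)
Require Import Defs.
From HB Require Import structures.
From mathcomp Require Import all_boot all_order all_algebra.
From mathcomp Require Import all_classical all_reals all_analysis.
From mathcomp Require Import complex.
From mathcomp Require Import ring lra zify.
Import Order.TTheory GRing.Theory Num.Theory numFieldNormedType.Exports.
Local Open Scope ring_scope.

Set Implicit Arguments.
Unset Strict Implicit.
Unset Printing Implicit Defensive.

(* (1) Write Z(u,v) for the boundary value of zeta_u(v) and I = -Im Z > 0.  The
   recursion 1/Z(w,v) = lam - W(v) - sum_{u ~ v, u <> w} Z(v,u) makes
   f(u,v) = psi(v) - Z(u,v) psi(u) satisfy f(w,v) = Z(w,v) sum_{u <> w} f(v,u), and
   its imaginary part reads I(w,v) = |Z(w,v)|^2 sum_{u <> w} I(v,u).  By
   Cauchy-Schwarz, F = |f|^2 / I is bounded at an edge by the sum of its values at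
   the ends of the non-backtracking walks of any fixed length k continuing that
   edge.  If the ball is a tree these ends are all distinct, and summing over
   k < h gives h F <= sum F, which is of order D / z; psi(x) is recovered from f on
   the two orientations of an edge at x.  If the ball contains a cycle, walks are
   stopped at one of its edges {a,b}; since b can be chosen of degree at least 3,
   each turn around the cycle costs a factor sqrt(1 - z^2), which bounds F(a,b) by
   4 z^-4 times the sum over walks that do not return.

   (2) A Combes-Thomas argument: psi lifted to the cover and cut off at distance
   ell from a lift of x is multiplied by rho^-distance.  The conjugated operator
   differs from H by at most delta/2 in norm, H - lam is bounded below by delta,
   and (H - lam) applied to the cut-off function lives on two spheres, which cover
   each vertex of G at most three times (up to the last step). *)

(** * Self-adjoint operators on a real Hilbert space *)

(** The spectrum is defined as failure of unique solvability in l2, so the lower bound delta in (2)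
    has to come from bare bijectivity, without functional calculus: a symmetric operator that is
    onto is bounded below, and its best lower bound is the distance to a spectral point. Complex l2
    is used as a real Hilbert space, with multiplication by i as a skew operator. In (1) the
    obstacle is the cycle. Stopping walks at {a,b} leaves terms in F(a,b) and F(b,a), and for the
    squares F the inequality around the cycle may return with coefficient 1 and say nothing. The
    amplitudes |f| / sqrt I instead return with the product of the weights sqrt(I(w,y) / S) along
    the way, S being the sum of I over the continuations; one weight is at most ka = sqrt(1 - z^2),
    and 1 - ka >= z^2 / 2. A restart at the cut edge may already be far from the starting point, so
    only lengths below floor(ell/2) + 1 are used: both pieces of a walk then fit into the ball. *)

Section Hilbert.
Variables (R : realType) (E : lmodType R) (dot : E -> E -> R).

Hypothesis dotC : forall u v, dot u v = dot v u.
Hypothesis dotDl : forall u v w, dot (u + v) w = dot u w + dot v w.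
Hypothesis dotZl : forall a u v, dot (a *: u) v = a * dot u v.
Hypothesis dot_ge0 : forall u, 0 <= dot u u.
Hypothesis dot_eq0 : forall u, dot u u = 0 -> u = 0.

Definition nrm (u : E) : R := Num.sqrt (dot u u).

(** Completeness only for geometrically small increments, with the tail of the geometric series as
    rate; both limits constructed below are of this kind. *)
Hypothesis complete : forall (g : nat -> E) (C q : R), 0 <= q < 1 ->
  (forall k, nrm (g k.+1 - g k) <= C * q ^+ k) ->
  exists l, forall k, nrm (l - g k) <= C * q ^+ k / (1 - q).

Lemma dotDr u v w : dot u (v + w) = dot u v + dot u w.
Proof. by rewrite dotC dotDl !(dotC u). Qed.

Lemma dotZr a u v : dot u (a *: v) = a * dot u v.
Proof. by rewrite dotC dotZl dotC. Qed.

Lemma dotNl u v : dot (- u) v = - dot u v.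
Proof. by rewrite -scaleN1r dotZl mulN1r. Qed.

Lemma dotNr u v : dot u (- v) = - dot u v.
Proof. by rewrite dotC dotNl dotC. Qed.

Lemma dotBl u v w : dot (u - v) w = dot u w - dot v w.
Proof. by rewrite dotDl dotNl. Qed.

Lemma dotBr u v w : dot u (v - w) = dot u v - dot u w.
Proof. by rewrite dotDr dotNr. Qed.

Definition dotE := (dotDl, dotDr, dotZl, dotZr, dotNl, dotNr).

Lemma nrm_ge0 u : 0 <= nrm u. Proof. exact: sqrtr_ge0. Qed.

Lemma sqr_nrm u : nrm u ^+ 2 = dot u u.
Proof. exact: sqr_sqrtr (dot_ge0 u). Qed.

Lemma nrm_gt0 u : u <> 0 -> 0 < nrm u.
Proof.
move=> u0; rewrite lt_neqAle nrm_ge0 andbT eq_sym; apply/eqP => n0.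
by apply/u0/dot_eq0; rewrite -sqr_nrm n0 expr0n.
Qed.

Lemma nrmZ a u : nrm (a *: u) = `|a| * nrm u.
Proof.
by rewrite /nrm dotZl dotZr mulrA -expr2 sqrtrM ?sqr_ge0 // sqrtr_sqr.
Qed.

Lemma nrmN u : nrm (- u) = nrm u.
Proof. by rewrite /nrm dotNl dotNr opprK. Qed.

Lemma cauchy_schwarz u v : dot u v <= nrm u * nrm v.
Proof.
have [->|/eqP u0] := eqVneq u 0.
  have d0 w : dot 0 w = 0 by rewrite -(scale0r 0) dotZl mul0r.
  by rewrite d0 mulr_ge0 ?nrm_ge0.
have [->|/eqP v0] := eqVneq v 0.
  have d0 w : dot w 0 = 0 by rewrite -(scale0r 0) dotZr mul0r.
  by rewrite d0 mulr_ge0 ?nrm_ge0.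
have a0 := nrm_gt0 u0; have b0 := nrm_gt0 v0.
have := dot_ge0 (nrm v *: u - nrm u *: v).
rewrite !dotE -!sqr_nrm (dotC v u); set a := nrm u; set b := nrm v => h.
have : 0 <= (a * b - dot u v) * (a * b) by nra.
by rewrite pmulr_lge0 ?mulr_gt0 // subr_ge0.
Qed.

Lemma cauchy_schwarz_norm u v : `|dot u v| <= nrm u * nrm v.
Proof.
rewrite ler_norml cauchy_schwarz andbT lerNl -dotNl.
by rewrite (le_trans (cauchy_schwarz _ _)) // nrmN.
Qed.

Lemma nrmD u v : nrm (u + v) <= nrm u + nrm v.
Proof.
rewrite -(ler_pXn2r (_ : 0 < 2)%N) ?nnegrE ?addr_ge0 ?nrm_ge0 //.
rewrite sqr_nrm !dotE -!sqr_nrm (dotC v u).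
by have := cauchy_schwarz u v; nra.
Qed.

Lemma nrmB_ge u v : nrm u - nrm v <= nrm (u - v).
Proof. by rewrite lerBlDr -{1}(subrK v u) nrmD. Qed.

Definition bounded_by (A : E -> E) (K : R) := forall u, nrm (A u) <= K * nrm u.
Definition bounded_below (A : E -> E) (c : R) := forall u, c * nrm u <= nrm (A u).
Definition self_adjoint (A : E -> E) := forall u v, dot (A u) v = dot u (A v).

Lemma cvg0_le (a C q : R) : 0 <= q < 1 -> (forall k, a <= C * q ^+ k) -> a <= 0.
Proof.
move=> /andP[q0 q1] h.
have c : ((fun k => C * q ^+ k) @ \oo --> (0 : R))%classic.
  by apply: cvg_geometric; rewrite ger0_norm.
rewrite -(cvg_lim _ c) //; apply: limr_ge; first by apply/cvg_ex; exists 0.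
by apply: nearW.
Qed.

(* The map u |-> u - t (A u - g) is a contraction for small t. *)
Lemma coercive_onto (A : E -> E) (K c : R) :
  (forall u v, A (u - v) = A u - A v) ->
  (forall a u, A (a *: u) = a *: A u) ->
  bounded_by A K -> 0 < c -> (forall u, c * dot u u <= dot (A u) u) ->
  forall g, exists f, A f = g.
Proof.
move=> AB AZ AK c0 Ac g.
pose M := Num.max 1 (Num.max K c).
have M1 : 1 <= M by rewrite /M le_max lexx.
have MK : K <= M by rewrite /M !le_max lexx orbT.
have Mc : c <= M by rewrite /M !le_max lexx !orbT.
(* This t minimises 1 - 2 t c + t^2 M^2, which bounds |w - t A w|^2 / |w|^2; the minimum is 1 - t
   c. *)
pose t := c / M ^+ 2.
have M20 : 0 < M ^+ 2 by rewrite exprn_gt0 // (lt_le_trans _ M1).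
have t0 : 0 < t by rewrite divr_gt0.
have tM : t * M ^+ 2 = c by rewrite /t divfK ?gt_eqF.
have tc1 : t * c <= 1.
  rewrite /t mulrAC ler_pdivrMr // mul1r -expr2 lerXn2r ?nnegrE //; lra.
pose q := Num.sqrt (1 - t * c).
have q01 : 0 <= q < 1.
  by rewrite sqrtr_ge0 /= -[ltRHS]sqrtr1 ltr_sqrt ?ltr01 // gtrBl mulr_gt0.
have contr w : nrm (w - t *: A w) <= q * nrm w.
  rewrite -(ler_pXn2r (_ : 0 < 2)%N) ?nnegrE ?mulr_ge0 ?sqrtr_ge0 ?nrm_ge0 //.
  rewrite exprMn !sqr_nrm sqr_sqrtr; last lra.
  rewrite !dotE (dotC w (A w)).
  have h1 := Ac w; have h2 := AK w.
  have h3 : dot (A w) (A w) <= M ^+ 2 * dot w w.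
    rewrite -!sqr_nrm -exprMn lerXn2r ?nnegrE ?mulr_ge0 ?nrm_ge0 //; first lra.
    by rewrite (le_trans h2) // ler_wpM2r ?nrm_ge0.
  have h4 : t * (t * dot (A w) (A w)) <= t * c * dot w w.
    rewrite -tM -2!mulrA ler_wpM2l ?(ltW t0) // mulrA.
    by rewrite -mulrA ler_wpM2l ?(ltW t0).
  have h5 : t * c * dot w w <= t * dot (A w) w by rewrite -mulrA ler_wpM2l ?(ltW t0).
  lra.
pose F u := u - t *: (A u - g).
have FB a b : F a - F b = (a - b) - t *: A (a - b).
  rewrite /F AB !scalerBr !opprB (addrC _ (- b)) addrACA; congr (_ + _).
  by rewrite addrC subrKA.
pose s k := iter k F 0.
have sd k : nrm (s k.+1 - s k) <= nrm (s 1%N - s 0%N) * q ^+ k.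
  elim: k => [|k IH]; first by rewrite expr0 mulr1.
  have -> : s k.+2 - s k.+1 = (s k.+1 - s k) - t *: A (s k.+1 - s k).
    exact: FB.
  rewrite (le_trans (contr _)) // exprS mulrCA ler_wpM2l //.
  by case/andP: q01.
have [l hl] := complete q01 sd.
exists l; apply/eqP; rewrite -subr_eq0; apply/eqP/dot_eq0; rewrite -sqr_nrm.
suff -> : nrm (A l - g) = 0 by rewrite expr0n.
apply/eqP; rewrite eq_le nrm_ge0 andbT.
pose C := nrm (s 1%N - s 0%N).
apply: (@cvg0_le _ (M * (C / (1 - q)) + C / t) q) => // k.
(* The second difference is (s_k - s_(k+1)) / t, hence also geometrically small. *)
have -> : A l - g = A (l - s k) + (A (s k) - g) by rewrite AB addrA subrK.
rewrite (le_trans (nrmD _ _)) // mulrDl lerD //.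
  rewrite (le_trans (AK _)) // -mulrA (le_trans (y := M * nrm (l - s k))) //.
    by rewrite ler_wpM2r ?nrm_ge0.
  by rewrite ler_wpM2l ?(le_trans _ M1) // mulrAC hl.
rewrite mulrAC ler_pdivlMr // mulrC -[X in X * _](gtr0_norm t0) -nrmZ.
rewrite -nrmN (le_trans _ (sd k)) //.
by rewrite [s k.+1]/= /F -/(s k) addrAC subrr add0r.
Qed.

(* Gliding hump: unit vectors u_k with S u_k = O(4^-k) assemble into
   l = sum_k +-3^-k u_k with <u_k, l> >= 3^-k / 2, so l is not in the range. *)
Lemma onto_bounded_below (S : E -> E) :
  (forall a u, S (a *: u) = a *: S u) -> self_adjoint S ->
  (forall g, exists f, S f = g) -> exists2 c, 0 < c & bounded_below S c.
Proof.
move=> SZ Ss So; apply: contrapT => nb.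
have /choice[u hu] (k : nat) :
    exists u, nrm u = 1 /\ nrm (S u) <= 4^-1 ^+ k.
  apply: contrapT => nu; apply: nb; exists (4^-1 ^+ k); first by rewrite exprn_gt0.
  move=> u; have [->|/eqP u0] := eqVneq u 0.
    by rewrite -(scale0r 0) SZ !nrmZ normr0 !mul0r mulr0.
  have n0 := nrm_gt0 u0.
  rewrite leNgt; apply/negP => hlt; apply: nu; exists ((nrm u)^-1 *: u).
  rewrite SZ !nrmZ normfV (gtr0_norm n0) mulVf ?gt_eqF //; split=> //.
  by rewrite mulrC ler_pdivrMr // ltW.
pose t (k : nat) : R := 3^-1 ^+ k.
have t0 k : 0 < t k by rewrite exprn_gt0.
(* The two candidate pairings with u_k differ by 2 t_k, so one of them is at least t_k in absolute
   value. *)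
pose stp k v := if t k <= `|dot (u k) (v + t k *: u k)| then v + t k *: u k
               else v - t k *: u k.
pose g := fix g k := if k is k'.+1 then stp k' (g k') else 0.
have uu k : dot (u k) (u k) = 1 by rewrite -sqr_nrm (hu k).1 expr1n.
have g1 k : t k <= `|dot (u k) (g k.+1)|.
  rewrite /= /stp; case: ifPn => //; rewrite -ltNge !dotE uu mulr1.
  rewrite ltr_norml => /andP[h1 h2].
  by rewrite ler0_norm; have := t0 k; lra.
have gd k : nrm (g k.+1 - g k) <= 1 * 3^-1 ^+ k.
  rewrite /= /stp mul1r; case: ifPn => _; rewrite addrAC subrr add0r ?nrmN nrmZ.
    by rewrite (hu k).1 gtr0_norm ?mulr1.
  by rewrite (hu k).1 gtr0_norm ?mulr1.
have q01 : 0 <= (3^-1 : R) < 1 by rewrite invr_ge0 invf_lt1 ?ltr0n ?ler0n ?ltr1n.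
have [l hl] := complete q01 gd.
have [h hS] := So l.
have key k : 1 <= (2 * nrm h) * (3 / 4) ^+ k.
  have a1 : `|dot (u k) l| <= 4^-1 ^+ k * nrm h.
    rewrite -hS -Ss (le_trans (cauchy_schwarz_norm _ _)) //.
    by rewrite ler_wpM2r ?nrm_ge0 // (hu k).2.
  (* The tail 3^-(k+1) / (1 - 1/3) is half of t_k, so half of the pairing survives in the limit. *)
  have a2 : `|dot (u k) (l - g k.+1)| <= t k / 2.
    rewrite (le_trans (cauchy_schwarz_norm _ _)) // (hu k).1 mul1r.
    rewrite (le_trans (hl _)) // exprS -/(t k).
    have -> : (1 - 3^-1 : R) = 2 / 3 by lra.
    by rewrite invf_div; have := t0 k; lra.
  have a3 : t k <= 2 * (4^-1 ^+ k * nrm h).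
    have := g1 k; have -> : g k.+1 = l - (l - g k.+1) by rewrite opprB addrC subrK.
    rewrite dotBr => /le_trans/(_ (ler_normB _ _)) a4.
    have {}a4 := le_trans a4 (lerD a1 a2).
    lra.
  have p3 : 0 < (3 : R) ^+ k by rewrite exprn_gt0.
  have : 3 ^+ k * t k <= 3 ^+ k * (2 * (4^-1 ^+ k * nrm h)) by rewrite ler_pM2l.
  by rewrite /t -exprMn mulfV // expr1n exprMn; nra.
have q34 : 0 <= (3 / 4 : R) < 1 by apply/andP; split; lra.
by have := cvg0_le q34 key; rewrite ler10.
Qed.

(** * Distance to the spectrum of a bounded symmetric operator *)

Section Gap.
Variables (A : E -> E) (K : R).
Hypothesis AB : forall u v, A (u - v) = A u - A v.
Hypothesis AZ : forall a u, A (a *: u) = a *: A u.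
Hypothesis AK : bounded_by A K.
Hypothesis Asym : self_adjoint A.

Definition shift (s : R) (u : E) : E := A u - s *: u.
Definition resolvent_pt (s : R) : Prop := forall g, exists! f, shift s f = g.

Lemma shiftB s u v : shift s (u - v) = shift s u - shift s v.
Proof. by rewrite /shift AB scalerBr !opprB addrACA [RHS]addrACA (addrC (- A v)). Qed.

Lemma shiftZ s a u : shift s (a *: u) = a *: shift s u.
Proof. by rewrite /shift AZ scalerBr !scalerA mulrC. Qed.

Lemma shift_sym s : self_adjoint (shift s).
Proof. by move=> u v; rewrite /shift dotBl dotBr Asym dotZl dotZr. Qed.

Lemma shift_bounded s : bounded_by (shift s) (K + `|s|).
Proof.
move=> u; rewrite (le_trans (nrmD _ _)) // nrmN nrmZ mulrDl lerD2r; exact: AK.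
Qed.

Lemma shift_comm s t u : shift s (shift t u) = shift t (shift s u).
Proof.
rewrite /shift !AB !AZ !scalerBr !opprB !scalerA (mulrC s t).
by rewrite addrACA [RHS]addrACA (addrC (- (t *: A u))).
Qed.

Lemma resolvent_bounded_below s :
  resolvent_pt s -> exists2 c, 0 < c & bounded_below (shift s) c.
Proof.
move=> rs; apply: onto_bounded_below; [exact: shiftZ|exact: shift_sym|].
by move=> g; have [f [fg _]] := rs g; exists f.
Qed.

(** [shift s] need not be positive, but its square is coercive with constant c^2; if the square maps
    f to g, then [shift s f] is the solution sought. *)
Lemma bounded_below_resolvent s c :
  0 < c -> bounded_below (shift s) c -> resolvent_pt s.
Proof.
move=> c0 hc g.
have [f ff] : exists f, shift s (shift s f) = g.
  apply: (@coercive_onto (fun u => shift s (shift s u)) ((K + `|s|) ^+ 2) (c ^+ 2)).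
  - by move=> u v; rewrite !shiftB.
  - by move=> a u; rewrite !shiftZ.
  - move=> u; have [K0|K0] := leP 0 (K + `|s|).
      rewrite (le_trans (shift_bounded _ _)) // expr2 -mulrA ler_wpM2l //.
      exact: shift_bounded.
    rewrite (le_trans (shift_bounded _ _)) //.
    apply: (@le_trans _ _ 0); first by rewrite nmulr_rle0 // nrm_ge0.
    by rewrite mulr_ge0 ?sqr_ge0 ?nrm_ge0.
  - by rewrite exprn_gt0.
  - move=> u; rewrite shift_sym -!sqr_nrm -exprMn lerXn2r ?nnegrE ?nrm_ge0 ?mulr_ge0 ?nrm_ge0 //.
    exact: ltW.
exists (shift s f); split => // f' f'g.
apply/eqP; rewrite -subr_eq0; apply/eqP/dot_eq0; rewrite -sqr_nrm.
suff -> : nrm (shift s f - f') = 0 by rewrite expr0n.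
apply/eqP; rewrite eq_le nrm_ge0 andbT -(pmulr_rle0 _ c0).
rewrite (le_trans (hc _)) // shiftB ff f'g subrr.
by rewrite -(scale0r 0) nrmZ normr0 mul0r.
Qed.

(* With m the infimum of |(A - lam) u| over unit vectors, (A - lam)^2 - m^2 is a
   nonnegative operator that is not bounded below; it factors through
   A - (lam + m) and A - (lam - m), so one of these points is in the spectrum. *)
Lemma spectral_gap (lam : R) (e : E) : e <> 0 -> resolvent_pt lam ->
  let X := [set `|lam - s| | s in [set s | ~ resolvent_pt s]]%classic in
  0 < inf X /\ forall u, inf X * nrm u <= nrm (shift lam u).
Proof.
move=> e0 rl X.
have [c c0 hc] := resolvent_bounded_below rl.
pose Y := [set nrm (shift lam u) | u in [set u | nrm u = 1]]%classic.
have Y0 : (Y !=set0)%classic.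
  exists (nrm (shift lam ((nrm e)^-1 *: e))), ((nrm e)^-1 *: e) => //=.
  by rewrite nrmZ normfV (gtr0_norm (nrm_gt0 e0)) mulVf // gt_eqF ?nrm_gt0.
have Yc : lbound Y c.
  by move=> _ [u /= u1 <-]; have := hc u; rewrite u1 mulr1.
have Yi : has_inf Y by split => //; exists c.
pose m := inf Y.
have cm : c <= m by apply: lb_le_inf.
have m0 : 0 < m := lt_le_trans c0 cm.
have hm u : m * nrm u <= nrm (shift lam u).
  have [->|/eqP u0] := eqVneq u 0.
    by rewrite -(scale0r 0) shiftZ !nrmZ normr0 !mul0r mulr0.
  have n0 := nrm_gt0 u0.
  rewrite -ler_pdivlMr // mulrC -{1}(gtr0_norm n0) -normfV -nrmZ -shiftZ.
  apply: (ge_inf Yi.2); exists ((nrm u)^-1 *: u) => //=.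
  by rewrite nrmZ normfV gtr0_norm // mulVf ?gt_eqF.
(* A point closer to lam than m inherits a positive lower bound and is therefore not spectral. *)
have Xm : lbound X m.
  move=> _ [s /= ns <-]; rewrite leNgt; apply/negP => lt; apply: ns.
  apply: (@bounded_below_resolvent s (m - `|lam - s|)); first by rewrite subr_gt0.
  move=> u; have -> : shift s u = shift lam u - (s - lam) *: u.
    by rewrite /shift scalerBl opprB subrKA.
  by apply: le_trans (nrmB_ge _ _); rewrite mulrBl lerB // nrmZ distrC.
have : X m.
  apply: contrapT => nX.
  have rp : resolvent_pt (lam + m).
    apply: contrapT => nr; apply: nX; exists (lam + m) => //.
    by rewrite opprD addNKr normrN gtr0_norm.
  have rm : resolvent_pt (lam - m).
    apply: contrapT => nr; apply: nX; exists (lam - m) => //.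
    by rewrite opprB addrC subrK gtr0_norm.
  have [c1 c10 h1] := resolvent_bounded_below rp.
  have [c2 c20 h2] := resolvent_bounded_below rm.
  have [T TE] : {T : E -> E | forall u, T u = shift (lam + m) (shift (lam - m) u)}.
    by exists (fun u => shift (lam + m) (shift (lam - m) u)).
  have Ts : self_adjoint T by move=> u v; rewrite !TE !shift_sym shift_comm.
  have TB u v : T (u - v) = T u - T v by rewrite !TE !shiftB.
  have TZ a u : T (a *: u) = a *: T u by rewrite !TE !shiftZ.
  have Tu u : dot (T u) u = nrm (shift lam u) ^+ 2 - m ^+ 2 * nrm u ^+ 2.
    have e1 v : shift (lam - m) v = shift lam v + m *: v.
      by rewrite /shift scalerBl opprB addrCA addrC.
    have e2 v : shift (lam + m) v = shift lam v - m *: v.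
      by rewrite /shift scalerDl opprD addrA.
    rewrite TE shift_sym e1 e2 !sqr_nrm !dotE (dotC u (A u)); ring.
  pose K2 := (K + `|lam|) ^+ 2 + 1.
  have K20 : 0 < K2 by rewrite ltr_wpDl ?sqr_ge0.
  have TK u : dot (T u) u <= K2 * dot u u.
    rewrite Tu -sqr_nrm mulrDl mul1r -exprMn.
    have : nrm (shift lam u) ^+ 2 <= ((K + `|lam|) * nrm u) ^+ 2.
      rewrite lerXn2r ?nnegrE ?nrm_ge0 ?shift_bounded //.
      by rewrite (le_trans (nrm_ge0 (shift lam u))) ?shift_bounded.
    have := sqr_ge0 (m * nrm u); have := sqr_ge0 (nrm u).
    by rewrite exprMn; lra.
  have T0 u : 0 <= dot (T u) u.
    rewrite Tu subr_ge0 -exprMn lerXn2r ?nnegrE ?nrm_ge0 //.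
    by rewrite mulr_ge0 ?nrm_ge0 // ltW.
  (* This is T^2 <= K2 T for 0 <= T <= K2, obtained by testing positivity of T on K2 u - T u. *)
  have TT u : dot (T u) (T u) <= K2 * dot (T u) u.
    have := T0 (K2 *: u - T u); rewrite TB TZ !dotE (Ts (T u) u).
    have := TK (T u); set a := dot (T u) (T u); set b := dot (T u) u => a1 a2.
    have {}a2 : 0 <= K2 * (K2 * b - a) by lra.
    by rewrite pmulr_rge0 // subr_ge0 in a2.
  (* The gain over m^2: (c1 c2)^2 |u|^2 <= |T u|^2 <= K2 <T u, u>. It contradicts m being the
     infimum. *)
  pose ep := (c1 * c2) ^+ 2 / K2.
  have ep0 : 0 < ep by rewrite divr_gt0 ?exprn_gt0 ?mulr_gt0.
  have hb u : (m ^+ 2 + ep) * nrm u ^+ 2 <= nrm (shift lam u) ^+ 2.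
    have : (c1 * c2 * nrm u) ^+ 2 <= nrm (T u) ^+ 2.
      rewrite lerXn2r ?nnegrE ?nrm_ge0 //.
        by rewrite mulr_ge0 ?nrm_ge0 // mulr_ge0 // ltW.
      by rewrite TE (le_trans _ (h1 _)) // -mulrA ler_wpM2l ?(ltW c10).
    rewrite sqr_nrm => /le_trans/(_ (TT u)); rewrite Tu exprMn.
    have -> : (c1 * c2) ^+ 2 = ep * K2 by rewrite /ep divfK ?gt_eqF.
    move=> h; rewrite -subr_ge0 -(pmulr_rge0 _ K20); lra.
  have m'm : m < Num.sqrt (m ^+ 2 + ep).
    rewrite -{1}(gtr0_norm m0) -sqrtr_sqr ltr_sqrt ?ltrDl //.
    by rewrite addr_gt0 ?exprn_gt0.
  have := inf_adherent (_ : 0 < Num.sqrt (m ^+ 2 + ep) - m) Yi.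
  rewrite subr_gt0 => /(_ m'm) [_ [u /= u1 <-]].
  rewrite addrC subrK ltNge => /negP; apply.
  have := hb u; rewrite u1 expr1n mulr1 => /ler_wsqrtr.
  by rewrite sqrtr_sqr ger0_norm ?nrm_ge0.
move=> Xmm.
have -> : inf X = m.
  apply/eqP; rewrite eq_le; apply/andP; split.
    by apply: ge_inf => //; exists m.
  by apply: lb_le_inf => //; exists m.
by split.
Qed.
End Gap.

End Hilbert.

(** * Limits of finite sums, and complex numbers as pairs of reals *)

Lemma cvg_sum_seq (R : realType) (U : Type) (F : set_system U) (FF : Filter F)
    (I : Type) (r : seq I) (P : pred I) (f : I -> U -> R) (l : I -> R) :
  (forall i, P i -> f i x @[x --> F] --> l i)%classic ->
  (\sum_(i <- r | P i) f i x @[x --> F] --> \sum_(i <- r | P i) l i)%classic.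
Proof.
move=> h; elim: r => [|i r IH].
  under eq_fun do rewrite big_nil.
  by rewrite big_nil; exact: cvg_cst.
under eq_fun do rewrite big_cons.
by rewrite big_cons; case: ifPn => // Pi; apply: cvgD => //; exact: h.
Qed.

Section Complex.
Variable R : realType.
Implicit Types a b : R[i].

(** Real part of the Hermitian product; it turns complex l2 into a real Hilbert space. *)
Definition cdot a b : R := complex.Re a * complex.Re b + complex.Im a * complex.Im b.

Definition sqn a : R := complex.Re a ^+ 2 + complex.Im a ^+ 2.

Lemma cdotaa a : cdot a a = sqn a. Proof. by rewrite /cdot /sqn !expr2. Qed.

Lemma cdotC a b : cdot a b = cdot b a.
Proof. by rewrite /cdot mulrC (mulrC (complex.Im a)). Qed.

Lemma cReD a b : complex.Re (a + b) = complex.Re a + complex.Re b.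
Proof. by case: a b => [? ?] [? ?]. Qed.

Lemma cImD a b : complex.Im (a + b) = complex.Im a + complex.Im b.
Proof. by case: a b => [? ?] [? ?]. Qed.

Lemma cReN a : complex.Re (- a) = - complex.Re a. Proof. by case: a. Qed.

Lemma cImN a : complex.Im (- a) = - complex.Im a. Proof. by case: a. Qed.

Lemma cReM a b : complex.Re (a * b) =
  complex.Re a * complex.Re b - complex.Im a * complex.Im b.
Proof. by case: a b => [? ?] [? ?]. Qed.

Lemma cImM a b : complex.Im (a * b) =
  complex.Re a * complex.Im b + complex.Im a * complex.Re b.
Proof. by case: a b => [? ?] [? ?] /=; rewrite (mulrC (_ : R)). Qed.

Lemma Re_sum (I : Type) (r : seq I) (P : pred I) (f : I -> R[i]) :
  complex.Re (\sum_(i <- r | P i) f i) = \sum_(i <- r | P i) complex.Re (f i).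
Proof. by apply: (big_morph (@complex.Re R)) => // x y; rewrite cReD. Qed.

Lemma Im_sum (I : Type) (r : seq I) (P : pred I) (f : I -> R[i]) :
  complex.Im (\sum_(i <- r | P i) f i) = \sum_(i <- r | P i) complex.Im (f i).
Proof. by apply: (big_morph (@complex.Im R)) => // x y; rewrite cImD. Qed.

Definition cE := (cReD, cImD, cReN, cImN, cReM, cImM, Re_sum, Im_sum).

Lemma complex_eq a b :
  complex.Re a = complex.Re b -> complex.Im a = complex.Im b -> a = b.
Proof. by case: a b => [? ?] [? ?] /= -> ->. Qed.

Lemma sqn_ge0 a : 0 <= sqn a. Proof. by rewrite addr_ge0 ?sqr_ge0. Qed.

Lemma sqn0 : sqn 0 = 0. Proof. by rewrite /sqn /= expr0n addr0. Qed.

Lemma sqn_eq0 a : sqn a = 0 -> a = 0.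
Proof.
move=> /eqP; rewrite paddr_eq0 ?sqr_ge0 // !sqrf_eq0 => /andP[/eqP ha /eqP hb].
exact: complex_eq.
Qed.

Lemma sqnN a : sqn (- a) = sqn a.
Proof. by rewrite /sqn !cE !sqrrN. Qed.

Lemma sqnM a b : sqn (a * b) = sqn a * sqn b.
Proof. by rewrite /sqn !cE; ring. Qed.

Lemma sqn_real (c : R) : sqn (c%:C)%C = c ^+ 2.
Proof. by rewrite /sqn /= expr0n addr0. Qed.

Lemma sqnDle a b : sqn (a + b) <= 2 * (sqn a + sqn b).
Proof.
rewrite /sqn !cE; case: a b => [a1 a2] [b1 b2] /=.
have := sqr_ge0 (a1 - b1); have := sqr_ge0 (a2 - b2); nra.
Qed.

Lemma cdot_le a b : `|cdot a b| <= sqn a + sqn b.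
Proof.
rewrite /cdot /sqn ler_norml; case: a b => [a1 a2] [b1 b2] /=.
have := sqr_ge0 (a1 - b1); have := sqr_ge0 (a2 - b2).
have := sqr_ge0 (a1 + b1); have := sqr_ge0 (a2 + b2).
have := sqr_ge0 a1; have := sqr_ge0 a2.
have := sqr_ge0 b1; have := sqr_ge0 b2 => *; apply/andP; split; nra.
Qed.

Lemma sum_cauchy_schwarz (I : Type) (r : seq I) (P : pred I) (f g : I -> R) :
  (\sum_(i <- r | P i) f i * g i) ^+ 2 <=
  (\sum_(i <- r | P i) f i ^+ 2) * (\sum_(i <- r | P i) g i ^+ 2).
Proof.
set C := \sum_(i <- r | P i) f i * g i.
set A := \sum_(i <- r | P i) f i ^+ 2; set B := \sum_(i <- r | P i) g i ^+ 2.
have B0 : 0 <= B by apply: sumr_ge0 => i _; apply: sqr_ge0.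
have key x y : 0 <= x ^+ 2 * A - 2 * x * y * C + y ^+ 2 * B.
  rewrite /A /B /C !mulr_sumr -sumrB -big_split /=; apply: sumr_ge0 => i _.
  by have := sqr_ge0 (x * f i - y * g i); nra.
have [B0'|Bn0] := eqVneq B 0.
  have A0 : 0 <= A by apply: sumr_ge0 => i _; apply: sqr_ge0.
  (* With B = 0 the quadratic form at (C, A + 1) equals -(A + 2) C^2, which forces C = 0. *)
  have := key C (A + 1); rewrite B0' mulr0 addr0.
  by have := sqr_ge0 C; nra.
have Bp : 0 < B by rewrite lt_neqAle eq_sym Bn0.
have := key B C.
have -> : B ^+ 2 * A - 2 * B * C * C + C ^+ 2 * B = B * (A * B - C ^+ 2) by ring.
by rewrite pmulr_rge0 // subr_ge0.
Qed.

Lemma sqr_sum_le (I : finType) (P : pred I) (f : I -> R) :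
  (\sum_(i | P i) f i) ^+ 2 <= #|P|%:R * \sum_(i | P i) f i ^+ 2.
Proof.
have := sum_cauchy_schwarz (index_enum I) P (fun=> 1) f.
under eq_bigr do rewrite mul1r.
by under [in leRHS]eq_bigr do rewrite expr1n; rewrite sumr_const.
Qed.

Lemma sqn_sum_le (I : finType) (P : pred I) (f : I -> R[i]) :
  sqn (\sum_(i | P i) f i) <= #|P|%:R * \sum_(i | P i) sqn (f i).
Proof.
rewrite /sqn !cE big_split /= mulrDr lerD //; exact: sqr_sum_le.
Qed.

End Complex.

(** * Sums over words and the space l2 *)

Section Levels.
Variables (R : realType) (T : finType).
Implicit Types (h : seq T -> R) (s : seq T).

(** All words of length k enter, walks or not: functions vanish off their tree, so each level is a
    finite sum that can be peeled at either end. *)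
Fixpoint lev (k : nat) h : R :=
  if k is k'.+1 then \sum_(z : T) lev k' (fun s => h (z :: s)) else h [::].

Lemma lev_rcons k h : lev k.+1 h = lev k (fun s => \sum_(z : T) h (rcons s z)).
Proof.
elim: k h => [//|k IH] h.
rewrite [LHS]/=; apply: eq_bigr => z _; exact: (IH (fun s => h (z :: s))).
Qed.

Lemma lev_le k h h' : (forall s, size s = k -> h s <= h' s) -> lev k h <= lev k h'.
Proof.
elim: k h h' => [|k IH] h h' hh /=; first exact: hh.
by apply: ler_sum => z _; apply: IH => s sk; apply: hh; rewrite /= sk.
Qed.

Lemma eq_lev k h h' : (forall s, size s = k -> h s = h' s) -> lev k h = lev k h'.
Proof.
move=> hh; apply/eqP; rewrite eq_le; apply/andP.
by split; apply: lev_le => s sk; rewrite hh.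
Qed.

Lemma levD k h h' : lev k (fun s => h s + h' s) = lev k h + lev k h'.
Proof.
elim: k h h' => [//|k IH] h h' /=.
by rewrite -big_split; apply: eq_bigr => z _ /=; rewrite IH.
Qed.

Lemma levZ k a h : lev k (fun s => a * h s) = a * lev k h.
Proof.
elim: k h => [//|k IH] h /=.
by rewrite mulr_sumr; apply: eq_bigr => z _ /=; rewrite IH.
Qed.

Lemma lev0 k : lev k (fun=> 0) = 0.
Proof. by rewrite -{1}(mul0r (0 : R)) levZ mul0r. Qed.

Lemma lev_ge0 k h : (forall s, 0 <= h s) -> 0 <= lev k h.
Proof. by move=> h0; rewrite -(lev0 k); apply: lev_le => s _. Qed.

Lemma lev_norm k h : `|lev k h| <= lev k (fun s => `|h s|).
Proof.
elim: k h => [//|k IH] h /=; rewrite (le_trans (ler_norm_sum _ _ _)) //.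
by apply: ler_sum => z _; apply: IH.
Qed.

Lemma lev_ge s h : (forall s, 0 <= h s) -> h s <= lev (size s) h.
Proof.
elim: s h => [//|z s IH] h h0 /=.
rewrite (bigD1 z) //= (le_trans (IH (fun s => h (z :: s)) _)) //.
by rewrite lerDl sumr_ge0 // => i _; apply: lev_ge0.
Qed.

Lemma lev_cvg k (h : nat -> seq T -> R) h' :
  (forall s, h j s @[j --> \oo] --> h' s)%classic ->
  (lev k (h j) @[j --> \oo] --> lev k h')%classic.
Proof.
elim: k h h' => [|k IH] h h' hh /=; first exact: hh.
apply: cvg_sum_seq => z _.
exact: (IH (fun j s => h j (z :: s)) (fun s => h' (z :: s))).
Qed.

Definition psum h : R^nat := series (fun k => lev k h).

Lemma psumS h n : psum h n.+1 = psum h n + lev n h.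
Proof. by rewrite /psum /series /= big_nat_recr. Qed.

Lemma psum0 h : psum h 0 = 0. Proof. by rewrite /psum /series /= big_geq. Qed.

Lemma psum_shift h n :
  psum h n.+1 = h [::] + psum (fun s => \sum_(z : T) h (rcons s z)) n.
Proof.
elim: n => [|n IH]; first by rewrite psumS !psum0 add0r addr0.
by rewrite psumS IH lev_rcons [in RHS]psumS addrA.
Qed.

Lemma psumD h h' n : psum (fun s => h s + h' s) n = psum h n + psum h' n.
Proof.
elim: n => [|n IH]; first by rewrite !psum0 addr0.
by rewrite !psumS IH levD addrACA.
Qed.

Lemma psumZ a h n : psum (fun s => a * h s) n = a * psum h n.
Proof.
elim: n => [|n IH]; first by rewrite !psum0 mulr0.
by rewrite !psumS IH levZ mulrDr.
Qed.

Lemma psum_le h h' n : (forall s, h s <= h' s) -> psum h n <= psum h' n.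
Proof.
move=> hh; elim: n => [|n IH]; first by rewrite !psum0.
by rewrite !psumS lerD // lev_le.
Qed.

Lemma psum_ge0 h n : (forall s, 0 <= h s) -> 0 <= psum h n.
Proof.
move=> h0; elim: n => [|n IH]; first by rewrite psum0.
by rewrite psumS addr_ge0 // lev_ge0.
Qed.

Lemma psum_nd h : (forall s, 0 <= h s) -> nondecreasing_seq (psum h).
Proof.
by move=> h0; apply/nondecreasing_seqP => n; rewrite psumS lerDl lev_ge0.
Qed.

Lemma psum_ge s h n : (forall s, 0 <= h s) -> (size s < n)%N -> h s <= psum h n.
Proof.
move=> h0 sn; apply: (@le_trans _ _ (psum h (size s).+1)); last exact: psum_nd.
by rewrite psumS (le_trans (lev_ge s h0)) // lerDr psum_ge0.
Qed.

Lemma psum_cvg n (h : nat -> seq T -> R) h' :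
  (forall s, h j s @[j --> \oo] --> h' s)%classic ->
  (psum (h j) n @[j --> \oo] --> psum h' n)%classic.
Proof.
move=> hh; rewrite /psum /series /=.
apply: (@cvg_sum_seq _ _ _ _ _ _ _ (fun k j => lev k (h j))) => k _; exact: lev_cvg.
Qed.

Definition summ h := exists M, forall n, psum (fun s => `|h s|) n <= M.

Lemma summ_cvg h : summ h -> cvgn (psum h).
Proof.
move=> [M hM]; apply: (@normed_cvg R).
have c : cvgn (psum (fun s => `|h s|)).
  apply: nondecreasing_is_cvgn; first by apply: psum_nd => s.
  by exists M => _ [n _ <-].
apply: series_le_cvg c => n //=; first by apply: lev_ge0.
exact: lev_norm.
Qed.

Definition tot h : R := limn (psum h).

Lemma tot_le h M : summ h -> (forall n, psum h n <= M) -> tot h <= M.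
Proof. by move=> /summ_cvg c hM; apply: limr_le => //; apply: nearW. Qed.

Lemma tot_ge h n : (forall s, 0 <= h s) -> summ h -> psum h n <= tot h.
Proof. by move=> h0 /summ_cvg c; apply: nondecreasing_cvgn_le => //; apply: psum_nd. Qed.

Lemma tot_ge0 h : (forall s, 0 <= h s) -> summ h -> 0 <= tot h.
Proof. by move=> h0 sh; rewrite -(psum0 h); apply: tot_ge. Qed.

Lemma tot_ge1 h s : (forall s, 0 <= h s) -> summ h -> h s <= tot h.
Proof.
by move=> h0 sh; apply: le_trans (tot_ge (size s).+1 h0 sh); apply: psum_ge.
Qed.

Lemma totD h h' : summ h -> summ h' -> tot (fun s => h s + h' s) = tot h + tot h'.
Proof.
move=> /summ_cvg ch /summ_cvg ch'; rewrite /tot.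
have -> : psum (fun s => h s + h' s) = psum h \+ psum h'.
  by apply/funext => n; rewrite psumD.
exact: limD.
Qed.

Lemma totZ a h : summ h -> tot (fun s => a * h s) = a * tot h.
Proof.
move=> /summ_cvg ch; rewrite /tot.
have -> : psum (fun s => a * h s) = (fun n => a * psum h n).
  by apply/funext => n; rewrite psumZ.
by apply: cvg_lim => //; apply: cvgMr.
Qed.

(** Every word other than the root is a child of exactly one word. *)
Lemma tot_shift h : summ h -> summ (fun s => \sum_(z : T) h (rcons s z)) ->
  tot h = h [::] + tot (fun s => \sum_(z : T) h (rcons s z)).
Proof.
move=> /summ_cvg ch /summ_cvg ch'; rewrite /tot.
apply/cvg_lim => //; rewrite -(cvg_shiftS (psum h)).
have -> : (fun n => psum h n.+1) =
    (fun n => h [::] + psum (fun s => \sum_(z : T) h (rcons s z)) n).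
  by apply/funext => n; rewrite psum_shift.
by apply: cvgD => //; exact: cvg_cst.
Qed.

Lemma summ_le h h' : (forall s, `|h s| <= h' s) -> summ h' -> summ h.
Proof.
move=> hh [M hM]; exists M => n; apply: le_trans (hM n); apply: psum_le => s.
by rewrite (le_trans (hh s)) // ler_norm.
Qed.

Lemma summD h h' : summ h -> summ h' -> summ (fun s => h s + h' s).
Proof.
move=> [M hM] [M' hM']; exists (M + M') => n.
apply: le_trans (lerD (hM n) (hM' n)); rewrite -psumD; apply: psum_le => s.
exact: ler_normD.
Qed.

Lemma summZ a h : summ h -> summ (fun s => a * h s).
Proof.
move=> [M hM]; exists (`|a| * M) => n.
rewrite (le_trans (y := psum (fun s => `|a| * `|h s|) n)) //.
  by apply: psum_le => s; rewrite normrM.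
by rewrite psumZ ler_wpM2l.
Qed.

End Levels.

Lemma ler_sum_uniq (R : realDomainType) (I : eqType) (r r' : seq I) (h : I -> R) :
  uniq r -> {subset r <= r'} -> (forall i, 0 <= h i) ->
  \sum_(i <- r) h i <= \sum_(i <- r') h i.
Proof.
elim: r r' => [|x r IH] r' /=; first by move=> _ _ h0; rewrite big_nil sumr_ge0.
move=> /andP[xr ur] sub h0; rewrite big_cons.
rewrite (perm_big _ (perm_to_rem (sub _ (mem_head x r)))) /= big_cons lerD2l.
apply: IH => // y yr.
have : y \in x :: rem x r'.
  by rewrite -(perm_mem (perm_to_rem (sub _ (mem_head x r)))) sub // inE yr orbT.
by rewrite inE => /predU1P[yx|//]; rewrite -yx yr in xr.
Qed.

(** * Partial sums by length and the extended sum in [l2] *)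

Section Words.
Variables (R : realType) (T : finType).

Fixpoint words (k : nat) : seq (seq T) :=
  if k is k'.+1 then [seq z :: s | z <- enum T, s <- words k'] else [:: [::]].

Lemma mem_words k s : (s \in words k) = (size s == k).
Proof.
elim: k s => [|k IH] s /=; first by rewrite inE -size_eq0.
apply/allpairsP/idP => [[[z t] /= [_ ht ->]]|]; first by rewrite /= eqSS -IH.
by case: s => [//|z s]; rewrite /= eqSS -IH => h; exists (z, s); rewrite mem_enum.
Qed.

Lemma words_uniq k : uniq (words k).
Proof.
elim: k => [//|k IH] /=; apply: allpairs_uniq => //; first exact: enum_uniq.
by move=> [a b] [c d] _ _ /= [-> ->].
Qed.

Lemma lev_words k (h : seq T -> R) : lev k h = \sum_(s <- words k) h s.
Proof.
elim: k h => [|k IH] h /=; first by rewrite big_seq1.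
by rewrite big_allpairs_dep big_enum /=; apply: eq_bigr => z _; rewrite IH.
Qed.

Fixpoint allw (n : nat) : seq (seq T) :=
  if n is n'.+1 then allw n' ++ words n' else [::].

Lemma mem_allw n s : (s \in allw n) = (size s < n)%N.
Proof.
elim: n => [|n IH] /=; first by rewrite in_nil ltn0.
by rewrite mem_cat IH mem_words ltnS [in RHS]leq_eqVlt orbC.
Qed.

Lemma allw_uniq n : uniq (allw n).
Proof.
elim: n => [//|n IH] /=; rewrite cat_uniq IH words_uniq andbT /=.
by apply/hasPn => s; rewrite mem_words mem_allw => /eqP ->; rewrite ltnn.
Qed.

Lemma psum_allw n (h : seq T -> R) : psum h n = \sum_(s <- allw n) h s.
Proof.
elim: n => [|n IH]; first by rewrite psum0 big_nil.
by rewrite psumS IH lev_words big_cat.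
Qed.

(** Every finite set of words lies in some [allw n], so the supremum defining the extended sum is
    that of the partial sums by length. *)
Lemma l2P (V : pred (seq T)) (f : seq T -> R[i]) :
  l2 V f <-> (forall s, ~~ V s -> f s = 0) /\ summ (fun s => sqn (f s)).
Proof.
have sq0 s : `|sqn (f s)| = sqn (f s) by rewrite ger0_norm ?sqn_ge0.
split=> -[fV hf]; split => //.
- set e := (esum _ _) in hf.
  have e0 : (0 <= e)%E by apply: esum_ge0 => s _; rewrite lee_fin sqn_ge0.
  exists (fine e) => n; rewrite -lee_fin fineK ?ge0_fin_numE //.
  rewrite psum_allw -sumEFin.
  rewrite fsbig_seq; last exact: allw_uniq.
  apply: ereal_sup_ubound; exists [set` allw n]%classic; first by split; [exact: finite_seq|].
  by apply: eq_fsbigr => s _; rewrite sq0.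
- case: hf => M hM; apply: (@le_lt_trans _ _ M%:E); last exact: ltry.
  apply: ub_ereal_sup => _ [A [fA _] <-].
  rewrite fsbig_finite //= sumEFin lee_fin.
  pose n := (\max_(s <- finmap.enum_fset (fset_set A)) size s).+1.
  apply: le_trans (hM n); rewrite psum_allw.
  under [leRHS]eq_bigr do rewrite sq0.
  apply: ler_sum_uniq => [|s sA|s]; [exact: finmap.fset_uniq| |exact: sqn_ge0].
  by rewrite mem_allw ltnS; apply: leq_bigmax_seq.
Qed.

End Words.

(** * The real Hilbert space of l2 functions on a set of words *)

Section L2space.
Variables (R : realType) (T : finType) (V : pred (seq T)).
Implicit Types f g : seq T -> Rcomplex R.

(** [Rcomplex R] is the real vector space underlying R[i], which makes l2 a submodule over R. *)
Definition inL2 : {pred seq T -> Rcomplex R} :=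
  fun f => `[< (forall s, ~~ V s -> f s = 0) /\ summ (fun s => sqn (f s)) >].

Lemma inL2P f : reflect (l2 V f) (f \in inL2).
Proof. by apply: (iffP (asboolP _)) => /l2P. Qed.

Lemma sqnZ (a : R) (x : Rcomplex R) : sqn (a *: x) = a ^+ 2 * sqn x.
Proof. by case: x => x y; rewrite /sqn /=; ring. Qed.

Fact inL2_submod_closed : submod_closed inL2.
Proof.
split=> [|a u v /asboolP[uV su] /asboolP[vV sv]].
  apply/asboolP; split => //; exists 0 => n.
  rewrite (_ : (fun s => _) = (fun=> 0 * 0)) ?psumZ ?mul0r //.
  by apply/funext => s; rewrite [X in `|X|]sqn0 normr0.
apply/asboolP; split.
  by move=> s nVs; rewrite /= -[LHS]/(a *: u s + v s) uV // vV // scaler0 addr0.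
apply: (@summ_le _ _ _ (fun s => (2 * a ^+ 2) * sqn (u s) + 2 * sqn (v s))).
  move=> s; rewrite ger0_norm ?sqn_ge0 // -[X in sqn X]/(a *: u s + v s).
  apply: (le_trans (sqnDle (a *: u s : Rcomplex R) (v s))).
  by rewrite (sqnZ a (u s)) mulrDr mulrA.
by apply: summD; apply: summZ.
Qed.

HB.instance Definition _ :=
  GRing.isSubmodClosed.Build R (seq T -> Rcomplex R) inL2 inL2_submod_closed.

Record l2t := L2t { l2v :> seq T -> Rcomplex R; _ : l2v \in inL2 }.

HB.instance Definition _ := [isSub for l2v].
HB.instance Definition _ := [Choice of l2t by <:].
HB.instance Definition _ := [SubChoice_isSubLmodule of l2t by <:].

Implicit Types u v w : l2t.

Lemma l2t_l2 u : l2 V u.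
Proof. by case: u => f /= /inL2P. Qed.

Lemma l2t_summ u : summ (fun s => sqn (u s)).
Proof. by case/l2P: (l2t_l2 u). Qed.

Lemma l2t_off u s : ~~ V s -> u s = 0.
Proof. by case/l2P: (l2t_l2 u) => + _; apply. Qed.

Lemma l2tP u v : (forall s, u s = v s) -> u = v.
Proof. by move=> h; apply: val_inj; apply/funext. Qed.

Lemma l2tD u v s : (u + v) s = u s + v s. Proof. by []. Qed.
Lemma l2tN u s : (- u) s = - u s. Proof. by []. Qed.
Lemma l2tZ a u s : (a *: u) s = (a%:C)%C * u s.
Proof. by rewrite -[LHS]/(a *: u s); case: (u s) => x y; apply: complex_eq; rewrite /= !(mul0r, subr0, addr0). Qed.

Definition mkl2 f (lf : l2 V f) : l2t := L2t (introT (inL2P f) lf).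

Definition dot u v : R := tot (fun s => cdot (u s) (v s)).

Lemma dot_summ u v : summ (fun s => cdot (u s) (v s)).
Proof.
apply: (@summ_le _ _ _ (fun s => sqn (u s) + sqn (v s))).
  by move=> s; apply: cdot_le.
by apply: summD; apply: l2t_summ.
Qed.

Lemma dotC u v : dot u v = dot v u.
Proof. by rewrite /dot; congr tot; apply/funext => s; rewrite cdotC. Qed.

Lemma dotDl u v w : dot (u + v) w = dot u w + dot v w.
Proof.
rewrite /dot -totD; [|exact: dot_summ|exact: dot_summ].
by congr tot; apply/funext => s; rewrite l2tD /cdot !cE; ring.
Qed.

Lemma dotZl a u v : dot (a *: u) v = a * dot u v.
Proof.
rewrite /dot -totZ; last exact: dot_summ.
by congr tot; apply/funext => s; rewrite l2tZ /cdot !cE /=; ring.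
Qed.

Lemma dot_sqn u : dot u u = tot (fun s => sqn (u s)).
Proof. by rewrite /dot; congr tot; apply/funext => s; rewrite cdotaa. Qed.

Lemma dot_ge0 u : 0 <= dot u u.
Proof. by rewrite dot_sqn; apply: tot_ge0 => [s|]; [exact: sqn_ge0|exact: l2t_summ]. Qed.

Lemma sqn_le_dot u s : sqn (u s) <= dot u u.
Proof.
rewrite dot_sqn; apply: (@tot_ge1 _ _ (fun s => sqn (u s)) s) => [t|].
  exact: sqn_ge0.
exact: l2t_summ.
Qed.

Lemma dot_eq0 u : dot u u = 0 -> u = 0.
Proof.
move=> d0; apply: l2tP => s; apply: (@sqn_eq0 R).
by apply/eqP; rewrite eq_le sqn_ge0 andbT -d0 sqn_le_dot.
Qed.

Local Notation nrm := (nrm dot).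

Lemma geom_cvg (a : nat -> R) (C q : R) : 0 <= q < 1 ->
  (forall k, `|a k.+1 - a k| <= C * q ^+ k) -> cvgn a.
Proof.
move=> /andP[q0 q1] h.
have -> : a = (fun n => a 0%N + series (telescope a) n).
  by apply/funext => n; rewrite -eq_sum_telescope.
apply: is_cvgD; first exact: is_cvg_cst.
apply: (@normed_cvg R).
have c : cvgn (series (geometric C q)).
  by apply: is_cvg_geometric_series; rewrite ger0_norm.
apply: series_le_cvg c => n //=; last exact: h.
by apply: le_trans (h n).
Qed.

(** The limit is taken pointwise. Its norm bound is checked on the finitely many words shorter than
    n, where sum and limit commute, uniformly in n. *)
Lemma l2_complete (g : nat -> l2t) (C q : R) : 0 <= q < 1 ->
  (forall k, nrm (g k.+1 - g k) <= C * q ^+ k) ->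
  exists l, forall k, nrm (l - g k) <= C * q ^+ k / (1 - q).
Proof.
move=> q01 h; have /andP[q0 q1] := q01.
have C0 : 0 <= C.
  by have := le_trans (nrm_ge0 dot _) (h 0%N); rewrite expr0 mulr1.
have q1' : 0 < 1 - q by rewrite subr_gt0.
have pt u s : `|complex.Re (u s)| <= nrm u /\ `|complex.Im (u s)| <= nrm u.
  have := sqn_le_dot u s; rewrite -(sqr_nrm dot_ge0) /sqn => hs.
  have hR := sqr_ge0 (complex.Re (u s)); have hI := sqr_ge0 (complex.Im (u s)).
  by split; rewrite -(ler_pXn2r (_ : 0 < 2)%N) ?nnegrE ?normr_ge0 ?nrm_ge0 //;
    rewrite real_normK ?num_real //; lra.
have cR s : cvgn (fun k => complex.Re (g k s)).
  apply: (geom_cvg q01) => k; apply: le_trans (h k).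
  by apply: le_trans (pt _ s).1; rewrite l2tD l2tN !cE.
have cI s : cvgn (fun k => complex.Im (g k s)).
  apply: (geom_cvg q01) => k; apply: le_trans (h k).
  by apply: le_trans (pt _ s).2; rewrite l2tD l2tN !cE.
pose l s : Rcomplex R :=
  Complex (limn (fun k => complex.Re (g k s))) (limn (fun k => complex.Im (g k s))).
have tri k i : nrm (g (k + i)%N - g k) <= C * q ^+ k / (1 - q).
  apply: (@le_trans _ _ (C * q ^+ k * (1 - q ^+ i) / (1 - q))); last first.
    rewrite ler_pM2r ?invr_gt0 // ler_piMr ?mulr_ge0 ?exprn_ge0 //.
    by rewrite gerBl exprn_ge0.
  elim: i => [|i IH].
    by rewrite addn0 subrr expr0 subrr mulr0 mul0r -(scale0r 0) (nrmZ dotC dotZl) normr0 mul0r.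
  rewrite addnS -(subrK (g (k + i)%N) (g (k + i).+1)) -addrA.
  rewrite (le_trans (nrmD dotC dotDl dotZl dot_ge0 dot_eq0 _ _)) //.
  rewrite (le_trans (lerD (h _) IH)) // ler_pdivlMr // mulrDl divfK ?gt_eqF //.
  by rewrite exprD exprS; lra.
have lb k n : psum (fun s => sqn (l s - g k s)) n <= (C * q ^+ k / (1 - q)) ^+ 2.
  have c : (psum (fun s => sqn (g (j + k)%N s - g k s)) n @[j --> \oo] -->
            psum (fun s => sqn (l s - g k s)) n)%classic.
    apply: psum_cvg => s; rewrite /sqn.
    have kR : (complex.Re (g (j + k)%N s) @[j --> \oo] --> complex.Re (l s))%classic.
      by rewrite (cvg_shiftn k (fun j => complex.Re (g j s))); exact: cR.
    have kI : (complex.Im (g (j + k)%N s) @[j --> \oo] --> complex.Im (l s))%classic.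
      by rewrite (cvg_shiftn k (fun j => complex.Im (g j s))); exact: cI.
    under eq_fun do rewrite !cE !expr2.
    by rewrite !cE !expr2; apply: cvgD; apply: cvgM; apply: cvgB => //; exact: cvg_cst.
  rewrite -(cvg_lim _ c) //; apply: limr_le; first by apply/cvg_ex; eexists; exact: c.
  apply: nearW => j.
  have nn : 0 <= C * q ^+ k / (1 - q).
    by rewrite mulr_ge0 ?invr_ge0 ?(ltW q1') // mulr_ge0 ?exprn_ge0.
  have : nrm (g (j + k)%N - g k) ^+ 2 <= (C * q ^+ k / (1 - q)) ^+ 2.
    rewrite ler_pXn2r ?nnegrE ?nrm_ge0 //.
    by rewrite addnC tri.
  apply: le_trans; rewrite (sqr_nrm dot_ge0) dot_sqn.
  by apply: (@tot_ge _ _ (fun s => sqn ((g (j + k)%N - g k) s))) => [s|];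
    [exact: sqn_ge0|exact: l2t_summ].
have ll : l2 V l.
  apply/l2P; split.
    move=> s nV; rewrite /l.
    have -> : (fun k => complex.Re (g k s)) = (fun=> 0).
      by apply/funext => k; rewrite l2t_off.
    have -> : (fun k => complex.Im (g k s)) = (fun=> 0).
      by apply/funext => k; rewrite l2t_off.
    by rewrite lim_cst.
  apply: (@summ_le _ _ _ (fun s => 2 * sqn (l s - g 0%N s) + 2 * sqn (g 0%N s))).
    move=> s; rewrite ger0_norm ?sqn_ge0 // -mulrDr.
    by apply: le_trans (sqnDle _ _); rewrite subrK.
  apply: summD; apply: summZ; last exact: l2t_summ.
  exists ((C * q ^+ 0 / (1 - q)) ^+ 2) => n; apply: le_trans (lb 0%N n).
  by apply: psum_le => s; rewrite ger0_norm ?sqn_ge0.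
exists (mkl2 ll) => k.
have nn : 0 <= C * q ^+ k / (1 - q).
  by rewrite mulr_ge0 ?invr_ge0 ?(ltW q1') // mulr_ge0 ?exprn_ge0.
rewrite -(ler_pXn2r (_ : 0 < 2)%N) ?nnegrE ?nrm_ge0 // (sqr_nrm dot_ge0) dot_sqn.
by apply: tot_le; [exact: l2t_summ|move=> n; exact: lb].
Qed.

End L2space.

(** * The Schroedinger operator on the cover *)

Section Walks.
Variables (T : finType) (adj : rel T).

Fixpoint nonback (x : T) (s : seq T) : bool :=
  if s is y :: s' then ((s' == [::]) || (head x s' != x)) && nonback y s' else true.

Lemma nonbackP d x s :
  nonback x s <->
  (forall i, (i.+2 <= size s)%N -> nth d (x :: s) i != nth d (x :: s) i.+2).
Proof.
elim: s x => [//|y s IH] x /=; split.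
  move=> /andP[h1 /IH h2] [|i]; last exact: h2.
  by case: s h1 {IH h2} => [//|z s] /= h1 _; rewrite eq_sym.
move=> h; apply/andP; split; last by apply/IH => i hi; exact: (h i.+1).
by case: s h {IH} => [//|z s] h /=; rewrite eq_sym; exact: (h 0%N).
Qed.

Lemma nbwalkE x s : nbwalk adj x s = path adj x s && nonback x s.
Proof.
rewrite /nbwalk; congr (_ && _); apply/forallP/idP => h.
  apply/(nonbackP x) => i hi; have hi' : (i < (size s).+1)%N by lia.
  by have /implyP := h (Ordinal hi'); apply.
by move=> i; apply/implyP; move/(nonbackP x): h; apply.
Qed.

Lemma nbwalk_nil x : nbwalk adj x [::].
Proof. by rewrite nbwalkE. Qed.

Lemma nbwalk_cons x y s : nbwalk adj x (y :: s) = adj x y && subtree adj y x s.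
Proof.
rewrite /subtree !nbwalkE /= -!andbA; congr (_ && _).
case: s => [|z s] /=; first by [].
by case: (adj y z) (path adj z s) (z != x) => -[] [] //=; rewrite ?andbF ?andbT.
Qed.

(** Self-similarity of the cover: the branch through a child y is again a subtree, now with x as the
    removed neighbour. The recursion for [zeta] rests on it. *)
Lemma subtree_cons x w y s :
  subtree adj x w (y :: s) = [&& adj x y, y != w & subtree adj y x s].
Proof. by rewrite {1}/subtree nbwalk_cons /= -andbA; congr (_ && _); rewrite andbC. Qed.

Lemma subtree_nil x w : subtree adj x w [::].
Proof. by rewrite /subtree nbwalk_nil. Qed.

Lemma tparent_rcons (s : seq T) z : tparent (rcons s z) = s.
Proof. by rewrite /tparent size_rcons /= -cats1 take_size_cat. Qed.

Lemma tparent_cons (y : T) s : s != [::] -> tparent (y :: s) = y :: tparent s.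
Proof. by case: s => [//|z s] _. Qed.

Lemma nbwalk_rcons x s z : nbwalk adj x (rcons s z) =
  [&& nbwalk adj x s, adj (last x s) z & (s == [::]) || (last x (tparent s) != z)].
Proof.
elim: s x => [|y s IH] x; first by rewrite /= nbwalk_cons subtree_nil nbwalk_nil andbT.
rewrite rcons_cons !nbwalk_cons /subtree IH -!andbA; congr (_ && _); congr (_ && _).
case: s {IH} => [|u s] /=; first by rewrite eq_sym.
by case: (adj _ z) (u != x) => -[]; rewrite ?andbF ?andbT.
Qed.

Lemma nbwalk_rconsW x s z : nbwalk adj x (rcons s z) -> nbwalk adj x s.
Proof. by rewrite nbwalk_rcons => /and3P[]. Qed.

End Walks.

(** * The Schroedinger operator as a bounded symmetric operator *)

Section Operator.
Variables (R : realType) (T : finType) (W : T -> R) (x : T) (V : pred (seq T)).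
Implicit Types u v w : l2t R V.

Definition par (f : seq T -> R[i]) (s : seq T) : R[i] :=
  if s == [::] then 0 else f (tparent s).

Definition chi (f : seq T -> R[i]) (s : seq T) : R[i] := \sum_(z : T) f (rcons s z).

Lemma HopE (f : seq T -> R[i]) s : (forall s, ~~ V s -> f s = 0) ->
  Hop W x V f s = (W (cover_map x s))%:C%C * f s + par f s + chi f s.
Proof.
move=> fV; rewrite /Hop /par /chi; congr (_ + _ + _).
  by case: eqP => //= _; case: ifPn => // /fV ->.
by rewrite big_mkcond; apply: eq_bigr => z _; case: ifPn => // /fV ->.
Qed.

Lemma par_psum (f : seq T -> R[i]) n :
  psum (fun s => sqn (par f s)) n <= #|T|%:R * psum (fun s => sqn (f s)) n.
Proof.
case: n => [|n]; first by rewrite !psum0 mulr0.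
rewrite psum_shift {1}/par eqxx sqn0 add0r -psumZ.
apply: (@le_trans _ _ (psum (fun s => #|T|%:R * sqn (f s)) n)); last first.
  by apply: psum_nd => // s; rewrite mulr_ge0 // sqn_ge0.
apply: psum_le => s.
rewrite (eq_bigr (fun=> sqn (f s))).
  by rewrite sumr_const mulr_natl.
by move=> z _; rewrite /par tparent_rcons; case: s.
Qed.

Lemma chi_psum (f : seq T -> R[i]) n :
  psum (fun s => sqn (chi f s)) n <= #|T|%:R * psum (fun s => sqn (f s)) n.+1.
Proof.
apply: (@le_trans _ _ (#|T|%:R * psum (fun s => \sum_z sqn (f (rcons s z))) n)).
  by rewrite -psumZ; apply: psum_le => s; apply: sqn_sum_le.
by rewrite ler_wpM2l // psum_shift lerDr sqn_ge0.
Qed.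

(** From |a + b + c|^2 <= 4 |a|^2 + 4 |b|^2 + 2 |c|^2, the squared norms of [par] and [chi] being at
    most #|T|. *)
Definition Abound : R := 4 * (\sum_y W y ^+ 2) + 6 * #|T|%:R.

Lemma Abound_ge0 : 0 <= Abound.
Proof.
by rewrite addr_ge0 ?mulr_ge0 // sumr_ge0 // => y _; apply: sqr_ge0.
Qed.

Definition Afun (f : seq T -> R[i]) (s : seq T) : R[i] :=
  if V s then Hop W x V f s else 0.

Lemma Afun_psum u n : psum (fun s => sqn (Afun u s)) n <= Abound * dot u u.
Proof.
apply: (@le_trans _ _ (psum (fun s => (4 * (\sum_y W y ^+ 2)) * sqn (u s)
    + (4 * sqn (par u s) + 2 * sqn (chi u s))) n)).
  apply: psum_le => s; rewrite /Afun; case: ifPn => Vs; last first.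
    rewrite sqn0 !addr_ge0 ?mulr_ge0 ?sqn_ge0 //.
    by apply: sumr_ge0 => y _; apply: sqr_ge0.
  rewrite HopE; last by move=> t; apply: l2t_off.
  rewrite (le_trans (sqnDle _ _)) // mulrDr addrA lerD2r.
  rewrite (_ : 4 = 2 * 2); last by ring.
  rewrite -!mulrA -mulrDr ler_wpM2l // (le_trans (sqnDle _ _)) // mulrDr lerD2r.
  rewrite ler_wpM2l // sqnM sqn_real ler_wpM2r ?sqn_ge0 //.
  rewrite (bigD1 (cover_map x s)) //= lerDl sumr_ge0 // => y _; exact: sqr_ge0.
rewrite !psumD !psumZ dot_sqn.
have su := l2t_summ u.
have tg m : psum (fun s => sqn (u s)) m <= tot (fun s => sqn (u s)).
  by apply: tot_ge => // s; apply: sqn_ge0.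
have h1 := par_psum u n; have h2 := chi_psum u n.
have h3 : #|T|%:R * psum (fun s => sqn (u s)) n <= #|T|%:R * tot (fun s => sqn (u s)).
  by rewrite ler_wpM2l.
have h4 : #|T|%:R * psum (fun s => sqn (u s)) n.+1 <= #|T|%:R * tot (fun s => sqn (u s)).
  by rewrite ler_wpM2l.
have h5 : 4 * (\sum_y W y ^+ 2) * psum (fun s => sqn (u s)) n <=
    4 * (\sum_y W y ^+ 2) * tot (fun s => sqn (u s)).
  by rewrite ler_wpM2l // mulr_ge0 // sumr_ge0 // => y _; apply: sqr_ge0.
by rewrite /Abound mulrDl; lra.
Qed.

Lemma Afun_l2 u : l2 V (Afun u).
Proof.
apply/l2P; split; first by move=> s nV; rewrite /Afun (negbTE nV).
exists (Abound * dot u u) => n; rewrite (le_trans _ (Afun_psum u n)) //.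
by apply: psum_le => s; rewrite ger0_norm ?sqn_ge0.
Qed.

Definition Aop u : l2t R V := mkl2 (Afun_l2 u).

Lemma AopE u s : V s -> Aop u s = Hop W x V u s.
Proof. by move=> Vs; rewrite /= /Afun Vs. Qed.

Lemma AopE' u s : V s ->
  Aop u s = (W (cover_map x s))%:C%C * u s + par u s + chi u s.
Proof. by move=> Vs; rewrite AopE // HopE //; apply: l2t_off. Qed.

Lemma Aop_bounded : bounded_by (@dot R T V) Aop (Num.sqrt Abound).
Proof.
move=> u; rewrite /nrm -sqrtrM ?Abound_ge0 // ler_wsqrtr // [leLHS]dot_sqn.
by apply: tot_le; [exact: l2t_summ|move=> n; exact: Afun_psum].
Qed.

Lemma AopB u v : Aop (u - v) = Aop u - Aop v.
Proof.
apply: l2tP => s; have [Vs|nV] := boolP (V s); last by rewrite !l2t_off.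
rewrite l2tD l2tN !AopE' // !(l2tD, l2tN) /par /chi.
have -> : (if s == [::] then 0 else (u - v) (tparent s)) =
  (if s == [::] then 0 else u (tparent s)) - (if s == [::] then 0 else v (tparent s)).
  by case: ifP => _; rewrite ?subr0.
under eq_bigr do rewrite l2tD l2tN.
by rewrite sumrB; apply: complex_eq; rewrite !cE; ring.
Qed.

Lemma AopZ a u : Aop (a *: u) = a *: Aop u.
Proof.
apply: l2tP => s; have [Vs|nV] := boolP (V s); last by rewrite !l2t_off.
rewrite l2tZ !AopE' // !l2tZ /par /chi.
have -> : (if s == [::] then 0 else (a *: u) (tparent s)) =
  (a%:C)%C * (if s == [::] then 0 else u (tparent s)).
  by case: ifP => _; rewrite ?mulr0 ?l2tZ.
under eq_bigr do rewrite l2tZ.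
by rewrite -mulr_sumr; apply: complex_eq; rewrite !cE; ring.
Qed.

Lemma summ_cdot (f g : seq T -> R[i]) : summ (fun s => sqn (f s)) ->
  summ (fun s => sqn (g s)) -> summ (fun s => cdot (f s) (g s)).
Proof.
move=> sf sg; apply: summ_le (summD sf sg) => s; exact: cdot_le.
Qed.

Lemma summ_par u : summ (fun s => sqn (par u s)).
Proof.
have su := l2t_summ u; exists (#|T|%:R * dot u u) => n.
rewrite (le_trans (y := psum (fun s => sqn (par u s)) n)) //.
  by apply: psum_le => s; rewrite ger0_norm ?sqn_ge0.
rewrite (le_trans (par_psum _ _)) // ler_wpM2l // dot_sqn.
by apply: tot_ge => // s; apply: sqn_ge0.
Qed.

Lemma summ_chi u : summ (fun s => sqn (chi u s)).
Proof.
have su := l2t_summ u; exists (#|T|%:R * dot u u) => n.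
rewrite (le_trans (y := psum (fun s => sqn (chi u s)) n)) //.
  by apply: psum_le => s; rewrite ger0_norm ?sqn_ge0.
rewrite (le_trans (chi_psum _ _)) // ler_wpM2l // dot_sqn.
by apply: tot_ge => // s; apply: sqn_ge0.
Qed.

(** Both sides run over the edges of the tree, indexed by the child on the left and by the parent on
    the right; the symmetry of the operator reduces to this. *)
Lemma par_chi_adj u v :
  tot (fun s => cdot (par u s) (v s)) = tot (fun s => cdot (u s) (chi v s)).
Proof.
have s1 := summ_cdot (summ_par u) (l2t_summ v).
have e : (fun s => \sum_z cdot (par u (rcons s z)) (v (rcons s z))) =
         (fun s => cdot (u s) (chi v s)).
  apply/funext => s; rewrite /chi /cdot !cE !mulr_sumr -big_split /=.
  by apply: eq_bigr => z _; rewrite /par tparent_rcons; case: s.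
rewrite tot_shift //; last by rewrite e; apply: summ_cdot (summ_chi v); apply: l2t_summ.
by rewrite e /par /= /cdot /= !mul0r !add0r.
Qed.

Lemma dot_Aop u v : dot (Aop u) v =
  tot (fun s => W (cover_map x s) * cdot (u s) (v s)) +
  (tot (fun s => cdot (par u s) (v s)) + tot (fun s => cdot (chi u s) (v s))).
Proof.
have sp := summ_cdot (summ_par u) (l2t_summ v).
have sc := summ_cdot (summ_chi u) (l2t_summ v).
have sW : summ (fun s => W (cover_map x s) * cdot (u s) (v s)).
  apply: (@summ_le _ _ _ (fun s => (\sum_y `|W y|) * (sqn (u s) + sqn (v s)))).
    move=> s; rewrite normrM ler_pM ?cdot_le //.
    by rewrite (bigD1 (cover_map x s)) //= lerDl sumr_ge0.
  by apply: summZ; apply: summD; apply: l2t_summ.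
rewrite -(totD sp sc) -(totD sW (summD sp sc)) /dot; congr tot; apply/funext => s.
have [Vs|nV] := boolP (V s).
  by rewrite AopE' // /cdot !cE /=; ring.
by rewrite !(l2t_off _ nV) /cdot /= !(mulr0, addr0).
Qed.

Lemma Aop_sym : self_adjoint (@dot R T V) Aop.
Proof.
move=> u v; rewrite [RHS]dotC !dot_Aop; congr (_ + _).
  by congr tot; apply/funext => s; rewrite cdotC.
rewrite !par_chi_adj addrC; congr (_ + _); congr tot; apply/funext => s;
  exact: cdotC.
Qed.

Lemma Jfun_l2 u : l2 V (fun s => 'i%C * u s).
Proof.
apply/l2P; split; first by move=> s /l2t_off ->; rewrite mulr0.
have -> : (fun s => sqn ('i%C * u s)) = (fun s => sqn (u s)).
  by apply/funext => s; rewrite sqnM /sqn /= expr0n expr1n add0r mul1r.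
exact: l2t_summ.
Qed.

Definition Jop u : l2t R V := mkl2 (Jfun_l2 u).

Lemma JopE u s : Jop u s = 'i%C * u s. Proof. by []. Qed.

Lemma Jop_skew u v : dot (Jop u) v = - dot u (Jop v).
Proof.
rewrite -mulN1r /dot -totZ; last exact: dot_summ.
by congr tot; apply/funext => s; rewrite !JopE /cdot !cE /=; ring.
Qed.

Lemma dotJ u v : dot (Jop u) (Jop v) = dot u v.
Proof.
by rewrite /dot; congr tot; apply/funext => s; rewrite !JopE /cdot !cE /=; ring.
Qed.

Lemma AopJ u : Aop (Jop u) = Jop (Aop u).
Proof.
apply: l2tP => s; have [Vs|nV] := boolP (V s); last by rewrite !l2t_off.
rewrite JopE !AopE' // JopE /par /chi.
under eq_bigr do rewrite JopE.
rewrite -mulr_sumr; have -> : (if s == [::] then 0 else Jop u (tparent s)) =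
  'i%C * (if s == [::] then 0 else u (tparent s)) by case: ifP => _; rewrite ?mulr0.
by apply: complex_eq; rewrite !cE; ring.
Qed.

Lemma dot_self_J u : dot u (Jop u) = 0.
Proof. by have := Jop_skew u u; rewrite dotC; lra. Qed.

Lemma dot_Aop_J u : dot (Aop u) (Jop u) = 0.
Proof. by have := Jop_skew u (Aop u); rewrite dotC Aop_sym AopJ; lra. Qed.

Lemma tot_root (h : seq T -> R) : (forall s, s != [::] -> h s = 0) -> tot h = h [::].
Proof.
move=> h0.
have e : (fun s => \sum_(z : T) h (rcons s z)) = (fun=> 0).
  by apply/funext => s; apply: big1 => z _; rewrite h0 // -size_eq0 size_rcons.
have p0 n : psum (fun _ : seq T => 0 : R) n = 0.
  by elim: n => [|n IH]; rewrite ?psum0 // psumS IH lev0 addr0.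
have s0 : summ (fun _ : seq T => 0 : R).
  by exists 0 => n; rewrite normr0 p0.
have sh : summ h.
  exists `|h [::]| => -[|n]; first by rewrite psum0.
  rewrite psum_shift (_ : (fun s => _) = (fun=> 0)) ?p0 ?addr0 //.
  by apply/funext => s; apply: big1 => z _; rewrite h0 ?normr0 // -size_eq0 size_rcons.
rewrite tot_shift // e // -[RHS]addr0; congr (_ + _).
by apply/cvg_lim => //; rewrite (_ : psum _ = (fun=> 0)); [exact: cvg_cst|apply/funext].
Qed.

(* Pairing the resolvent equation with i u: the self-adjoint part drops out. *)
Lemma resolvent_im (lam eta : R) (c : R[i]) u :
  (forall s, V s -> Hop W x V u s - (lam +i* eta)%C * u s = if s == [::] then c else 0) ->
  V [::] -> eta * dot u u = - cdot c ('i%C * u [::]).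
Proof.
move=> hu V0; pose w := Aop u - lam *: u - eta *: Jop u.
have wE s : w s = if s == [::] then c else 0.
  have [Vs|nV] := boolP (V s); last first.
    by rewrite (l2t_off _ nV); case: eqP => // s0; rewrite s0 V0 in nV.
  rewrite -hu // /w !(l2tD, l2tN, l2tZ) AopE // JopE.
  by apply: complex_eq; rewrite !cE /=; ring.
have : dot w (Jop u) = - (eta * dot u u).
  rewrite /w !dotDl !(dotNl (@dotZl _ _ _)) !dotZl dot_Aop_J dot_self_J dotJ.
  by rewrite mulr0 subr0 add0r.
rewrite /dot tot_root => [|s s0].
  by rewrite wE eqxx JopE => ->; rewrite opprK.
by rewrite wE (negbTE s0) /cdot /= !mul0r addr0.
Qed.

End Operator.

(** * Green functions of subtrees and the recursion for [zeta] *)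

Section Zeta.
Variables (R : realType) (T : finType) (adj : rel T) (W : T -> R).

Definition Green (x : T) (V : pred (seq T)) (g : R[i]) (f : seq T -> R[i]) :=
  l2 V f /\ forall s, V s -> Hop W x V f s - g * f s = (s == [::])%:R.

(** The difference solves the homogeneous equation, for which [resolvent_im] gives eta |u|^2 = 0. *)
Lemma Green_uniq x (V : pred (seq T)) (lam eta : R) f f' : 0 < eta -> V [::] ->
  Green x V (lam +i* eta)%C f -> Green x V (lam +i* eta)%C f' -> f = f'.
Proof.
move=> e0 V0 [lf hf] [lf' hf'].
pose u := mkl2 lf - mkl2 lf'.
suff u0 : u = 0.
  apply/funext => s; apply/eqP; rewrite -subr_eq0; apply/eqP.
  by have := congr1 (fun w : l2t R V => w s) u0.
apply: dot_eq0; apply/eqP.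
have /eqP : eta * dot u u = 0.
  rewrite (@resolvent_im _ _ W x V lam eta 0 u) //.
    by rewrite /cdot /= !mul0r addr0 oppr0.
  move=> s Vs; rewrite if_same -AopE // /u AopB l2tD l2tN !AopE //.
  have := hf s Vs; have := hf' s Vs; rewrite l2tD l2tN /= => h1 h2.
  rewrite mulrBr -[RHS](subrr (s == [::])%:R) -{1}h2 -h1; ring.
by rewrite mulf_eq0 gt_eqF.
Qed.

Lemma Green_im x (V : pred (seq T)) (lam eta : R) f : 0 < eta -> V [::] ->
  Green x V (lam +i* eta)%C f -> 0 <= complex.Im (f [::]).
Proof.
move=> e0 V0 [lf hf].
have -> : complex.Im (f [::]) = eta * dot (mkl2 lf) (mkl2 lf).
  rewrite (@resolvent_im _ _ W x V lam eta 1 (mkl2 lf)) //.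
    by rewrite /cdot !cE /= !(mul0r, mul1r, sub0r, addr0, opprK).
  by move=> s Vs; rewrite hf //; case: eqP.
by rewrite mulr_ge0 ?dot_ge0 // ltW.
Qed.

Lemma zeta_Green x y (lam eta : R) f : 0 < eta ->
  Green x (subtree adj x y) (lam +i* eta)%C f ->
  zeta adj W x y (lam +i* eta)%C = - f [::].
Proof.
move=> e0 [lf hf]; rewrite /zeta /resolvent_entry; congr (- _).
apply: xget_unique; first by exists f.
move=> _ [f' [lf' hf' <-]].
by rewrite (Green_uniq e0 (subtree_nil adj x y) (conj lf' hf') (conj lf hf)).
Qed.

(** [resolvent_entry] defaults to 0 when there is no l2 solution, so a nonzero value certifies one.
    Near the real axis, existence of Green functions is drawn from the nonzero boundary values. *)
Lemma zeta_neq0 x y (lam eta : R) : zeta adj W x y (lam +i* eta)%C != 0 ->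
  exists f, Green x (subtree adj x y) (lam +i* eta)%C f.
Proof.
rewrite /zeta /resolvent_entry oppr_eq0.
by case: xgetP => [c _ [f [lf hf _]] _|_]; [exists f|rewrite eqxx].
Qed.

Lemma zeta_im x y (lam eta : R) : 0 < eta -> complex.Im (zeta adj W x y (lam +i* eta)%C) <= 0.
Proof.
move=> e0; have [->//|] := eqVneq (zeta adj W x y (lam +i* eta)%C) 0.
move=> /zeta_neq0[f hf]; rewrite (zeta_Green e0 hf) cImN oppr_le0.
exact: Green_im (subtree_nil adj x y) hf.
Qed.

Lemma psum_cons (h : seq T -> R) n :
  psum h n.+1 = h [::] + \sum_z psum (fun s => h (z :: s)) n.
Proof.
elim: n => [|n IH].
  by rewrite psumS psum0 add0r big1 ?addr0 // => z _; rewrite psum0.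
rewrite psumS IH -addrA; congr (_ + _); rewrite /= -big_split.
by apply: eq_bigr => z _; rewrite psumS.
Qed.

(** Schur complement by gluing. Let X be the bracket and c = -1/X, where Im X >= eta > 0. The
    function equal to c at the root and to -c g_u on the branch of u, with g_u the Green function of
    that branch, solves the equation on the subtree of v. *)
Lemma zeta_rec v w (lam eta : R) : 0 < eta ->
  (forall u, adj v u -> zeta adj W u v (lam +i* eta)%C != 0) ->
  zeta adj W v w (lam +i* eta)%C *
  ((lam +i* eta)%C - (W v)%:C%C
    - \sum_(u | adj v u && (u != w)) zeta adj W u v (lam +i* eta)%C) = 1.
Proof.
set ga := (lam +i* eta)%C => e0 nz.
have /choice[g hg] (u : T) : exists f, adj v u -> Green u (subtree adj u v) ga f.
  have [vu|] := boolP (adj v u); last by exists (fun=> 0).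
  by have [f hf] := zeta_neq0 (nz u vu); exists f.
have zE u : adj v u -> zeta adj W u v ga = - g u [::].
  by move=> vu; apply: zeta_Green => //; apply: hg.
pose X := ga - (W v)%:C%C - \sum_(u | adj v u && (u != w)) zeta adj W u v ga.
have XI : 0 < complex.Im X.
  rewrite /X !cE /= subr0 -sumrN ltr_wpDr // sumr_ge0 // => u _.
  by rewrite oppr_ge0 zeta_im.
have X0 : X != 0 by apply: contraTneq XI => ->; rewrite ltxx.
pose c := - X^-1.
pose F (s : seq T) := if s is u :: s' then
  (if subtree adj v w s then - c * g u s' else 0) else c.
have FV s : ~~ subtree adj v w s -> F s = 0.
  by case: s => [|u s] /=; [rewrite subtree_nil|move=> /negbTE ->].
suff GF : Green v (subtree adj v w) ga F.
  by rewrite (zeta_Green e0 GF) /= /c opprK mulVf.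
split.
  apply/l2P; split => //.
  have /choice[M hM] (u : T) : exists M, 0 <= M /\
      (adj v u -> forall n, psum (fun s => sqn (g u s)) n <= M).
    have [vu|] := boolP (adj v u); last by exists 0.
    have [/l2P[_ [M hM]] _] := hg u vu; exists M; split.
      by have := hM 0%N; rewrite psum0.
    move=> _ n; rewrite (le_trans _ (hM n)) //.
    by apply: psum_le => s; rewrite ger0_norm ?sqn_ge0.
  exists (sqn c + \sum_u sqn c * M u) => n.
  apply: (@le_trans _ _ (psum (fun s => sqn (F s)) n.+1)).
    rewrite psumS (le_trans (y := psum (fun s => sqn (F s)) n)) //.
      by apply: psum_le => s; rewrite ger0_norm ?sqn_ge0.
    by rewrite lerDl lev_ge0 // => s; apply: sqn_ge0.
  rewrite psum_cons /= lerD2l; apply: ler_sum => u _.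
  have [vu|nvu] := boolP (adj v u).
    rewrite (le_trans (y := psum (fun s => sqn c * sqn (g u s)) n)) //.
      apply: psum_le => s; case: ifP => _; first by rewrite sqnM sqnN.
      by rewrite sqn0 mulr_ge0 ?sqn_ge0.
    by rewrite psumZ ler_wpM2l ?sqn_ge0 // (hM u).2.
  rewrite (_ : (fun s => _) = (fun=> 0 * 0)) ?psumZ ?mul0r.
    by rewrite mulr_ge0 ?sqn_ge0 ?(hM u).1.
  by apply/funext => s; rewrite subtree_cons (negbTE nvu) sqn0.
case=> [_|u s Vus].
  rewrite /Hop /= /cover_map /= addr0.
  rewrite (eq_bigl (fun u => adj v u && (u != w))); last first.
    by move=> u; rewrite subtree_cons subtree_nil andbT.
  rewrite (eq_bigr (fun u => c * zeta adj W u v ga)); last first.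
    move=> u /andP[vu uw].
    by rewrite subtree_cons vu uw subtree_nil /= zE // mulrN mulNr.
  rewrite -mulr_sumr mulr1n.
  transitivity (- c * X); first by rewrite /X; ring.
  by rewrite /c opprK mulVf.
have := Vus; rewrite subtree_cons => /and3P[vu uw us].
have Vt t : subtree adj v w (u :: t) = subtree adj u v t by rewrite subtree_cons vu uw.
have hE := (hg u vu).2 s us; rewrite /Hop in hE.
rewrite /Hop -[cover_map v (u :: s)]/(cover_map u s).
(* At the root of a branch the source -c of -c g_u is cancelled by the value c at the parent. *)
transitivity (- c * (s == [::])%:R + (if s == [::] then c else 0)); last first.
  by case: eqP => _; rewrite ?mulr1 ?mulr0 ?addr0 // addNr.
rewrite -hE.
have -> : (if (u :: s != [::]) && subtree adj v w (tparent (u :: s))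
    then F (tparent (u :: s)) else 0) = (if s == [::] then c else 0) +
    - c * (if (s != [::]) && subtree adj u v (tparent s) then g u (tparent s) else 0).
  have [->|s0] := eqVneq s [::]; first by rewrite /= subtree_nil mulr0 addr0.
  rewrite tparent_cons // Vt /= Vt add0r.
  by case: ifP => [->|_]; rewrite ?mulr0.
have -> : \sum_(z | subtree adj v w (rcons (u :: s) z)) F (rcons (u :: s) z) =
    - c * \sum_(z | subtree adj u v (rcons s z)) g u (rcons s z).
  rewrite mulr_sumr; apply: eq_big => z; first by rewrite rcons_cons Vt.
  by rewrite rcons_cons => h; rewrite /= h.
have -> : F (u :: s) = - c * g u s by rewrite /= Vus.
ring.
Qed.

End Zeta.

(** * Non-backtracking walks in balls with at most one cycle *)

Lemma nonback_cat (T : finType) (x : T) s t :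
  nonback x (s ++ t) -> nonback x s && nonback (last x s) t.
Proof.
elim: s x => [//|y s IH] x /= /andP[h1 /IH/andP[h2 ->]]; rewrite h2 !andbT.
by case: s h1 {IH h2}.
Qed.

Section Forest.
Variables (T : finType) (r : rel T).
Hypothesis rsym : symmetric r.
Hypothesis rirr : irreflexive r.

Definition acyclic := forall c, uniq c -> (3 <= size c)%N -> ~~ cycle r c.

Hypothesis racy : acyclic.

(** A return to x would close a cycle, and non-backtracking gives it at least three vertices. *)
Lemma nonback_uniq x s : path r x s -> nonback x s -> uniq (x :: s).
Proof.
elim: s x => [//|y s IH] x /= /andP[rxy p] /andP[hb nb].
have u := IH y p nb; move: (u); rewrite /= => ->; rewrite andbT.
apply/negP; rewrite inE => /predU1P[xy|xs]; first by rewrite xy rirr in rxy.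
case/splitPr: xs hb p u {nb IH} => p1 p2 hb p u.
have : ~~ cycle r [:: x, y & p1].
  apply: racy; last by case: p1 hb {p u} => //=; rewrite eqxx.
  move: u; rewrite -cat_cons cat_uniq => /and3P[u1 h _] /=.
  rewrite -/(uniq (y :: p1)) u1 andbT; apply: contra h => h.
  by apply/hasP; exists x => //; rewrite mem_head.
move/negP; apply; rewrite /= rxy /= rcons_path.
by move: p; rewrite cat_path /= => /and3P[-> ->].
Qed.

(** If the first steps y and z differ, both tails avoid x by [nonback_uniq]; hence y and z are
    joined by a path avoiding x, which closes a cycle through x. *)
Lemma nonback_unique x s t : path r x s -> nonback x s -> path r x t ->
  nonback x t -> last x s = last x t -> s = t.
Proof.
elim: s x t => [|y s IH] x t.
  case: t => [//|z t] _ _ p nb /= h; have /= := nonback_uniq p nb.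
  by rewrite {1}h mem_last.
case: t => [|z t].
  by move=> p nb _ _ /= h; have /= := nonback_uniq p nb; rewrite -{1}h mem_last.
move=> ps ns pt nt /= hl.
have [yz|yz] := eqVneq y z.
  move: ps ns pt nt => /= /andP[_ ps] /andP[_ ns] /andP[_ pt] /andP[_ nt].
  by rewrite -yz in pt nt hl *; rewrite (IH y t).
pose r' := [rel u v | [&& r u v, u != x & v != x]].
have r'sym : symmetric r' by move=> u v; rewrite /= rsym; congr (_ && _); rewrite andbC.
have av v p : path r x (v :: p) -> nonback x (v :: p) -> connect r' v (last v p).
  move=> hp np; have /= := nonback_uniq hp np => /andP[xn _].
  apply/connectP; exists p => //.
  move: hp => /= /andP[_]; elim: p v xn {np} => [//|w p IHp] v xn /= /andP[rvw pw].
  move: xn; rewrite !inE !negb_or => /and3P[xv xw xp].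
  rewrite rvw (eq_sym v) (eq_sym w) xv xw /=; apply: IHp => //.
  by rewrite inE negb_or xw.
have : connect r' y z.
  apply: connect_trans (av y s ps ns) _.
  by rewrite hl (sym_connect_sym r'sym) av.
case/connectP => p pp zl.
case/shortenP: pp zl => p' pp' up' _ zl.
have pr : path r y p' by apply: sub_path pp' => u v /= /and3P[].
have xp : x \notin y :: p'.
  have yx : y != x by apply: contraTneq ps => ->; rewrite /= rirr.
  elim: p' y yx pp' {up' zl pr ps ns hl yz} => [|w p' IHp] y' yx /=.
    by rewrite inE eq_sym yx.
  move=> /andP[/and3P[_ _ wx] pw]; rewrite inE negb_or eq_sym yx.
  exact: IHp.
have : ~~ cycle r [:: x, y & p'].
  apply: racy; first by rewrite /= xp.
  by case: p' zl {pp' up' pr xp} => //= zy; rewrite zy eqxx in yz.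
move/negP; case; rewrite /= rcons_path.
move: ps pt => /= /andP[-> _] /andP[rxz _]; rewrite pr /= -zl.
by rewrite rsym.
Qed.

End Forest.

(** * Cutting the cycle of a ball and counting walks across the cut *)

Section Cut.
Variables (T : finType) (adj : rel T).
Hypothesis asym : symmetric adj.
Hypothesis airr : irreflexive adj.

Definition cut (a b u v : T) := ((u == a) && (v == b)) || ((u == b) && (v == a)).

Definition adjin (B : {set T}) := [rel u v | [&& adj u v, u \in B & v \in B]].

Definition cutin (B : {set T}) a b := [rel u v | adjin B u v && ~~ cut a b u v].

Lemma cut_sym a b : symmetric (cut a b).
Proof. by move=> u v; rewrite /cut orbC; congr (_ || _); rewrite andbC. Qed.

Lemma cutin_sym B a b : symmetric (cutin B a b).
Proof.
move=> u v; rewrite /= cut_sym asym; congr (_ && _); congr (_ && _); exact: andbC.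
Qed.

Lemma cutin_irr B a b : irreflexive (cutin B a b).
Proof. by move=> u; rewrite /= airr. Qed.

(** Vertices of degree 2 have only their two cycle neighbours, so the cycle is closed under
    adjacency and, by connectedness, is the whole graph. *)
Lemma deg2_cycle_graph c : connected_graph adj -> uniq c -> (3 <= size c)%N ->
  cycle adj c -> (forall x, x \in c -> (deg adj x <= 2)%N) -> is_cycle_graph adj.
Proof.
move=> conn uc sc cc dc.
have nbrs x y : x \in c -> adj x y = (y == next c x) || (y == prev c x).
  move=> xc; have n1 : adj x (next c x) by apply: next_cycle.
  have n2 : adj x (prev c x) by rewrite asym; apply: prev_cycle.
  have n12 : next c x != prev c x.
    apply/eqP => h; have h2 : next c (next c x) = x by rewrite h next_prev.
    case/rot_to: xc => i c' hc.
    have := h2; rewrite -!(next_rot i uc) hc.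
    have : uniq (rot i c) by rewrite rot_uniq.
    have : (3 <= size (rot i c))%N by rewrite size_rot.
    rewrite hc; case: c' {hc} => [|y1 [|y2 c']] // _ /=.
    rewrite !inE !negb_or => /andP[/and3P[h01 h02 _] /andP[/andP[h12 _] _]].
    have h10 : (y1 == x) = false by rewrite eq_sym (negbTE h01).
    rewrite !eqxx /= ?(negbTE h01) ?h10 ?eqxx => e.
    by rewrite e eqxx in h02.
  have sub : [set next c x; prev c x]%SET \subset [set y | adj x y]%SET.
    by apply/fintype.subsetP => v; rewrite !inE => /orP[/eqP->|/eqP->].
  have eqs : [set next c x; prev c x]%SET = [set y | adj x y]%SET.
    by apply/eqP; rewrite eqEcard sub cards2 n12; apply: dc.
  have -> : adj x y = (y \in [set y | adj x y]%SET) by rewrite inE.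
  by rewrite -eqs !inE.
have call x : x \in c.
  have [x1 x1c] : exists x1, x1 \in c by case: c sc {uc cc dc nbrs} => // x1 c _; exists x1; rewrite mem_head.
  case/connectP: (conn x1 x) => p pp ->.
  elim: p x1 x1c pp => [//|y p IH] x1 x1c /= /andP[xy pp]; apply: IH => //.
  by move: xy; rewrite nbrs // => /orP[/eqP->|/eqP->]; rewrite ?mem_next ?mem_prev.
exists c; split => // x y; rewrite nbrs //; congr (_ || _).
by apply/eqP/eqP => ->; rewrite ?next_prev ?prev_next.
Qed.

(** All cycles in the ball have the same edges, so removing one of these edges leaves a forest. The
    cycle has a vertex b of degree at least 3 because the graph is not itself a cycle. *)
Lemma exists_cut (B : {set T}) (x : T) : connected_graph adj ->
  ~ is_cycle_graph adj -> at_most_one_cycle adj B ->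
  exists a b, acyclic (cutin B a b) /\ (adj a b -> (3 <= deg adj b)%N).
Proof.
move=> conn ncy one.
have cycB a b c : uniq c -> (3 <= size c)%N -> cycle (cutin B a b) c -> cycle_in adj B c.
  move=> uc sc cc; apply/and4P; split => //.
    apply/allP => v vc; have := next_cycle cc vc.
    by rewrite /= => /andP[/and3P[_ ->]].
  by apply: sub_cycle cc => u v /= /andP[/and3P[]].
have [[c hc]|nc] := pselect (exists c, cycle_in adj B c); last first.
  (* Without a cycle, a = b removes no edge, and the degree condition is void since [adj] has no
     loops. *)
  exists x, x; split => [c uc sc|]; last by rewrite airr.
  by apply/negP => cc; apply: nc; exists c; apply: cycB cc.
have /and4P[uc sc cB cc] := hc.
have [b bc db] : exists2 b, b \in c & (3 <= deg adj b)%N.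
  apply: contrapT => h; apply: ncy; apply: (deg2_cycle_graph conn uc sc cc) => y yc.
  by rewrite leqNgt; apply/negP => h3; apply: h; exists y.
exists (prev c b), b; split => // c1 uc1 sc1; apply/negP => cc1.
have e : cycle_edges c1 (prev c b, b) = cycle_edges c (prev c b, b).
  exact: (one _ _ (cycB _ _ _ uc1 sc1 cc1) hc).
have : cycle_edges c (prev c b, b) by rewrite /cycle_edges /= mem_prev bc next_prev ?eqxx.
rewrite -e /cycle_edges /=.
case/orP => /andP[hin /eqP h]; have := next_cycle cc1 hin; rewrite -h /= /cut !eqxx /=.
  by rewrite andbF.
by rewrite orbT andbF.
Qed.

Lemma sub_ball x k l : (k <= l)%N -> Defs.ball adj x k \subset Defs.ball adj x l.
Proof.
move=> /subnK <-; elim: (l - k)%N => [//|n IH].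
by rewrite addSn /= (fintype.subset_trans IH) // finset.subsetUl.
Qed.

Lemma ball_step x k y z : y \in Defs.ball adj x k -> adj y z -> z \in Defs.ball adj x k.+1.
Proof.
move=> yb yz; rewrite /= !inE; apply/orP; right.
by apply/existsP; exists y; rewrite yz andbT.
Qed.

Lemma ball0 x : x \in Defs.ball adj x 0. Proof. by rewrite inE. Qed.

Lemma path_ball w k l x s : x \in Defs.ball adj w k -> path adj x s ->
  (k + size s <= l)%N -> path (adjin (Defs.ball adj w l)) x s.
Proof.
elim: s x k => [//|y s IH] x k xb /= /andP[xy p] hl.
have yb := ball_step xb xy.
rewrite xy (IH y k.+1) //; last by rewrite addSnnS.
rewrite (fintype.subsetP (sub_ball w (_ : k <= l)%N) _ xb); last by lia.
by rewrite (fintype.subsetP (sub_ball w (_ : k.+1 <= l)%N) _ yb) //; lia.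
Qed.

Lemma last_ball w k x s : x \in Defs.ball adj w k -> path adj x s ->
  last x s \in Defs.ball adj w (k + size s).
Proof.
elim: s x k => [|y s IH] x k xb /=; first by rewrite addn0.
by move=> /andP[xy p]; rewrite -addSnnS; apply: IH => //; apply: ball_step xb xy.
Qed.

Section Count.
Variables (B : {set T}) (a b : T).
Local Notation r1 := (adjin B).
Local Notation r := (cutin B a b).
Hypothesis racy : acyclic r.

Let uniqr := nonback_unique (@cutin_sym B a b) (@cutin_irr B a b) racy.

Lemma first_cut x s : path r1 x s -> path r x s \/
  exists s1 z s2, [/\ s = s1 ++ z :: s2, path r x s1, cut a b (last x s1) z & path r1 z s2].
Proof.
elim: s x => [|y s IH] x /=; first by left.
move=> /andP[xy p]; have [c|nc] := boolP (cut a b x y).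
  by right; exists [::], y, s.
have [pr|[s1 [z [s2 [-> h1 h2 h3]]]]] := IH y p; first by left; rewrite /= xy pr.
by right; exists (y :: s1), z, s2; split => //=; rewrite xy nc h1.
Qed.

Lemma cutE u v u' v' : cut a b u v -> cut a b u' v' ->
  u' = u /\ v' = v \/ u' = v /\ v' = u.
Proof.
by move=> /orP[]/andP[/eqP-> /eqP->] /orP[]/andP[/eqP-> /eqP->]; auto.
Qed.

(* After crossing u -> v the cut edge can only be crossed again in the same
   direction, since a non-backtracking loop at v avoiding it is trivial. *)
Lemma recross u v s1 z s2 : cut a b u v -> nonback u (v :: s1 ++ z :: s2) ->
  path r v s1 -> cut a b (last v s1) z -> last v s1 = u /\ z = v.
Proof.
move=> cuv nb p1 cz; have [[-> ->]//|[h1 h2]] := cutE cuv cz.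
move: nb => /= /andP[hb /nonback_cat/andP[n1 _]].
have s10 : s1 = [::] by apply: (uniqr p1 n1).
by move: hb; rewrite s10 /= h2 eqxx.
Qed.

(** By [recross], a walk that crosses again does so from u to v; dropping that turn leaves a shorter
    walk with the same end, to which induction applies. *)
Lemma cross_longer u v s t : cut a b u v -> nonback u (v :: s) -> path r1 v s ->
  path r v t -> nonback v t -> last v t = last v s -> s = t \/ (size t < size s)%N.
Proof.
move=> cuv; have [n hn] := ubnP (size s); elim: n s hn => [//|n IH] s hn nb p pt nt hl.
have [pr|[s1 [z [s2 [e p1 cz p2]]]]] := first_cut p.
  by left; move: nb => /= /andP[_ nb]; exact: (uniqr pr nb pt nt (esym hl)).
rewrite e in nb; have [lu zv] := recross cuv nb p1 cz.
rewrite zv in nb p2 e.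
have := nb => /= /andP[_ /nonback_cat/andP[_]]; rewrite lu => nb2.
have hs2 : (size s2 < n)%N by move: hn; rewrite e size_cat /=; lia.
have hl2 : last v t = last v s2 by rewrite hl e last_cat.
right; rewrite e size_cat /=.
by have [->|] := IH s2 hs2 nb2 p2 pt nt hl2; lia.
Qed.

(** Both walks turn around the cycle in the same direction. By [cross_longer], equal length excludes
    that only one of them makes a further turn, and a common turn can be removed. *)
Lemma cross_unique u v s t : cut a b u v -> nonback u (v :: s) -> path r1 v s ->
  nonback u (v :: t) -> path r1 v t -> last v s = last v t -> size s = size t -> s = t.
Proof.
move=> cuv; have [n hn] := ubnP (size s); elim: n s t hn => [//|n IH] s t hn ns ps nt pt hl hs.
have [ps'|[s1 [z [s2 [es p1 cz p2]]]]] := first_cut ps.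
  have := ns => /= /andP[_ ns'].
  by have [//|] := cross_longer cuv nt pt ps' ns' hl; rewrite hs ltnn.
have [pt'|[t1 [z' [t2 [et q1 cz' q2]]]]] := first_cut pt.
  have := nt => /= /andP[_ nt'].
  by have [//|] := cross_longer cuv ns ps pt' nt' (esym hl); rewrite hs ltnn.
rewrite es in ns hn; rewrite et in nt.
have [ls zv] := recross cuv ns p1 cz; have [lt zv'] := recross cuv nt q1 cz'.
have := ns => /= /andP[_ /nonback_cat/andP[n1]]; rewrite ls => n2.
have := nt => /= /andP[_ /nonback_cat/andP[m1]]; rewrite lt => m2.
have e1 : s1 = t1 by apply: (uniqr p1 n1 q1 m1); rewrite ls lt.
rewrite es et e1 zv zv'; congr (_ ++ _ :: _).
rewrite zv in n2 p2; rewrite zv' in m2 q2; apply: IH => //.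
- by move: hn; rewrite size_cat /= ltnS addnS => h; apply: leq_trans h; rewrite ltnS leq_addl.
- by move: hl; rewrite es et zv zv' !last_cat.
- by move: hs; rewrite es et e1 !size_cat /= => /addnI[].
Qed.

(** The three ways to meet the cut edge: never, first from a to b ([true]), first from b to a
    ([false]). *)
Definition walk_class x s (o : option bool) :=
  if o is Some d then exists s1 s2,
    [/\ s = s1 ++ (if d then b else a) :: s2, path r x s1,
        last x s1 = (if d then a else b) & path r1 (if d then b else a) s2]
  else path r x s.

Lemma walk_classP x s : path r1 x s -> exists o, walk_class x s o.
Proof.
move=> /first_cut[p|[s1 [z [s2 [-> p1 /orP[]/andP[/eqP e1 /eqP e2] p2]]]]].
- by exists None.
- by subst z; exists (Some true), s1, s2; split.
- by subst z; exists (Some false), s1, s2; split.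
Qed.

Lemma walk_class_inj x s t o : walk_class x s o -> walk_class x t o ->
  nonback x s -> nonback x t -> size s = size t -> last x s = last x t -> s = t.
Proof.
case: o => [d|] /=; last by move=> p q n m _ h; exact: (uniqr p n q m h).
move=> [s1 [s2 [-> p1 l1 p2]]] [t1 [t2 [-> q1 l1' q2]]].
move=> /nonback_cat/andP[n1 n2] /nonback_cat/andP[m1 m2] hs hl.
have e1 : s1 = t1 by apply: (uniqr p1 n1 q1 m1); rewrite l1 l1'.
rewrite l1 in n2; rewrite l1' in m2; rewrite e1; congr (_ ++ _ :: _).
apply: (@cross_unique (if d then a else b) (if d then b else a)) => //.
- by rewrite /cut; case: (d); rewrite !eqxx ?orbT.
- by move: hl; rewrite !last_cat.
- by move: hs; rewrite !size_cat e1 /= => /addnI[].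
Qed.

(** By [walk_class_inj] each class contains at most one such walk, and there are three classes. *)
Lemma count_walks x y k (l : seq (seq T)) : uniq l ->
  (forall s, s \in l -> [/\ path r1 x s, nonback x s, size s = k & last x s = y]) ->
  (size l <= 3)%N.
Proof.
move=> ul hl.
have /choice[f hf] s : exists o, s \in l -> walk_class x s o.
  have [sl|] := boolP (s \in l); last by exists None.
  by have [p _ _ _] := hl s sl; have [d hd] := walk_classP p; exists d.
have -> : size l = size (map f l) by rewrite size_map.
have -> : 3%N = #|{: option bool}| by rewrite card_option card_bool.
have um : uniq (map f l).
  rewrite map_inj_in_uniq // => s t sl tl e.
  have [_ n1 z1 l1] := hl s sl; have [_ n2 z2 l2] := hl t tl.
  apply: (walk_class_inj (hf s sl)) => //; first by rewrite e; apply: hf.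
  - by rewrite z1 z2.
  - by rewrite l1 l2.
by rewrite -(card_uniqP um) max_card.
Qed.

End Count.
End Cut.

(** * Energy estimate along walks that stop at the cut edge *)

Section Avoiding.
Variables (R : realType) (T : finType) (adj : rel T) (a b : T).
Hypothesis asym : symmetric adj.
Hypothesis airr : irreflexive adj.

Definition foll (x w y : T) := adj w y && (y != x).

Fixpoint avw (k : nat) (x w : T) : seq (seq T) :=
  if k is k'.+1 then
    [seq y :: s | y <- enum [pred y | foll x w y && ~~ cut a b w y], s <- avw k' w y]
  else [:: [::]].

(* [Phi k g x w] sums [g] over the end edges of the non-backtracking walks of
   length [k] continuing the edge (x, w) and avoiding the edge {a, b}. *)
Fixpoint Phi (k : nat) (g : T -> T -> R) (x w : T) : R :=
  if k is k'.+1 then \sum_(y | foll x w y && ~~ cut a b w y) Phi k' g w y else g x w.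

Lemma Phi_le k g g' x w : (forall u v, adj u v -> g u v <= g' u v) -> adj x w ->
  Phi k g x w <= Phi k g' x w.
Proof.
move=> hg; elim: k x w => [|k IH] x w xw /=; first exact: hg.
by apply: ler_sum => y /andP[/andP[wy _] _]; apply: IH.
Qed.

Lemma Phi_ge0 k g x w : (forall u v, adj u v -> 0 <= g u v) -> adj x w -> 0 <= Phi k g x w.
Proof.
move=> hg; elim: k x w => [|k IH] x w xw /=; first exact: hg.
by apply: sumr_ge0 => y /andP[/andP[wy _] _]; apply: IH.
Qed.

Fixpoint eprev (x w : T) (s : seq T) : T := if s is y :: s' then eprev w y s' else x.

Lemma Phi_avw k g x w : Phi k g x w = \sum_(s <- avw k x w) g (eprev x w s) (last w s).
Proof.
elim: k x w => [|k IH] x w /=; first by rewrite big_seq1.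
by rewrite big_allpairs_dep big_enum /=; apply: eq_bigr => y _; rewrite IH.
Qed.

Lemma avw_uniq k x w : uniq (avw k x w).
Proof.
elim: k x w => [//|k IH] x w /=; apply: allpairs_uniq_dep.
- exact: enum_uniq.
- by move=> y _; apply: IH.
- by move=> [y s] [y' s'] _ _ /= [-> ->].
Qed.

Lemma avwP k x w s : s \in avw k x w ->
  [/\ size s = k, path [rel u v | adj u v && ~~ cut a b u v] w s & nonback x (w :: s)].
Proof.
elim: k x w s => [|k IH] x w s /=; first by rewrite inE => /eqP ->.
case/allpairsPdep => y [t [hy ht ->]]; have [st pt nt] := IH w y t ht.
move: hy; rewrite mem_enum inE => /andP[/andP[wy yx] nc]; split => /=.
- by rewrite st.
- by rewrite wy nc pt.
- by rewrite yx /=; move: nt => /= ->.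
Qed.

Section Ball.
Variables (c : T) (l : nat).
Local Notation B := (Defs.ball adj c l).
Hypothesis racy : acyclic (cutin adj B a b).

Let uniqr := nonback_unique (cutin_sym asym B a b) (cutin_irr airr B a b) racy.

Lemma avw_path k j x w s : w \in Defs.ball adj c j -> (j + k <= l)%N ->
  s \in avw k x w -> path (cutin adj B a b) w s /\ nonback w s.
Proof.
move=> wj jk /avwP[sk p /= /andP[_ ->]]; split => //.
have pa : path adj w s by apply: sub_path p => u v /= /andP[].
have pb : path (adjin adj B) w s by apply: path_ball wj pa _; rewrite sk.
elim: s w p pb {wj sk pa} => [//|y s IH] w /= /andP[/andP[_ nc] p] /andP[h pb].
by rewrite h nc IH.
Qed.

Lemma avw_inj k k' j x w s s' : w \in Defs.ball adj c j -> (j + k <= l)%N ->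
  (j + k' <= l)%N -> s \in avw k x w -> s' \in avw k' x w ->
  last w s = last w s' -> s = s'.
Proof.
move=> wj h h' hs hs' e.
have [p n] := avw_path wj h hs; have [p' n'] := avw_path wj h' hs'.
exact: (uniqr p n p' n' e).
Qed.

(** In a forest the end determines the walk and hence its length, so all these walks, of whatever
    length, have distinct ends. The longest has length h - 1, whence l + 1. *)
Lemma Phi_sum_le j h x w (G : T -> R) : w \in Defs.ball adj c j -> (j + h <= l.+1)%N ->
  (forall v, 0 <= G v) -> \sum_(k < h) Phi k (fun _ v => G v) x w <= \sum_v G v.
Proof.
move=> wj hl G0.
have key n : (n <= h)%N -> exists2 L, uniq (map (last w) L) &
   (forall s, s \in L -> exists2 k, (k < n)%N & s \in avw k x w) /\
   \sum_(k < n) Phi k (fun _ v => G v) x w = \sum_(s <- L) G (last w s).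
  elim: n => [|n IH] hn; first by exists [::] => //; split => //; rewrite big_ord0 big_nil.
  have [L uL [mL eL]] := IH (ltnW hn).
  exists (L ++ avw n x w).
    rewrite map_cat cat_uniq uL /= map_inj_in_uniq ?avw_uniq ?andbT.
      apply/hasPn => _ /mapP[s hs ->]; apply/negP => /mapP[t ht e].
      have [k kn hk] := mL t ht.
      have st : s = t by apply: (avw_inj wj _ _ hs hk e); lia.
      by have [sn _ _] := avwP hs; have [tk _ _] := avwP hk; move: kn; rewrite -tk -st sn ltnn.
    by move=> s t hs ht; apply: (avw_inj wj _ _ hs ht); lia.
  split; last by rewrite big_ord_recr /= eL Phi_avw big_cat.
  move=> s; rewrite mem_cat => /orP[/mL[k kn hk]|hs]; last by exists n.
  by exists k => //; apply: ltnW.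
have [L uL [_ ->]] := key h (leqnn h).
rewrite -(big_map (last w) xpredT G).
rewrite -[leRHS]big_enum /=; apply: ler_sum_uniq => // v _.
by rewrite mem_enum.
Qed.

End Ball.

Variables (F : T -> T -> R).
Hypothesis F0 : forall u v, 0 <= F u v.

Lemma Phi_sum_edges c l j h x w : acyclic (cutin adj (Defs.ball adj c l) a b) ->
  w \in Defs.ball adj c j -> (j + h <= l.+1)%N -> adj x w ->
  \sum_(k < h) Phi k F x w <= \sum_v \sum_(u | adj u v) F u v.
Proof.
move=> ac wj hl xw; pose G v := \sum_(u | adj u v) F u v.
have G0 v : 0 <= G v by apply: sumr_ge0.
apply: le_trans (Phi_sum_le ac x wj hl G0).
apply: ler_sum => k _; apply: Phi_le => // u v uv.
by rewrite /G (bigD1 u) //= lerDl sumr_ge0.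
Qed.

(* Number of avoiding walks that continue the edge (x, w), have length < k and
   can then be prolonged through c1 -> c2. *)
Fixpoint hitn (c1 c2 : T) (k : nat) (x w : T) : R :=
  if k is k'.+1 then \sum_(y | foll x w y)
    (if (w == c1) && (y == c2) then 1 else if cut a b w y then 0 else hitn c1 c2 k' w y)
  else 0.

Lemma hitnE c1 c2 k x w : cut a b c1 c2 -> hitn c1 c2 k x w =
  \sum_(j < k) Phi j (fun u v => ((v == c1) && foll u v c2)%:R) x w.
Proof.
move=> hc; elim: k x w => [|k IH] x w /=; first by rewrite big_ord0.
rewrite big_ord_recl /= exchange_big /=.
under [in RHS]eq_bigr do rewrite -IH.
rewrite [in RHS]big_mkcondr /=.
have [->|wc] /= := eqVneq w c1; last first.
  rewrite add0r; apply: eq_bigr => y _; by case: ifP.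
have [fc|nfc] := boolP (foll x c1 c2).
  rewrite (bigD1 c2) //= eqxx [in RHS](bigD1 c2) //= hc /= add0r; congr (_ + _).
  by apply: eq_bigr => y /andP[_ yc]; rewrite (negbTE yc); case: ifP.
rewrite add0r; apply: eq_bigr => y fy; have [yc|_] := eqVneq y c2.
  by rewrite yc (negbTE nfc) in fy.
by case: ifP.
Qed.

Lemma hitn_ge0 c1 c2 k x w : 0 <= hitn c1 c2 k x w.
Proof.
elim: k x w => [//|k IH] x w /=; apply: sumr_ge0 => y _.
by case: ifP => // _; case: ifP.
Qed.

(** At most one of the avoiding walks, over all lengths, ends at c1. *)
Lemma hitn_le1 c l j c1 c2 k x w : acyclic (cutin adj (Defs.ball adj c l) a b) ->
  cut a b c1 c2 -> w \in Defs.ball adj c j -> (j + k <= l.+1)%N -> adj x w ->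
  hitn c1 c2 k x w <= 1.
Proof.
move=> ac hc wj jk xw; rewrite hitnE //.
apply: (@le_trans _ _ (\sum_v (v == c1)%:R)); last first.
  by rewrite (bigD1 c1) //= eqxx big1 ?addr0 // => v /negbTE ->.
apply: le_trans (Phi_sum_le ac x wj jk (G := fun v => (v == c1)%:R) _) => //.
apply: ler_sum => i _; apply: Phi_le => // u v _.
by case: (v == c1); case: (foll u v c2).
Qed.

(** To cross from c2 to c1, an avoiding walk must first lead from c2 back to c2; only the trivial
    one does, and stepping to c1 would then backtrack. *)
Lemma hitn_back c l j c1 c2 k : acyclic (cutin adj (Defs.ball adj c l) a b) ->
  cut a b c1 c2 -> c2 \in Defs.ball adj c j -> (j + k <= l.+1)%N -> adj c1 c2 ->
  hitn c2 c1 k c1 c2 = 0.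
Proof.
move=> ac hc wj jk ad; rewrite hitnE; last by rewrite cut_sym.
apply: big1 => i _; rewrite Phi_avw big_seq; apply: big1 => s hs.
case: eqP => //= e.
suff -> : s = [::] by rewrite /= /foll eqxx andbF.
have il : (j + i <= l)%N by have := ltn_ord i; move: jk; clear; lia.
have [p n] := avw_path wj il hs.
have uniqr := nonback_unique (cutin_sym asym _ a b) (cutin_irr airr _ a b) ac.
exact: (uniqr _ _ _ p n).
Qed.

Lemma hitn_ball c1 c2 k x w : cut a b c1 c2 -> hitn c1 c2 k x w != 0 ->
  adj c1 c2 /\ c2 \in Defs.ball adj w k.
Proof.
move=> hc; rewrite hitnE // => h.
have [i hi] : exists i : 'I_k, Phi i (fun u v => ((v == c1) && foll u v c2)%:R) x w != 0.
  apply: contrapT => nh; move/eqP: h; apply; apply: big1 => i _.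
  by apply/eqP; apply: contrapT => /negP hi; apply: nh; exists i.
have [s hs ls] : exists2 s, s \in avw i x w & (last w s == c1) && foll (eprev x w s) (last w s) c2.
  apply: contrapT => nh; move/eqP: hi; apply; rewrite Phi_avw big_seq; apply: big1 => s hs.
  by case: (boolP (_ && _)) => // e; case: nh; exists s.
have [ss p _] := avwP hs; case/andP: ls => /eqP lc /andP[ad _].
rewrite lc in ad; split => //.
have pa : path adj w s by apply: sub_path p => u v /= /andP[].
have := last_ball (ball0 adj w) pa; rewrite add0n ss lc => hb.
exact: (fintype.subsetP (sub_ball adj w (ltn_ord i)) _ (ball_step hb ad)).
Qed.

Section Step.
(** In the application [phi] is |f| / sqrt I, [sg x w y] is the square root of the share of I(w,y)
    in the sum over continuations, and [ka] bounds this root where the walk branches. *)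
Variables (phi : T -> T -> R) (sg : T -> T -> T -> R) (ka : R).
Hypothesis phi0 : forall u v, 0 <= phi u v.
Hypothesis sg0 : forall x w y, 0 <= sg x w y.
Hypothesis sg1 : forall x w, adj x w -> \sum_(y | foll x w y) sg x w y ^+ 2 <= 1.
Hypothesis sgd : forall x w y, adj x w -> foll x w y -> (3 <= deg adj w)%N -> sg x w y <= ka.
Hypothesis phiS : forall x w, adj x w -> phi x w <= \sum_(y | foll x w y) sg x w y * phi w y.
Hypothesis FE : forall x w, F x w = phi x w ^+ 2.

Lemma sg_le1 x w y : adj x w -> foll x w y -> sg x w y <= 1.
Proof.
move=> xw fy; rewrite -(ler_pXn2r (_ : 0 < 2)%N) ?nnegrE // expr1n.
apply: le_trans (sg1 xw); rewrite (bigD1 y) //= lerDl sumr_ge0 // => i _.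
exact: sqr_ge0.
Qed.

Lemma F_step x w : adj x w -> F x w <= \sum_(y | foll x w y) F w y.
Proof.
move=> xw; rewrite FE; have h := phiS xw.
apply: (@le_trans _ _ ((\sum_(y | foll x w y) sg x w y * phi w y) ^+ 2)).
  rewrite lerXn2r ?nnegrE //; apply: sumr_ge0 => y _; exact: mulr_ge0.
apply: le_trans (sum_cauchy_schwarz _ _ _ _) _.
under [leRHS]eq_bigr do rewrite FE.
by rewrite ler_piMl ?sg1 // sumr_ge0 // => y _; apply: sqr_ge0.
Qed.

(** Iteration of [F_step]: a walk is abandoned at its first crossing of the cut edge and leaves the
    value of F there. *)
Lemma F_hit k x w : adj x w ->
  F x w <= Phi k F x w + (hitn a b k x w * F a b + hitn b a k x w * F b a).
Proof.
elim: k x w => [|k IH] x w xw /=; first by rewrite !mul0r !addr0.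
apply: le_trans (F_step xw) _.
rewrite [X in _ <= X + _]big_mkcondr /= !mulr_suml -!big_split /=.
apply: ler_sum => y /andP[wy yx].
have [c|nc] := boolP (cut a b w y); rewrite ?c ?nc /=.
  case/orP: c => /andP[/eqP -> /eqP ->]; rewrite !eqxx /= mul1r add0r.
    by rewrite lerDl mulr_ge0 //; case: ifP => //; case: ifP => //; rewrite hitn_ge0.
  by rewrite lerDr mulr_ge0 //; case: ifP => //; case: ifP => //; rewrite hitn_ge0.
have := nc; rewrite negb_or => /andP[/negbTE -> /negbTE ->].
exact: IH.
Qed.

(** [hitn] with each walk weighted by the product of [sg] along it. Around the cycle [hitn] may
    equal 1, while the weights retain a factor [ka]. *)
Fixpoint hits (c1 c2 : T) (k : nat) (x w : T) : R :=
  if k is k'.+1 then \sum_(y | foll x w y) sg x w y *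
    (if (w == c1) && (y == c2) then 1 else if cut a b w y then 0 else hits c1 c2 k' w y)
  else 0.

Lemma hits_ge0 c1 c2 k x w : 0 <= hits c1 c2 k x w.
Proof.
elim: k x w => [//|k IH] x w /=; apply: sumr_ge0 => y _; rewrite mulr_ge0 //.
by case: ifP => // _; case: ifP.
Qed.

Lemma hits_le c1 c2 k x w : adj x w -> hits c1 c2 k x w <= hitn c1 c2 k x w.
Proof.
elim: k x w => [//|k IH] x w xw /=; apply: ler_sum => y fy.
have h1 := sg_le1 xw fy; have /andP[wy _] := fy.
case: ifP => _; first by rewrite mulr1.
case: ifP => _; first by rewrite mulr0.
by rewrite (le_trans _ (IH w y wy)) // ler_piMl ?hits_ge0.
Qed.

(** Serves the crossing from a to b, after which the walk sets out from b, of degree at least 3. *)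
Lemma hits_le_first c1 c2 k x w : adj x w -> (3 <= deg adj w)%N ->
  hits c1 c2 k x w <= ka * hitn c1 c2 k x w.
Proof.
case: k => [|k] xw dw /=; first by rewrite mulr0.
rewrite mulr_sumr; apply: ler_sum => y fy.
have h1 := sgd xw fy dw; have /andP[wy _] := fy.
have ka0 : 0 <= ka := le_trans (sg0 _ _ _) h1.
case: ifP => _; first by rewrite !mulr1.
case: ifP => _; first by rewrite !mulr0.
by rewrite ler_pM ?hits_ge0 ?hits_le.
Qed.

(** Serves the crossing from b to a, where it is the last step of a hit that leaves b. *)
Lemma hits_le_last c1 c2 k x w : adj x w -> (3 <= deg adj c1)%N -> 0 <= ka ->
  hits c1 c2 k x w <= ka * hitn c1 c2 k x w.
Proof.
move=> xw dc ka0; elim: k x w xw => [|k IH] x w xw /=; first by rewrite mulr0.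
rewrite mulr_sumr; apply: ler_sum => y fy.
have h1 := sg_le1 xw fy; have /andP[wy _] := fy.
case: ifP => [/andP[/eqP wc _]|_]; first by rewrite !mulr1 sgd // wc.
case: ifP => _; first by rewrite !mulr0.
by rewrite (le_trans _ (IH w y wy)) // ler_piMl ?hits_ge0.
Qed.

(** Cauchy-Schwarz is applied only to the walks that avoid the cut; crossings stay linear in [phi],
    so their weights are not lost. *)
Lemma phi_hit k x w : adj x w ->
  phi x w <= Num.sqrt (Phi k F x w) + (hits a b k x w * phi a b + hits b a k x w * phi b a).
Proof.
elim: k x w => [|k IH] x w xw /=.
  by rewrite !mul0r !addr0 FE sqrtr_sqr ger0_norm.
apply: le_trans (phiS xw) _.
apply: (@le_trans _ _ (\sum_(y | foll x w y && ~~ cut a b w y) sg x w y * Num.sqrt (Phi k F w y)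
   + (hits a b k.+1 x w * phi a b + hits b a k.+1 x w * phi b a))).
  rewrite [X in _ <= X + _]big_mkcondr /= !mulr_suml -!big_split /=.
  apply: ler_sum => y fy.
  have /andP[wy yx] := fy; rewrite -!mulrA -!mulrDr.
  have [c|nc] := boolP (cut a b w y); rewrite ?c ?nc /=.
    rewrite add0r ler_wpM2l //.
    case/orP: c => /andP[/eqP -> /eqP ->]; rewrite !eqxx /= mul1r.
      by rewrite lerDl mulr_ge0 //; case: ifP => //; case: ifP => //; rewrite hits_ge0.
    by rewrite lerDr mulr_ge0 //; case: ifP => //; case: ifP => //; rewrite hits_ge0.
  have := nc; rewrite negb_or => /andP[/negbTE -> /negbTE ->].
  by rewrite -!mulrDr ler_wpM2l // IH.
rewrite lerD2r.
have S0 : 0 <= \sum_(y | foll x w y && ~~ cut a b w y) Phi k F w y.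
  by apply: sumr_ge0 => y /andP[/andP[wy _] _]; apply: Phi_ge0.
rewrite -(ler_pXn2r (_ : 0 < 2)%N) ?nnegrE ?sqrtr_ge0 //; last first.
  by apply: sumr_ge0 => y _; rewrite mulr_ge0 ?sqrtr_ge0.
rewrite sqr_sqrtr //; apply: le_trans (sum_cauchy_schwarz _ _ _ _) _.
have -> : \sum_(y | foll x w y && ~~ cut a b w y) Num.sqrt (Phi k F w y) ^+ 2 =
    \sum_(y | foll x w y && ~~ cut a b w y) Phi k F w y.
  by apply: eq_bigr => y /andP[/andP[wy _] _]; rewrite sqr_sqrtr // Phi_ge0.
rewrite ler_piMl //; apply: le_trans (sg1 xw).
rewrite [leLHS]big_mkcondr /=; apply: ler_sum => y _; case: ifP => // _; exact: sqr_ge0.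
Qed.

Hypothesis ka01 : 0 <= ka < 1.
Hypothesis degb : adj a b -> (3 <= deg adj b)%N.

(** In [phi_hit] the crossing recurs in its own bound with coefficient at most [ka], and the
    opposite crossing has coefficient 0, so the recurring term is absorbed on the left. *)
Lemma F_cut_le c l j k c1 c2 : acyclic (cutin adj (Defs.ball adj c l) a b) ->
  cut a b c1 c2 -> c2 \in Defs.ball adj c j -> (j + k <= l.+1)%N -> adj c1 c2 ->
  F c1 c2 <= Phi k F c1 c2 / (1 - ka) ^+ 2.
Proof.
move=> ac hc cj jk ad; have /andP[ka0 ka1] := ka01.
have P0 : 0 <= Phi k F c1 c2 by apply: Phi_ge0.
suff h : (1 - ka) * phi c1 c2 <= Num.sqrt (Phi k F c1 c2).
  rewrite ler_pdivlMr ?exprn_gt0 ?subr_gt0 // FE -exprMn mulrC -[leRHS]sqr_sqrtr //.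
  rewrite lerXn2r ?nnegrE ?sqrtr_ge0 // mulr_ge0 // subr_ge0; exact: ltW.
have hb := hitn_back ac hc cj jk ad.
have h1 := hitn_le1 ac hc cj jk ad.
have hb0 : hits c2 c1 k c1 c2 = 0.
  by apply/eqP; rewrite eq_le hits_ge0 andbT -hb hits_le.
have h2 : hits c1 c2 k c1 c2 <= ka.
  apply: (@le_trans _ _ (ka * hitn c1 c2 k c1 c2)); last by rewrite ler_piMr.
  case/orP: hc => /andP[/eqP e1 /eqP e2]; subst c1 c2.
    by apply: hits_le_first => //; apply: degb.
  by apply: hits_le_last => //; apply: degb; rewrite asym.
have h3 : hits c1 c2 k c1 c2 * phi c1 c2 <= ka * phi c1 c2 by rewrite ler_wpM2r.
have := phi_hit k ad.
case/orP: hc hb0 h3 => /andP[/eqP e1 /eqP e2]; subst c1 c2 => -> h3.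
  by rewrite mul0r addr0; lra.
by rewrite mul0r add0r; lra.
Qed.

(** If no walk hits, the sum vanishes. Otherwise c2 lies within h - 1 of w, and walks of length
    below h restarted there stay in the ball because 2 h <= l + 2. *)
Lemma F_cut_sum l h x w c1 c2 : acyclic (cutin adj (Defs.ball adj w l) a b) ->
  cut a b c1 c2 -> (h.*2 <= l.+2)%N -> adj x w ->
  \sum_(k < h) hitn c1 c2 k x w * F c1 c2 <=
  (\sum_v \sum_(u | adj u v) F u v) / (1 - ka) ^+ 2.
Proof.
move=> ac hc hl xw; have /andP[ka0 ka1] := ka01.
have S0 : 0 <= \sum_v \sum_(u | adj u v) F u v.
  by apply: sumr_ge0 => v _; apply: sumr_ge0.
have [[i hi]|nh] := pselect (exists k : 'I_h, hitn c1 c2 k x w != 0); last first.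
  rewrite big1 ?divr_ge0 ?sqr_ge0 // => k _.
  have [->|hk] := eqVneq (hitn c1 c2 k x w) 0; first by rewrite mul0r.
  by case: nh; exists k.
have [ad cb] := hitn_ball hc hi.
have hi1 : (i <= h.-1)%N by have := ltn_ord i; clear; lia.
have hh : (h.-1 + h <= l.+1)%N by have := ltn_ord i; move: hl; clear; lia.
have {}cb := fintype.subsetP (sub_ball adj w hi1) _ cb.
apply: le_trans (_ : (\sum_(k < h) Phi k F c1 c2) / (1 - ka) ^+ 2 <= _); last first.
  by rewrite ler_wpM2r ?invr_ge0 ?sqr_ge0 // (Phi_sum_edges ac cb hh).
rewrite mulr_suml; apply: ler_sum => k _.
have hk : (h.-1 + k <= l.+1)%N by have := ltn_ord k; move: hh; clear; lia.
have hk0 : (0 + k <= l.+1)%N by move: hk; clear; lia.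
apply: le_trans (F_cut_le ac hc cb hk ad).
by rewrite ler_piMl // (hitn_le1 ac hc (ball0 adj w) hk0).
Qed.

(** The 1 stands for walks that avoid the cut edge, the 2 for its two directions. *)
Lemma F_estimate l h x w : acyclic (cutin adj (Defs.ball adj w l) a b) ->
  (h.*2 <= l.+2)%N -> adj x w ->
  h%:R * F x w <= (1 + 2 / (1 - ka) ^+ 2) * \sum_v \sum_(u | adj u v) F u v.
Proof.
move=> ac hl xw.
have cab : cut a b a b by rewrite /cut !eqxx.
have cba : cut a b b a by rewrite cut_sym.
have h1 := F_cut_sum ac cab hl xw; have h2 := F_cut_sum ac cba hl xw.
have h0 : (0 + h <= l.+1)%N by move: hl; clear; lia.
have h3 := Phi_sum_edges ac (ball0 adj w) h0 xw.
have -> : h%:R * F x w = \sum_(k < h) F x w by rewrite sumr_const card_ord mulr_natl.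
apply: le_trans (_ : _ <= \sum_(k < h) (Phi k F x w +
    (hitn a b k x w * F a b + hitn b a k x w * F b a))) _.
  by apply: ler_sum => k _; apply: F_hit.
rewrite !big_split /=; apply: le_trans (lerD h3 (lerD h1 h2)) _.
lra.
Qed.

End Step.
End Avoiding.

(** * Norms and degrees *)

Section NormC.
Variable R : realType.

Lemma normc_sqn (x : R[i]) : ComplexField.Normc.normc x = Num.sqrt (sqn x).
Proof. by case: x. Qed.

Lemma sqrt_sqn_sum (I : Type) (r : seq I) (P : pred I) (f : I -> R[i]) :
  Num.sqrt (sqn (\sum_(i <- r | P i) f i)) <= \sum_(i <- r | P i) Num.sqrt (sqn (f i)).
Proof.
elim/big_rec2: _ => [|i x y _ h]; first by rewrite sqn0 sqrtr0.
by rewrite -!normc_sqn in h *; apply: le_trans (le_normcD _ _) _; rewrite lerD2l.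
Qed.

Lemma sup_norm_le (T : finType) (psi : T -> R[i]) (M : R) : 0 <= M ->
  (forall x, sqn (psi x) <= M ^+ 2) -> sup_norm psi <= M.
Proof.
move=> M0 h; apply: bigmax_le => // x _; rewrite normc_sqn.
by rewrite -[leRHS]ger0_norm // -sqrtr_sqr ler_wsqrtr.
Qed.

End NormC.

Section Degree.
Variables (T : finType) (adj : rel T).
Hypothesis asym : symmetric adj.

Lemma deg_le_max x : (deg adj x <= max_deg adj)%N.
Proof. exact: leq_bigmax. Qed.

Lemma sum_adj (R : realType) x (c : R) : \sum_(y | adj x y) c = (deg adj x)%:R * c.
Proof.
rewrite sumr_const mulr_natl; have -> // : deg adj x = #|adj x|.
by apply: eq_card => y; rewrite inE.
Qed.

Lemma foll_ex x w : (2 <= deg adj w)%N -> exists y, foll adj x w y.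
Proof.
move=> d; apply: contrapT => h.
have : [set y | adj w y]%SET \subset [set x]%SET.
  apply/fintype.subsetP => y; rewrite !inE => wy; apply: contrapT => /negP yx.
  by apply: h; exists y; rewrite /foll wy.
by move=> /subset_leq_card; rewrite cards1 leqNgt d.
Qed.

Lemma foll_ex2 x w y : (3 <= deg adj w)%N -> exists2 y', foll adj x w y' & y' != y.
Proof.
move=> d; apply: contrapT => h.
have : [set y | adj w y]%SET \subset [set x; y]%SET.
  apply/fintype.subsetP => y'; rewrite !inE => wy.
  apply: contrapT => /negP; rewrite negb_or => /andP[y'x y'y].
  by apply: h; exists y' => //; rewrite /foll wy.
move=> /subset_leq_card; rewrite cards2 => /(leq_trans d).
by case: (x != y).
Qed.

End Degree.

Lemma mul_eq1_parts (R : realType) (p g s : R[i]) (w : R) :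
  p * (g - (w%:C)%C - s) = 1 ->
  complex.Re p * (complex.Re g - w - complex.Re s) -
    complex.Im p * (complex.Im g - complex.Im s) = 1 /\
  complex.Re p * (complex.Im g - complex.Im s) +
    complex.Im p * (complex.Re g - w - complex.Re s) = 0.
Proof.
move=> h; split.
  by move: (congr1 (@complex.Re R) h); rewrite !cE /= subr0.
by move: (congr1 (@complex.Im R) h); rewrite !cE /= subr0.
Qed.

(** * The bulk spectrum *)

Section BulkLimit.
Variables (R : realType) (T : finType) (adj : rel T) (W : T -> R) (lam : R).
Hypothesis asym : symmetric adj.
(** Arguments in the order of a walk step from u to v, the reverse of those of [zeta]. *)
Variable Z : T -> T -> R[i].
Hypothesis hZ : forall u v, adj u v -> zeta_limit adj W v u lam (Z u v) /\ complex.Im (Z u v) != 0.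

(** The nonzero imaginary parts of the limits keep [zeta] nonzero for small eta, so [zeta_rec]
    applies there; being free of division, it passes to the limit in real and imaginary parts. *)
Lemma Z_rec w v : adj w v ->
  Z w v * ((lam%:C)%C - (W v)%:C%C - \sum_(u | foll adj w v u) Z v u) = 1.
Proof.
move=> wv.
have near_rec : \forall eta \near ((0 : R)^'+)%classic,
   zeta adj W v w (lam +i* eta)%C * ((lam +i* eta)%C - (W v)%:C%C
    - \sum_(u | foll adj w v u) zeta adj W u v (lam +i* eta)%C) = 1.
  have nz : \forall eta \near ((0 : R)^'+)%classic,
      forall u, adj v u -> zeta adj W u v (lam +i* eta)%C != 0.
    apply: filter_forall => u; have [vu|] := boolP (adj v u); last by move=> _; apply: nearW.
    have [[_ cI] I0] := hZ vu.
    near=> eta => _.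
    have : complex.Im (zeta adj W u v (lam +i* eta)%C) != 0.
      by near: eta; apply: cvgr_neq0 cI I0.
    by apply: contraNneq => ->.
  near=> eta.
  apply: zeta_rec; first by near: eta; apply: nbhs_right_gt.
  by near: eta.
have [[wR wI] _] := hZ wv.
have sR : ((fun eta => \sum_(u | foll adj w v u) complex.Re (zeta adj W u v (lam +i* eta)%C))
   @ 0^'+ --> \sum_(u | foll adj w v u) complex.Re (Z v u))%classic.
  by apply: cvg_sum_seq => u /andP[vu _]; have [[]] := hZ vu.
have sI : ((fun eta => \sum_(u | foll adj w v u) complex.Im (zeta adj W u v (lam +i* eta)%C))
   @ 0^'+ --> \sum_(u | foll adj w v u) complex.Im (Z v u))%classic.
  by apply: cvg_sum_seq => u /andP[vu _]; have [[]] := hZ vu.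
have id0 : ((fun eta : R => eta) @ 0^'+ --> (0 : R))%classic.
  by apply: cvg_at_right_filter; exact: cvg_id.
set A := fun eta => complex.Re (zeta adj W v w (lam +i* eta)%C) in wR.
set B := fun eta => complex.Im (zeta adj W v w (lam +i* eta)%C) in wI.
set C := fun eta : R => _ in sR.
set D := fun eta : R => _ in sI.
have c1 : ((fun eta => A eta * (lam - W v - C eta) - B eta * (eta - D eta)) @ 0^'+ -->
   (complex.Re (Z w v) * (lam - W v - \sum_(u | foll adj w v u) complex.Re (Z v u)) -
    complex.Im (Z w v) * (0 - \sum_(u | foll adj w v u) complex.Im (Z v u))))%classic.
  by apply: cvgB; apply: cvgM => //; apply: cvgB => //; exact: cvg_cst.
have c2 : ((fun eta => A eta * (eta - D eta) + B eta * (lam - W v - C eta)) @ 0^'+ -->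
   (complex.Re (Z w v) * (0 - \sum_(u | foll adj w v u) complex.Im (Z v u)) +
    complex.Im (Z w v) * (lam - W v - \sum_(u | foll adj w v u) complex.Re (Z v u))))%classic.
  by apply: cvgD; apply: cvgM => //; apply: cvgB => //; exact: cvg_cst.
have e1 : ((fun eta => A eta * (lam - W v - C eta) - B eta * (eta - D eta)) @ 0^'+ --> (1 : R))%classic.
  apply: cvg_near_cst; apply: filterS near_rec => eta /mul_eq1_parts[<- _].
  by rewrite /A /B /C /D Re_sum Im_sum.
have e2 : ((fun eta => A eta * (eta - D eta) + B eta * (lam - W v - C eta)) @ 0^'+ --> (0 : R))%classic.
  apply: cvg_near_cst; apply: filterS near_rec => eta /mul_eq1_parts[_ <-].
  by rewrite /A /B /C /D Re_sum Im_sum.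
have h1 := norm_cvg_unique c1 e1; have h2 := norm_cvg_unique c2 e2.
apply: complex_eq; rewrite !cE /=; [rewrite -[RHS]h1|rewrite -[RHS]h2]; ring.
Unshelve. all: by end_near.
Qed.

Lemma Z_im u v : adj u v -> complex.Im (Z u v) < 0.
Proof.
move=> uv; have [[_ cI] I0] := hZ uv; rewrite lt_neqAle I0 /=.
rewrite -(cvg_lim _ cI) //; apply: limr_le; first by apply/cvg_ex; eexists; exact: cI.
near=> eta; apply: zeta_im; near: eta; exact: nbhs_right_gt.
Unshelve. all: by end_near.
Qed.

End BulkLimit.

(** * The eigenfunction estimate in the bulk *)

Section BulkBound.
Variables (R : realType) (T : finType) (adj : rel T) (W : T -> R) (lam : R).
Variables (psi : T -> R[i]) (Z : T -> T -> R[i]) (z : R) (ell : nat).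
Hypothesis asym : symmetric adj.
Hypothesis airr : irreflexive adj.
Hypothesis conn : connected_graph adj.
Hypothesis mind : min_deg_ge2 adj.
Hypothesis ncyc : ~ is_cycle_graph adj.
Hypothesis psiE : forall x, \sum_(y | adj x y) psi y + (W x)%:C%C * psi x
                 = (lam%:C)%C * psi x.
Hypothesis psi1 : l2_norm_sq psi = 1.
Hypothesis hell : forall x, at_most_one_cycle adj (Defs.ball adj x ell).
Hypothesis ell0 : (0 < ell)%N.
Hypothesis Zrec : forall w v, adj w v ->
  Z w v * ((lam%:C)%C - (W v)%:C%C - \sum_(u | foll adj w v u) Z v u) = 1.
Hypothesis z0 : 0 < z.
Hypothesis Zim : forall u v, adj u v -> z <= - complex.Im (Z u v).

Local Notation D := (max_deg adj).
Let I u v : R := - complex.Im (Z u v).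
Let S x w : R := \sum_(y | foll adj x w y) I w y.
Let X x w : R[i] := (lam%:C)%C - (W w)%:C%C - \sum_(u | foll adj x w u) Z w u.
Let f x w : R[i] := psi w - Z x w * psi x.

Lemma I_ge u v : adj u v -> z <= I u v.
Proof. exact: Zim. Qed.

Lemma I_gt0 u v : adj u v -> 0 < I u v.
Proof. by move=> /I_ge; apply: lt_le_trans. Qed.

Lemma ImX x w : complex.Im (X x w) = S x w.
Proof. by rewrite /X !cE /= subrr sub0r /S sumrN. Qed.

Lemma sqnXZ x w : adj x w -> sqn (Z x w) * sqn (X x w) = 1.
Proof. by move=> xw; rewrite -sqnM Zrec // /sqn /= expr0n expr1n addr0. Qed.

Lemma sqnZ_gt0 x w : adj x w -> 0 < sqn (Z x w).
Proof.
move=> xw; rewrite lt_neqAle sqn_ge0 andbT eq_sym.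
by apply: contra_eqN (sqnXZ xw) => /eqP ->; rewrite mul0r eq_sym oner_eq0.
Qed.

Lemma I_rec x w : adj x w -> I x w = sqn (Z x w) * S x w.
Proof.
move=> xw; rewrite -ImX; have h := Zrec xw; rewrite -/(X x w) in h.
have h1 := congr1 (@complex.Re R) h; have h2 := congr1 (@complex.Im R) h.
move: h1 h2; rewrite cReM cImM /I /sqn.
case: (Z x w) (X x w) => p q [r s] /= h1 h2.
have : - q * (p * r - q * s) = (p ^+ 2 + q ^+ 2) * s - p * (p * s + q * r) by ring.
by rewrite h1 h2 mulr1 mulr0 subr0.
Qed.

Lemma S_ge x w : adj x w -> z <= S x w.
Proof.
move=> xw; have [y fy] := foll_ex x (mind w).
rewrite /S (bigD1 y) //=; have /andP[wy _] := fy.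
rewrite (le_trans (I_ge wy)) // lerDl sumr_ge0 // => u /andP[/andP[wu _] _].
exact: ltW (I_gt0 wu).
Qed.

Lemma S_gt0 x w : adj x w -> 0 < S x w.
Proof. by move=> /S_ge; apply: lt_le_trans. Qed.

(** From I^2 <= |Z|^2 = I / S. Together with I >= z it bounds S by 1 / z. *)
Lemma IS_le1 x w : adj x w -> I x w * S x w <= 1.
Proof.
move=> xw; have I0 := I_gt0 xw; have S0 := S_gt0 xw.
have h : I x w ^+ 2 <= sqn (Z x w) by rewrite /I sqrrN /sqn lerDr sqr_ge0.
rewrite -(ler_pM2l I0) mulr1 mulrA -expr2 {2}(I_rec xw).
by rewrite ler_wpM2r // ltW.
Qed.

Lemma zS_le1 x w : adj x w -> z * S x w <= 1.
Proof.
move=> xw; apply: le_trans (IS_le1 xw); by rewrite ler_wpM2r ?I_ge ?(ltW (S_gt0 xw)).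
Qed.

Lemma exists_edge (x : T) : exists y, adj x y.
Proof. by have [y /andP[xy _]] := foll_ex x (mind x); exists y. Qed.

Lemma z_le1 (x : T) : z <= 1.
Proof.
have [y xy] := exists_edge x.
rewrite -(ler_pXn2r (_ : 0 < 2)%N) ?nnegrE ?(ltW z0) // expr1n expr2.
apply: le_trans (zS_le1 xy); rewrite ler_pM2l // S_ge //.
Qed.

(** The eigenvalue equation at w turns the sum into X psi(w) - psi(x), and Z X = 1. *)
Lemma f_rec x w : adj x w -> f x w = Z x w * \sum_(y | foll adj x w y) f w y.
Proof.
move=> xw.
have -> : \sum_(y | foll adj x w y) f w y = X x w * psi w - psi x.
  rewrite /f sumrB -mulr_suml.
  have := psiE w; rewrite (bigD1 x) /=; last by rewrite asym.
  move=> h; rewrite /X; set A := \sum_(i | _) psi i in h *.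
  have -> : A = (lam%:C)%C * psi w - psi x - (W w)%:C%C * psi w by rewrite -h; ring.
  by ring.
rewrite mulrBr mulrA [Z x w * X x w]Zrec // mul1r //.
Qed.

Let phi x w : R := Num.sqrt (sqn (f x w) / I x w).
Let sg x w y : R := Num.sqrt (I w y / S x w).
Let F x w : R := phi x w ^+ 2.
Let ka : R := Num.sqrt (1 - z ^+ 2).

Lemma FE x w : adj x w -> F x w = sqn (f x w) / I x w.
Proof.
by move=> xw; rewrite /F /phi sqr_sqrtr // divr_ge0 ?sqn_ge0 // ltW ?I_gt0.
Qed.

Lemma sg_sqr x w y : adj x w -> foll adj x w y -> sg x w y ^+ 2 = I w y / S x w.
Proof.
move=> xw /andP[wy _]; rewrite /sg sqr_sqrtr // divr_ge0 // ltW ?I_gt0 ?S_gt0 //.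
Qed.

Lemma sg_sum x w : adj x w -> \sum_(y | foll adj x w y) sg x w y ^+ 2 <= 1.
Proof.
move=> xw; rewrite (eq_bigr (fun y => I w y / S x w)) => [|y fy]; last exact: sg_sqr.
by rewrite -mulr_suml divff ?gt_eqF ?S_gt0.
Qed.

(** A second continuation y' has I(w,y') >= z >= z^2 S, which leaves y a share of at most 1 -
    z^2. *)
Lemma sg_branch x w y : adj x w -> foll adj x w y -> (3 <= deg adj w)%N -> sg x w y <= ka.
Proof.
move=> xw fy d; apply: ler_wsqrtr; have /andP[wy _] := fy.
have [y' fy' yy'] := foll_ex2 x y d; have /andP[wy' _] := fy'.
have S0 := S_gt0 xw; rewrite ler_pdivrMr // mulrBl mul1r.
have : I w y + I w y' <= S x w.
  rewrite /S (bigD1 y) //= lerD2l (bigD1 y') /=; last by rewrite fy'.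
  by rewrite lerDl sumr_ge0 // => u /andP[/andP[/andP[wu _] _] _]; apply/ltW/I_gt0.
have : z ^+ 2 * S x w <= z by rewrite expr2 -mulrA ler_piMr ?zS_le1 // ltW.
have : z <= I w y' by apply: I_ge.
lra.
Qed.

Lemma phi_step x w : adj x w -> phi x w <= \sum_(y | foll adj x w y) sg x w y * phi w y.
Proof.
move=> xw; have S0 := S_gt0 xw; have I0 := I_gt0 xw.
have -> : phi x w = Num.sqrt (sqn (\sum_(y | foll adj x w y) f w y)) / Num.sqrt (S x w).
  rewrite /phi -sqrtrV ?ltW // -sqrtrM ?sqn_ge0 //; congr Num.sqrt.
  rewrite f_rec // sqnM {1}I_rec //; have := sqnZ_gt0 xw => Z0.
  by field; rewrite !gt_eqF.
rewrite ler_pdivrMr ?sqrtr_gt0 // mulr_suml; apply: le_trans (sqrt_sqn_sum _ _ _) _.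
apply: ler_sum => y /andP[wy _]; have J0 := I_gt0 wy.
have J0' := ltW J0; have S0' := ltW S0.
rewrite /sg /phi -sqrtrM ?divr_ge0 // -sqrtrM ?mulr_ge0 ?invr_ge0 ?sqn_ge0 //.
by rewrite (_ : _ * _ * _ = sqn (f w y)) //; field; rewrite !gt_eqF.
Qed.

Lemma sum_sqn_psi : \sum_x sqn (psi x) = 1.
Proof. exact: psi1. Qed.

(** |f|^2 <= 2 |psi(v)|^2 + 2 |Z|^2 |psi(u)|^2, where 1 / I and |Z|^2 / I = 1 / S are both at most 1
    / z; each vertex is at most D times either end of an edge. *)
Lemma F_total : \sum_v \sum_(u | adj u v) F u v <= 4 * D%:R / z.
Proof.
apply: le_trans (_ : \sum_v \sum_(u | adj u v) (2 / z) * (sqn (psi v) + sqn (psi u)) <= _).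
  apply: ler_sum => v _; apply: ler_sum => u uv.
  have I0 := I_gt0 uv; have S0 := S_gt0 uv.
  rewrite FE // ler_pdivrMr // /f; apply: le_trans (sqnDle _ _) _.
  rewrite sqnN sqnM.
  have e1 : 1 <= I u v / z by rewrite ler_pdivlMr // mul1r I_ge.
  have e2 : sqn (Z u v) <= I u v / z.
    by rewrite ler_pdivlMr // I_rec // ler_wpM2l ?sqn_ge0 // S_ge.
  have -> : 2 / z * (sqn (psi v) + sqn (psi u)) * I u v =
      2 * (I u v / z * sqn (psi v) + I u v / z * sqn (psi u)) by ring.
  rewrite ler_pM2l // lerD //; last by rewrite ler_wpM2r ?sqn_ge0.
  by rewrite ler_peMl ?sqn_ge0.
rewrite (eq_bigr (fun v => 2 / z * \sum_(u | adj u v) sqn (psi v) +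
    2 / z * \sum_(u | adj u v) sqn (psi u))); last first.
  by move=> v _; rewrite -mulrDr -big_split mulr_sumr.
rewrite big_split /= -!mulr_sumr -mulrDr.
have h1 : \sum_v \sum_(u | adj u v) sqn (psi v) <= D%:R.
  rewrite -[leRHS]mulr1 -[X in _ <= _ * X]sum_sqn_psi mulr_sumr; apply: ler_sum => v _.
  rewrite (eq_bigl (fun u => adj v u)); last by move=> u; rewrite asym.
  by rewrite sum_adj ler_wpM2r ?sqn_ge0 // ler_nat deg_le_max.
have h2 : \sum_v \sum_(u | adj u v) sqn (psi u) <= D%:R.
  rewrite (exchange_big_dep xpredT) //=.
  rewrite -[leRHS]mulr1 -[X in _ <= _ * X]sum_sqn_psi mulr_sumr; apply: ler_sum => v _.
  by rewrite sum_adj ler_wpM2r ?sqn_ge0 // ler_nat deg_le_max.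
have zi : 0 < z^-1 by rewrite invr_gt0.
apply: le_trans (_ : 2 / z * (D%:R + D%:R) <= _).
  by rewrite ler_wpM2l ?lerD // mulr_ge0 // ltW.
by rewrite le_eqVlt; apply/orP; left; apply/eqP; ring.
Qed.

(** 72 is 2 times 9 times 4: at least ell / 2 lengths are available, 1 + 8 z^-4 <= 9 z^-4, and the
    total of F is at most 4 D / z. *)
Lemma F_bound x w : adj x w -> F x w <= 72 * D%:R * z ^- 5 / ell%:R.
Proof.
move=> xw; have z1 := z_le1 x.
have [a [b [ac db]]] := exists_cut asym airr w conn ncyc (@hell w).
have zz : 0 <= 1 - z ^+ 2 by rewrite subr_ge0 expr_le1 // ltW.
have zi : 0 < z ^- 4 by rewrite invr_gt0 exprn_gt0.
(* This is sqrt(1 - t) <= 1 - t / 2 at t = z^2. *)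
have kz : z ^+ 2 / 2 <= 1 - ka.
  suff : ka <= 1 - z ^+ 2 / 2 by lra.
  have z20 := sqr_ge0 z.
  rewrite -[leRHS]ger0_norm -?sqrtr_sqr; last lra.
  by apply: ler_wsqrtr; have := sqr_ge0 (z ^+ 2); nra.
have z20 : 0 < z ^+ 2 by rewrite exprn_gt0.
have ka01 : 0 <= ka < 1 by rewrite sqrtr_ge0 /=; lra.
have hh : ((ell./2.+1).*2 <= ell.+2)%N by rewrite doubleS !ltnS -[leqRHS](odd_double_half ell) leq_addl.
have F0 u v : 0 <= F u v by apply: sqr_ge0.
have := @F_estimate R T adj a b asym airr F F0 phi sg ka
  (fun _ _ => sqrtr_ge0 _) (fun _ _ _ => sqrtr_ge0 _) sg_sum sg_branch phi_step
  (fun _ _ => erefl) ka01 db ell (ell./2.+1) x w ac hh xw.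
set Sg := \sum_v _ => hF.
have S0 : 0 <= Sg by apply: sumr_ge0 => v _; apply: sumr_ge0.
have c9 : 1 + 2 / (1 - ka) ^+ 2 <= 9 * z ^- 4.
  have : (z ^+ 2 / 2) ^+ 2 <= (1 - ka) ^+ 2.
    by rewrite lerXn2r ?nnegrE //; have := ltW z20; lra.
  have kp : 0 < 1 - ka by lra.
  have : (1 - ka) ^- 2 <= (4 * z ^- 4) -> 1 <= z ^- 4 -> 1 + 2 / (1 - ka) ^+ 2 <= 9 * z ^- 4 by lra.
  move=> h hk; apply: h.
    rewrite (_ : 4 * z ^- 4 = ((z ^+ 2 / 2) ^+ 2)^-1); last by field; rewrite gt_eqF.
    by rewrite lef_pV2 ?posrE // exprn_gt0 // divr_gt0.
  by rewrite invf_ge1 ?exprn_gt0 // exprn_ile1 // ltW.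
have e0 : 0 < ell%:R :> R by rewrite ltr0n.
have hl : ell%:R / 2 * F x w <= (ell./2.+1)%:R * F x w.
  rewrite ler_wpM2r // ler_pdivrMr // -natrM ler_nat; move: hh; clear; lia.
have h1 := le_trans hl hF.
have h2 : (1 + 2 / (1 - ka) ^+ 2) * Sg <= 9 * z ^- 4 * (4 * D%:R / z).
  by rewrite ler_pM ?F_total ?addr_ge0 ?divr_ge0 ?sqr_ge0.
have h3 := le_trans h1 h2.
rewrite ler_pdivlMr //.
have -> : 72 * D%:R * z ^- 5 = 2 * (9 * z ^- 4 * (4 * D%:R / z)).
  by field; rewrite gt_eqF.
lra.
Qed.

(** Eliminating psi(w) between f(w,x) and f(x,w) gives psi(x) (X - Z) = X f(w,x) + f(x,w), with Im
    (X - Z) = S + I(x,w) >= 2 z. Since |X|^2 I(w,x) = S, the bound M for F makes the squared right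
    side at most 2 (S + I(x,w)) M. *)
Lemma psi_bound x : sqn (psi x) <= (8 * D%:R * z ^- 4 / Num.sqrt ell%:R) ^+ 2.
Proof.
have z1 := z_le1 x; have [w xw] := exists_edge x.
have wx : adj w x by rewrite asym.
have e0 : 0 < ell%:R :> R by rewrite ltr0n.
set M := 72 * D%:R * z ^- 5 / ell%:R.
have S0 := S_gt0 wx; have I0 := I_gt0 xw; have I0' := I_gt0 wx.
have key : psi x * (X w x - Z x w) = X w x * f w x + f x w.
  rewrite /f; have h := Zrec wx; rewrite -/(X w x) in h.
  have -> : X w x * (psi x - Z w x * psi w) = X w x * psi x - (Z w x * X w x) * psi w by ring.
  by rewrite h; ring.
have P2 : (S w x + I x w) ^+ 2 <= sqn (X w x - Z x w).
  have e : complex.Im (X w x - Z x w) = S w x + I x w by rewrite cImD cImN ImX.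
  by rewrite /sqn e lerDr sqr_ge0.
have XS : sqn (X w x) * I w x = S w x.
  by rewrite I_rec // mulrA [_ * sqn (Z w x)]mulrC sqnXZ // mul1r.
have h1 : sqn (X w x * f w x) <= S w x * M.
  rewrite sqnM -XS -mulrA ler_wpM2l ?sqn_ge0 // mulrC -ler_pdivrMr //.
  by rewrite -FE // F_bound.
have h2 : sqn (f x w) <= I x w * M.
  by rewrite mulrC -ler_pdivrMr // -FE // F_bound.
have P0 : 0 < S w x + I x w by rewrite addr_gt0.
have h3 : sqn (psi x) * (S w x + I x w) ^+ 2 <= 2 * ((S w x + I x w) * M).
  apply: le_trans (_ : sqn (psi x) * sqn (X w x - Z x w) <= _).
    by rewrite ler_wpM2l ?sqn_ge0.
  rewrite -sqnM key; apply: le_trans (sqnDle _ _) _.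
  by rewrite ler_pM2l // [leRHS](mulrDl (S w x)) lerD.
have h4 : sqn (psi x) * (S w x + I x w) <= 2 * M.
  rewrite -(ler_pM2r P0) -mulrA -expr2; apply: le_trans h3 _.
  by rewrite [leRHS]mulrAC -mulrA.
have h5 : sqn (psi x) * z <= M.
  have : sqn (psi x) * (z + z) <= sqn (psi x) * (S w x + I x w).
    by rewrite ler_wpM2l ?sqn_ge0 // lerD ?S_ge ?I_ge.
  lra.
have zi : 0 < z^-1 by rewrite invr_gt0.
have D2 : (2 : R) <= D%:R by rewrite ler_nat (leq_trans (mind x)) // deg_le_max.
apply: le_trans (_ : M / z <= _); first by rewrite ler_pdivlMr.
have t0 : 0 < Num.sqrt ell%:R :> R by rewrite sqrtr_gt0.
have -> : (8 * D%:R * z ^- 4 / Num.sqrt ell%:R) ^+ 2 =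
    z ^- 6 / ell%:R * (64 * D%:R ^+ 2 * z^-1 ^+ 2).
  rewrite -[X in _ = _ / X * _](sqr_sqrtr (ltW e0)).
  by field; rewrite !gt_eqF.
have -> : M / z = z ^- 6 / ell%:R * (72 * D%:R) by rewrite /M; field; rewrite !gt_eqF.
rewrite ler_pM2l ?divr_gt0 ?invr_gt0 ?exprn_gt0 //.
have zi1 : 1 <= z^-1 by rewrite invf_ge1.
have zi2 : 1 <= z^-1 ^+ 2 by rewrite exprn_ege1.
(* D >= 2 lets 64 D^2 absorb 72 D, and z <= 1 pays for passing from z^-6 to z^-8. *)
have D0 : 72 * D%:R <= 64 * D%:R ^+ 2 :> R by nra.
by rewrite (le_trans D0) // ler_peMr // mulr_ge0 // sqr_ge0.
Qed.

End BulkBound.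

(** * Outside the spectrum *)

Section Reroot.
Variables (R : realType) (T : finType) (adj : rel T) (W : T -> R).
Hypothesis asym : symmetric adj.

(* The isomorphism from the cover rooted at x to the one rooted at a neighbour y. *)
Definition reroot (x y : T) (s : seq T) : seq T :=
  if s is z :: s' then (if z == y then s' else x :: s) else [:: x].

Lemma reroot_nbwalk x y s : adj x y -> nbwalk adj x s -> nbwalk adj y (reroot x y s).
Proof.
move=> xy; case: s => [|z s] /=; first by rewrite nbwalk_cons asym xy subtree_nil.
case: eqP => [->|/eqP zy h]; first by rewrite nbwalk_cons => /andP[_ /andP[]].
by rewrite nbwalk_cons asym xy /subtree h /= zy.
Qed.

Lemma rerootK x y s : adj x y -> nbwalk adj x s -> reroot y x (reroot x y s) = s.
Proof.
move=> xy; case: s => [|z s] /=; first by rewrite eqxx.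
case: eqP => [->|_] h; last by rewrite /= eqxx.
case: s h => [//|w s]; rewrite !nbwalk_cons subtree_cons => /and4P[_ _ wx _].
by rewrite /= (negbTE wx).
Qed.

Lemma last_reroot x y s : last y (reroot x y s) = last x s.
Proof. by case: s => [//|z s] /=; case: eqP => [->|]. Qed.

Definition retract (x y : T) (f : seq T -> R[i]) (s : seq T) : R[i] :=
  if nbwalk adj x s then f (reroot x y s) else 0.

(** [reroot] consists of two injective pieces, prepending x and dropping a leading y; each
    contributes at most the bound M for f. *)
Lemma retract_l2 x y f : l2 (UC adj y) f -> l2 (UC adj x) (retract x y f).
Proof.
move=> /l2P[fV [M hM]]; apply/l2P; split.
  by move=> s; rewrite /UC /retract => /negbTE ->.
have hM' n : psum (fun s => sqn (f s)) n <= M.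
  apply: le_trans (hM n); apply: psum_le => s; exact: ler_norm.
pose A s := sqn (f (x :: s)).
pose B s := if s is z :: s' then (z == y)%:R * sqn (f s') else 0.
have A0 s : 0 <= A s by apply: sqn_ge0.
have B0 s : 0 <= B s by case: s => [//|z s] /=; rewrite mulr_ge0 ?sqn_ge0.
exists (M + M) => n.
apply: (@le_trans _ _ (psum (fun s => A s + B s) n)).
  apply: psum_le => s; rewrite ger0_norm ?sqn_ge0 // /retract.
  case: ifP => _; last by rewrite sqn0 addr_ge0.
  case: s => [|z s] /=; first by rewrite addr0.
  case: eqP => _; last by rewrite mul0r addr0.
  by rewrite mul1r lerDr; apply: A0.
rewrite psumD; apply: lerD.
  apply: le_trans (hM' n.+1); rewrite psum_cons (bigD1 x) //=.
  rewrite addrCA lerDl addr_ge0 ?sqn_ge0 // sumr_ge0 // => z _.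
  by apply: psum_ge0 => s; apply: sqn_ge0.
case: n => [|n]; first by rewrite psum0; have := hM' 0%N; rewrite psum0.
rewrite psum_cons /= add0r (bigD1 y) //= big1 ?addr0.
  by rewrite eqxx psumZ mul1r.
by move=> z /negbTE ->; rewrite psumZ mul0r.
Qed.

(** [reroot] exchanges parent and child only along the edge between x and y. The cases are the root,
    the vertex y, the rest of its branch, and the other branches. *)
Lemma Hop_retract x y f s : adj x y -> (forall s, ~~ UC adj y s -> f s = 0) ->
  UC adj x s -> Hop W x (UC adj x) (retract x y f) s = Hop W y (UC adj y) f (reroot x y s).
Proof.
move=> xy fV sV; have yx : adj y x by rewrite asym.
rewrite !HopE //; last by move=> t; rewrite /UC /retract => /negbTE ->.
rewrite /cover_map last_reroot {1}/retract (_ : nbwalk adj x s = true) //.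
rewrite -!addrA; congr (_ + _); rewrite /par /chi.
have fz t : ~~ nbwalk adj y t -> f t = 0 by apply: fV.
case: s sV => [_|z s sV] /=.
  rewrite add0r (bigD1 y) //= [in RHS](bigD1 y) //=.
  rewrite {1}/retract nbwalk_cons xy subtree_nil /= eqxx.
  have -> : f [:: x; y] = 0 by rewrite fz // nbwalk_cons subtree_cons eqxx !andbF.
  rewrite add0r; congr (_ + _); apply: eq_bigr => z zy.
  rewrite /retract /= (negbTE zy); case: ifPn => // nz; rewrite fz //.
  by apply: contra nz; rewrite nbwalk_cons => /andP[_ /andP[]].
have [zy|zy] := eqVneq z y.
  rewrite {}zy in sV *; have [s0|s0] := eqVneq s [::].
    rewrite s0 /= add0r (bigD1 x) //= [in RHS](bigD1 x) //=.
    rewrite {1 2}/retract nbwalk_nil /= nbwalk_cons subtree_cons eqxx !andbF add0r.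
    congr (_ + _); apply: eq_bigr => v vx.
    rewrite /retract /= eqxx; case: ifPn => // nv; rewrite fz //.
    by apply: contra nv; rewrite !nbwalk_cons subtree_cons xy vx !subtree_nil /= => /andP[->].
  rewrite tparent_cons //; congr (_ + _).
    rewrite /retract /= eqxx; case: ifPn => // /negP; case.
    have := sV; rewrite /UC -[y :: tparent s](tparent_cons y s0).
    case/lastP: s s0 {sV} => [//|s w] _; rewrite -rcons_cons tparent_rcons.
    exact: nbwalk_rconsW.
  apply: eq_bigr => w _; rewrite /retract /= eqxx; case: ifPn => // nw; rewrite fz //.
  apply: contra nw => nw; rewrite nbwalk_cons xy /subtree nw /=.
  have := sV; rewrite /UC nbwalk_cons /subtree => /and3P[_ _].
  by case: s s0 {sV nw} => [//|v s] _ /=.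
congr (_ + _).
  have -> : tparent [:: x, z & s] = x :: tparent (z :: s) by rewrite tparent_cons.
  have nt : nbwalk adj x (tparent (z :: s)).
    have := sV; rewrite /UC; case/lastP: (z :: s) => [//|t w]; rewrite tparent_rcons.
    exact: nbwalk_rconsW.
  rewrite /retract nt; have : exists t, tparent (z :: s) = [::] \/ tparent (z :: s) = z :: t.
    by case: (s) => [|w t]; [exists [::]; left|exists (tparent (w :: t)); right; rewrite tparent_cons].
  by case=> t [->|->] //=; rewrite (negbTE zy).
apply: eq_bigr => w _; rewrite /retract /= (negbTE zy); case: ifPn => // nw; rewrite fz //.
by apply: contra nw; rewrite nbwalk_cons => /andP[_ /andP[]].
Qed.

Definition solvable (x : T) (lam : R) := forall g, l2 (UC adj x) g ->
  exists! f, l2 (UC adj x) f /\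
    forall s, UC adj x s -> Hop W x (UC adj x) f s - (lam%:C)%C * f s = g s.

Lemma l2_off (V : pred (seq T)) (f : seq T -> R[i]) : l2 V f -> forall s, ~~ V s -> f s = 0.
Proof. by case. Qed.

Lemma retractK x y f : adj x y -> l2 (UC adj x) f -> retract x y (retract y x f) = f.
Proof.
move=> xy lf; apply/funext => s; rewrite /retract; case: ifPn => sx.
  by rewrite reroot_nbwalk // rerootK.
by rewrite (l2_off lf).
Qed.

Lemma retract_eq x y f g lam : adj x y -> l2 (UC adj y) f -> l2 (UC adj y) g ->
  (forall s, UC adj y s -> Hop W y (UC adj y) f s - (lam%:C)%C * f s = g s) ->
  forall s, UC adj x s -> Hop W x (UC adj x) (retract x y f) s
     - (lam%:C)%C * retract x y f s = retract x y g s.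
Proof.
move=> xy lf lg hf s sx; rewrite Hop_retract //; last exact: l2_off.
have sx' : nbwalk adj x s by [].
by rewrite /retract sx' hf // /UC reroot_nbwalk.
Qed.

Lemma solvable_step x y lam : adj x y -> solvable x lam -> solvable y lam.
Proof.
move=> xy hx g lg; have yx : adj y x by rewrite asym.
have [f [[lf hf] uf]] := hx _ (retract_l2 x lg).
exists (retract y x f); split.
  split; first exact: retract_l2.
  by move=> s sy; rewrite (retract_eq yx lf (retract_l2 x lg) hf) // retractK.
move=> f' [lf' hf'].
have -> : f = retract x y f'.
  apply: uf; split; first exact: retract_l2.
  exact: retract_eq.
by rewrite retractK.
Qed.

Lemma solvable_connect x y lam : connect adj x y -> solvable x lam -> solvable y lam.
Proof.
case/connectP => p pp ->; elim: p x pp => [//|z p IH] x /= /andP[xz pp] hx.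
by apply: IH => //; apply: solvable_step xz hx.
Qed.

(** Links the root x0 of [dist_spectrum] with the cover rooted at x, on which psi(x) is
    estimated. *)
Lemma spectrum_root x y : connected_graph adj -> spectrum adj W x = spectrum adj W y.
Proof.
move=> conn; apply/seteqP; split => lam /= h h'; apply: h.
  exact: solvable_connect (conn y x) h'.
exact: solvable_connect (conn x y) h'.
Qed.

Lemma resolvent_ptP x s : resolvent_pt (@Aop R T W x (UC adj x)) s <-> solvable x s.
Proof.
have eqV u : forall t, UC adj x t -> shift (@Aop R T W x (UC adj x)) s u t =
    Hop W x (UC adj x) u t - (s%:C)%C * u t.
  by move=> t tV; rewrite /shift l2tD l2tN l2tZ AopE.
split => h g.
  move=> lg; have [f [ef uf]] := h (mkl2 lg).
  exists f; split.
    by split; [exact: l2t_l2|move=> t tV; rewrite -eqV // ef].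
  move=> f' [lf' ef'].
  rewrite (uf (mkl2 lf')) //; apply: l2tP => t.
  have [tV|nV] := boolP (UC adj x t); last by rewrite !l2t_off.
  by rewrite eqV // ef'.
have [f [[lf ef] uf]] := h g (l2t_l2 g).
exists (mkl2 lf); split.
  apply: l2tP => t; have [tV|nV] := boolP (UC adj x t); last by rewrite !l2t_off.
  by rewrite eqV // ef.
move=> f' ef'; apply: l2tP => t; rewrite /= (uf f') //; split; first exact: l2t_l2.
by move=> t' tV; rewrite -eqV // ef'.
Qed.

Lemma dist_spectrumP x lam : solvable x lam ->
  let de := dist_spectrum adj W x lam in
  0 < de /\ forall u : l2t R (UC adj x),
    de * nrm (@dot R T (UC adj x)) u <=
    nrm (@dot R T (UC adj x)) (Aop W x u - lam *: u).
Proof.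
move=> h de.
(* The delta function at the root supplies the nonzero vector that [spectral_gap] asks for. *)
have ld : l2 (UC adj x) (fun s => (s == [::])%:R : R[i]).
  apply/l2P; split; first by case=> [|z s] //; rewrite /UC nbwalk_nil.
  exists 1 => -[|n]; first by rewrite psum0.
  rewrite psum_cons big1 => [|z _].
    by rewrite eqxx /sqn /= expr0n expr1n !addr0 normr1.
  have -> : (fun s => `|sqn ((z :: s == [::])%:R : R[i])|) = (fun=> 0 * 0).
    by apply/funext => s; rewrite sqn0 normr0 mul0r.
  by rewrite psumZ mul0r.
have e0 : mkl2 ld <> 0.
  move=> /(congr1 (fun u : l2t R (UC adj x) => u [::])) /= /(congr1 (@complex.Re R)) /=.
  by apply/eqP; rewrite oner_eq0.
have := @spectral_gap R _ (@dot R T (UC adj x)) (@dotC _ _ _) (@dotDl _ _ _) (@dotZl _ _ _)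
  (@dot_ge0 _ _ _) (@dot_eq0 _ _ _) (@l2_complete _ _ _) (@Aop R T W x (UC adj x)) _
  (@AopB _ _ _ _ _) (@AopZ _ _ _ _ _) (@Aop_bounded _ _ _ _ _) (@Aop_sym _ _ _ _ _) lam _ e0.
move=> /(_ ((resolvent_ptP x lam).2 h)) /=.
have -> // : [set s | ~ resolvent_pt (@Aop R T W x (UC adj x)) s]%classic = spectrum adj W x.
apply/seteqP; split => s /= hs hs'; apply: hs; exact/resolvent_ptP.
Qed.

End Reroot.

(** * The Combes-Thomas estimate *)

Section FiniteSupport.
Variables (R : realType) (T : finType).

Lemma psum_stable (h : seq T -> R) n m : (forall s, (n <= size s)%N -> h s = 0) ->
  (n <= m)%N -> psum h m = psum h n.
Proof.
move=> h0 /subnK <-; elim: (m - n)%N => [//|k IH].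
rewrite addSn psumS IH (@eq_lev _ _ _ _ (fun=> 0)) ?lev0 ?addr0 // => s sk.
by rewrite h0 // sk leq_addl.
Qed.

Lemma psum_finite_le (h : seq T -> R) n m : (forall s, 0 <= h s) ->
  (forall s, (n <= size s)%N -> h s = 0) -> psum h m <= psum h n.
Proof.
move=> hp h0; have [nm|/ltnW mn] := leqP n m; first by rewrite (psum_stable h0 nm).
exact: psum_nd.
Qed.

Lemma sqr_sumD_le (I : finType) (P : pred I) (a : R) (f : I -> R) :
  (a + \sum_(i | P i) f i) ^+ 2 <= (1 + #|P|%:R) * (a ^+ 2 + \sum_(i | P i) f i ^+ 2).
Proof.
have := sqr_sum_le P f; set b := \sum_(i | P i) f i; set q := \sum_(i | P i) _.
have q0 : 0 <= q by apply: sumr_ge0 => i _; apply: sqr_ge0.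
have [->|n0] := posnP #|P|.
  rewrite mul0r => hb; have -> : b = 0 by apply/eqP; rewrite -sqrf_eq0 eq_le hb sqr_ge0.
  by rewrite !addr0 mul1r lerDl.
have : 0 < #|P|%:R :> R by rewrite ltr0n.
set n := #|P|%:R => np bq.
have : 0 <= n * (n * a ^+ 2 + q - 2 * a * b).
  by have := sqr_ge0 (n * a - b); nra.
by rewrite pmulr_rge0 //; nra.
Qed.

Lemma sqn_sumD_le (I : finType) (P : pred I) (a : R[i]) (f : I -> R[i]) :
  sqn (a + \sum_(i | P i) f i) <= (1 + #|P|%:R) * (sqn a + \sum_(i | P i) sqn (f i)).
Proof.
rewrite /sqn !cE big_split /= addrACA mulrDr; apply: lerD; exact: sqr_sumD_le.
Qed.

End FiniteSupport.

Section CombesThomas.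
Variables (R : realType) (T : finType) (adj : rel T) (W : T -> R) (x : T) (lam : R).
Variables (psi : T -> R[i]) (ell : nat).
Hypothesis asym : symmetric adj.
Hypothesis airr : irreflexive adj.
Hypothesis psiE : forall x, \sum_(y | adj x y) psi y + (W x)%:C%C * psi x
                 = (lam%:C)%C * psi x.
Hypothesis psi1 : \sum_x sqn (psi x) = 1.

Local Notation V := (nbwalk adj x).
Local Notation D := (max_deg adj).
Local Notation nrm := (nrm (@dot R T V)).

Definition nch (s : seq T) : nat := #|[pred z | V (rcons s z)]|.

Lemma children s z : V s ->
  V (rcons s z) = adj (last x s) z && ((s == [::]) || (last x (tparent s) != z)).
Proof. by move=> Vs; rewrite nbwalk_rcons Vs. Qed.

Lemma tparent_adj s : V s -> s != [::] -> adj (last x s) (last x (tparent s)).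
Proof.
case/lastP: s => [//|s z]; rewrite tparent_rcons last_rcons nbwalk_rcons.
by case/and3P => _ h _ _; rewrite asym.
Qed.

Lemma nch_deg s : V s -> (nch s + (s != [::]) <= D)%N.
Proof.
move=> Vs; apply: leq_trans (deg_le_max adj (last x s)); rewrite /nch /deg.
have [s0|s0] := eqVneq s [::].
  rewrite addn0 subset_leq_card //; apply/fintype.subsetP => z; rewrite !inE.
  by rewrite children // => /andP[].
rewrite addn1 (cardsD1 (last x (tparent s)) [set y | adj (last x s) y]%SET).
rewrite inE tparent_adj // add1n ltnS subset_leq_card //.
apply/fintype.subsetP => z; rewrite !inE children // (negbTE s0) /= eq_sym.
by case/andP => -> ->.
Qed.

(** The covering map is bijective from the neighbours of a vertex to those of its image, so the
    eigenvalue equation lifts to the cover. *)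
Lemma cover_sum s (g : T -> R[i]) : V s ->
  \sum_(z | adj (last x s) z) g z =
  (if s == [::] then 0 else g (last x (tparent s))) + \sum_(z | V (rcons s z)) g z.
Proof.
move=> Vs; have [s0|s0] := eqVneq s [::].
  by rewrite add0r; apply: eq_bigl => z; rewrite children // s0 andbT.
rewrite (bigD1 (last x (tparent s))) /=; last exact: tparent_adj.
congr (_ + _); apply: eq_bigl => z; rewrite children // (negbTE s0) /=.
by rewrite eq_sym.
Qed.

Hypothesis hell : at_most_one_cycle adj (Defs.ball adj x ell).
Hypothesis conn : connected_graph adj.
Hypothesis ncyc : ~ is_cycle_graph adj.

(** Walks of length ell from x stay in the ball, so [count_walks] limits how often a vertex occurs
    as an end. *)
Lemma lev_walks (G : T -> R) : (forall y, 0 <= G y) ->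
  lev ell (fun s => if V s then G (last x s) else 0) <= 3 * \sum_y G y.
Proof.
move=> G0; have [a [b [ac _]]] := exists_cut asym airr x conn ncyc hell.
rewrite lev_words (partition_big (fun s => last x s) xpredT) //= mulr_sumr.
apply: ler_sum => y _.
rewrite (eq_bigr (fun s => if V s then G y else 0)); last by move=> s /eqP ->.
rewrite -big_mkcondr /= -big_filter big_const_seq count_predT iter_addr_0.
rewrite -[leLHS]mulr_natl ler_wpM2r // ler_nat.
apply: (count_walks asym airr ac (x := x) (y := y) (k := ell)).
  by rewrite filter_uniq // words_uniq.
move=> s; rewrite mem_filter mem_words => /andP[/andP[/eqP ly Vs] /eqP sl].
move: Vs; rewrite nbwalkE => /andP[p n]; split => //.
by apply: path_ball (ball0 adj x) p _; rewrite sl.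
Qed.

Variables (rho : R).
Hypothesis rho1 : 1 <= rho.

Let h (s : seq T) : R[i] := if V s && (size s <= ell)%N then psi (last x s) else 0.
Let u0 (s : seq T) : R[i] := ((rho^-1 ^+ size s)%:C)%C * h s.

Lemma u0_l2 : l2 V u0.
Proof.
apply/l2P; split; first by move=> s nV; rewrite /u0 /h (negbTE nV) mulr0.
exists (psum (fun s => sqn (u0 s)) ell.+1) => n.
rewrite (le_trans (y := psum (fun s => sqn (u0 s)) n)) //.
  by apply: psum_le => s; rewrite ger0_norm ?sqn_ge0.
apply: psum_finite_le => [s|s sl]; first exact: sqn_ge0.
by rewrite /u0 /h leqNgt sl andbF mulr0 sqn0.
Qed.

Let u : l2t R V := mkl2 u0_l2.

(** The operator minus its conjugate by rho^-|s|; conjugation multiplies the parent term by rho^-1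
    and the child term by rho. *)
Let B0 (s : seq T) : R[i] := if V s then
  ((1 - rho^-1)%:C)%C * par u s + ((1 - rho)%:C)%C * chi u s else 0.

Lemma chiV s : chi u s = \sum_(z | V (rcons s z)) u (rcons s z).
Proof.
rewrite /chi [RHS]big_mkcond; apply: eq_bigr => z _.
by case: ifPn => // nV; rewrite (l2t_off u nV).
Qed.

Lemma rho_bounds : (1 - rho^-1) ^+ 2 <= (rho - 1) ^+ 2.
Proof.
have r0 : 0 < rho := lt_le_trans ltr01 rho1.
have : 1 - rho^-1 = (rho - 1) * rho^-1 by field; rewrite gt_eqF.
move=> ->; rewrite exprMn ler_piMr ?sqr_ge0 // exprn_ile1 //.
  by rewrite invr_ge0 ltW.
by rewrite invf_le1.
Qed.

Lemma B0_le s : sqn (B0 s) <= (rho - 1) ^+ 2 * D%:R *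
  ((if V s then sqn (par u s) else 0) + \sum_z sqn (u (rcons s z))).
Proof.
have S0 : 0 <= \sum_z sqn (u (rcons s z)) by apply: sumr_ge0 => z _; apply: sqn_ge0.
rewrite /B0; case: ifPn => Vs; last first.
  by rewrite sqn0 add0r mulr_ge0 ?S0 ?(mulr_ge0 (sqr_ge0 _)).
have -> : \sum_z sqn (u (rcons s z)) = \sum_(z | V (rcons s z)) sqn (u (rcons s z)).
  rewrite [RHS]big_mkcond; apply: eq_bigr => z _.
  by case: ifPn => // nV; rewrite (l2t_off u nV) sqn0.
set Q := \sum_(z | _) _.
have Q0 : 0 <= Q by apply: sumr_ge0 => z _; apply: sqn_ge0.
rewrite chiV mulr_sumr.
have e1 : sqn (((1 - rho^-1)%:C)%C * par u s) <= (rho - 1) ^+ 2 * sqn (par u s).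
  by rewrite sqnM sqn_real ler_wpM2r ?sqn_ge0 // rho_bounds.
have e2 : \sum_(z | V (rcons s z)) sqn (((1 - rho)%:C)%C * u (rcons s z)) = (rho - 1) ^+ 2 * Q.
  rewrite /Q mulr_sumr; apply: eq_bigr => z _; rewrite sqnM sqn_real.
  by congr (_ * _); ring.
have := nch_deg Vs; have [s0|s0] := eqVneq s [::] => /= hd.
  have -> : par u s = 0 by rewrite /par s0.
  rewrite mulr0 add0r sqn0 add0r; apply: le_trans (sqn_sum_le _ _) _.
  rewrite e2 [leLHS]mulrCA -[leRHS]mulrA ler_wpM2l ?sqr_ge0 // ler_wpM2r //.
  by rewrite ler_nat; move: hd; rewrite addn0.
apply: le_trans (sqn_sumD_le _ _ _) _.
rewrite e2 (_ : _ * _ * _ = D%:R * ((rho - 1) ^+ 2 * sqn (par u s) + (rho - 1) ^+ 2 * Q)); last by ring.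
apply: (@le_trans _ _ (D%:R * (sqn (((1 - rho^-1)%:C)%C * par u s) + (rho - 1) ^+ 2 * Q))).
  rewrite ler_wpM2r ?(addr_ge0 (sqn_ge0 _) (mulr_ge0 (sqr_ge0 _) Q0)) //.
  by rewrite addrC natr1 ler_nat -addn1.
by rewrite ler_wpM2l // lerD2r.
Qed.

(** Schur test: Cauchy-Schwarz costs a factor D at each vertex, and each |u(s)|^2 is then counted
    once per neighbour of s, again at most D times. *)
Lemma B0_psum n : psum (fun s => sqn (B0 s)) n <= ((rho - 1) * D%:R) ^+ 2 * dot u u.
Proof.
have su := l2t_summ u.
have tg m : psum (fun s => sqn (u s)) m <= dot u u.
  by rewrite dot_sqn; apply: tot_ge => // s; apply: sqn_ge0.
pose e s := if s == [::] then 0 else sqn (u s).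
pose pV s := if V s then sqn (par u s) else 0.
have e0 s : 0 <= e s by rewrite /e; case: ifP => // _; apply: sqn_ge0.
have ce s : (nch s)%:R * sqn (u s) + e s <= D%:R * sqn (u s).
  have [Vs|nV] := boolP (V s); last first.
    by rewrite /e (l2t_off u nV) sqn0 !mulr0 add0r if_same.
  have := nch_deg Vs; rewrite /e; case: eqP => _ /= hd.
    by rewrite addr0 ler_wpM2r ?sqn_ge0 // ler_nat -[nch s]addn0.
  by rewrite -{2}[sqn (u s)]mul1r -mulrDl ler_wpM2r ?sqn_ge0 // natr1 ler_nat -addn1.
apply: (@le_trans _ _ ((rho - 1) ^+ 2 * D%:R *
    (psum pV n + psum (fun s => \sum_z sqn (u (rcons s z))) n))).
  rewrite -psumD -psumZ; apply: psum_le => s; exact: B0_le.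
have ->: ((rho - 1) * D%:R) ^+ 2 * dot u u = (rho - 1) ^+ 2 * D%:R * (D%:R * dot u u) by ring.
rewrite ler_wpM2l ?(mulr_ge0 (sqr_ge0 _)) //.
have h1 : psum pV n <= psum (fun s => (nch s)%:R * sqn (u s)) n.+1.
  have pV0 s : 0 <= pV s by rewrite /pV; case: ifP => // _; apply: sqn_ge0.
  apply: le_trans (psum_nd pV0 (leqnSn n)) _.
  rewrite psum_shift /pV {1}/par eqxx sqn0 if_same add0r.
  apply: (@le_trans _ _ (psum (fun s => (nch s)%:R * sqn (u s)) n)); last first.
    by apply: psum_nd => // s; rewrite mulr_ge0 ?sqn_ge0.
  apply: psum_le => s; rewrite -big_mkcond /=.
  rewrite (eq_bigr (fun=> sqn (u s))); first by rewrite sumr_const mulr_natl.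
  by move=> z _; rewrite /par tparent_rcons; case: (s).
have h2 : psum (fun s => \sum_z sqn (u (rcons s z))) n = psum e n.+1.
  rewrite psum_shift {1}/e eqxx add0r; congr (psum _ n); apply/funext => s.
  by apply: eq_bigr => z _; rewrite /e; case: (s).
rewrite h2; apply: le_trans (lerD h1 (lexx _)) _.
rewrite -psumD; apply: (@le_trans _ _ (D%:R * psum (fun s => sqn (u s)) n.+1)).
  by rewrite -psumZ; apply: psum_le.
by rewrite ler_wpM2l.
Qed.

Lemma B0_l2 : l2 V B0.
Proof.
apply/l2P; split; first by move=> s nV; rewrite /B0 (negbTE nV).
exists (((rho - 1) * D%:R) ^+ 2 * dot u u) => n; apply: le_trans (B0_psum n).
by apply: psum_le => s; rewrite ger0_norm ?sqn_ge0.
Qed.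

Let Bu : l2t R V := mkl2 B0_l2.

Lemma Bu_nrm : nrm Bu <= (rho - 1) * D%:R * nrm u.
Proof.
have c0 : 0 <= (rho - 1) * D%:R by rewrite mulr_ge0 // subr_ge0.
have n0 : 0 <= (rho - 1) * D%:R * nrm u := mulr_ge0 c0 (nrm_ge0 _ _).
rewrite -(ler_pXn2r (_ : 0 < 2)%N) ?nnegrE ?nrm_ge0 //.
rewrite exprMn !(sqr_nrm (@dot_ge0 _ _ _)) [leLHS]dot_sqn.
by apply: tot_le; [exact: l2t_summ|move=> n; exact: B0_psum].
Qed.

Let g : l2t R V := Aop W x u - lam *: u - Bu.

Lemma gE s : V s -> g s = ((rho^-1 ^+ size s)%:C)%C *
  ((W (last x s))%:C%C * h s + par h s + chi h s - (lam%:C)%C * h s).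
Proof.
move=> Vs; have r0 : rho != 0 by rewrite gt_eqF // (lt_le_trans ltr01).
have -> : g s = Aop W x u s - (lam%:C)%C * u s - B0 s.
  by rewrite /g !(l2tD, l2tN, l2tZ).
rewrite AopE' // /B0 Vs.
have pu : (((rho^-1))%:C)%C * par u s = ((rho^-1 ^+ size s)%:C)%C * par h s.
  rewrite /par; case: (lastP s) => [|t z]; first by rewrite !mulr0.
  rewrite tparent_rcons size_rcons -size_eq0 size_rcons /= /u0 exprS.
  by rewrite rmorphM mulrA.
have cu : (rho%:C)%C * chi u s = ((rho^-1 ^+ size s)%:C)%C * chi h s.
  rewrite /chi !mulr_sumr; apply: eq_bigr => z _; rewrite /= /u0 size_rcons exprS.
  by rewrite mulrA -rmorphM mulrA mulfV // mul1r.
have us : u s = ((rho^-1 ^+ size s)%:C)%C * h s by [].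
rewrite mulrBr !mulrDr -pu -cu us !rmorphB /= rmorph1 /cover_map.
set p := par u s; set c := chi u s.
ring.
Qed.

Lemma g_low s : V s -> (size s < ell)%N -> g s = 0.
Proof.
move=> Vs sl; rewrite gE //.
have hs : h s = psi (last x s) by rewrite /h Vs (ltnW sl).
have hp : par h s = if s == [::] then 0 else psi (last x (tparent s)).
  rewrite /par; case: eqP => // /eqP s0; rewrite /h.
  case/lastP: s Vs s0 sl {hs} => [//|t z] /nbwalk_rconsW Vt _.
  by rewrite tparent_rcons size_rcons Vt => /ltnW/ltnW ->.
have hc : chi h s = \sum_(z | V (rcons s z)) psi z.
  rewrite /chi [RHS]big_mkcond; apply: eq_bigr => z _.
  by rewrite /h size_rcons sl andbT last_rcons.
rewrite hs hp hc -psiE (cover_sum _ Vs) -[in X in X - _]addrA.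
by rewrite [X in X - _]addrC subrr mulr0.
Qed.

Lemma g_high s : (ell.+2 <= size s)%N -> g s = 0.
Proof.
move=> sl; have [Vs|nV] := boolP (V s); last by rewrite l2t_off.
have h0 t : (ell < size t)%N -> h t = 0 by move=> tl; rewrite /h leqNgt tl andbF.
rewrite gE // h0 ?(ltnW sl) // !mulr0 subr0 add0r.
have -> : par h s = 0.
  rewrite /par; case/lastP: s sl {Vs} => [//|t z].
  by rewrite tparent_rcons size_rcons ltnS => /h0 ->; case: ifP.
rewrite add0r /chi big1 ?mulr0 // => z _.
by rewrite h0 // size_rcons ltnS (ltnW (ltnW sl)).
Qed.

Lemma rhoV k : 0 <= rho^-1 ^+ k <= 1.
Proof.
have r0 : 0 < rho := lt_le_trans ltr01 rho1.
have i0 : 0 <= rho^-1 by rewrite invr_ge0 ltW.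
by rewrite exprn_ge0 // exprn_ile1 // invf_le1.
Qed.

(** At distance ell the child values are cut off, and minus their sum is what remains of the
    eigenvalue equation. *)
Lemma g_mid s : size s = ell -> sqn (g s) <= rho^-1 ^+ ell ^+ 2 * D%:R *
  (if V s then \sum_(z | adj (last x s) z) sqn (psi z) else 0).
Proof.
move=> sl; case: ifPn => [Vs|nV]; last by rewrite (l2t_off g nV) sqn0 mulr0.
have hs : h s = psi (last x s) by rewrite /h Vs sl leqnn.
have hp : par h s = if s == [::] then 0 else psi (last x (tparent s)).
  rewrite /par; case: eqP => // /eqP s0; rewrite /h.
  case/lastP: s Vs s0 sl {hs} => [//|t z] /nbwalk_rconsW Vt _.
  by rewrite tparent_rcons size_rcons Vt => <-; rewrite leqnSn.
have hc : chi h s = 0.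
  by rewrite /chi big1 // => z _; rewrite /h size_rcons sl ltnn andbF.
have -> : g s = ((rho^-1 ^+ ell)%:C)%C * - \sum_(z | V (rcons s z)) psi z.
  rewrite gE // sl hc addr0 hs hp -psiE (cover_sum _ Vs); congr (_ * _).
  set a := if _ then _ else _; set b := \sum_(z | _) _; ring.
rewrite sqnM sqn_real sqnN -mulrA ler_wpM2l ?sqr_ge0 //.
apply: le_trans (sqn_sum_le _ _) _.
have S0 : 0 <= \sum_(z | V (rcons s z)) sqn (psi z) by apply: sumr_ge0 => z _; apply: sqn_ge0.
apply: (@le_trans _ _ (D%:R * \sum_(z | V (rcons s z)) sqn (psi z))).
  by rewrite ler_wpM2r // ler_nat (leq_trans _ (nch_deg Vs)) // leq_addr.
rewrite ler_wpM2l // [leRHS](bigID (fun z => V (rcons s z))) /=.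
rewrite (eq_bigl (fun z => adj (last x s) z && V (rcons s z))); last first.
  by move=> z; rewrite children //; case: (adj _ z).
by rewrite lerDl sumr_ge0 // => z _; apply: sqn_ge0.
Qed.

(** One step beyond the cut-off only the parent term survives. *)
Lemma g_top s z : size s = ell -> sqn (g (rcons s z)) <=
  rho^-1 ^+ ell ^+ 2 * (if V (rcons s z) then sqn (psi (last x s)) else 0).
Proof.
move=> sl; case: ifPn => [Vs|nV]; last by rewrite (l2t_off g nV) sqn0 mulr0.
have Vs' := nbwalk_rconsW Vs.
have h0 t : (ell < size t)%N -> h t = 0 by move=> tl; rewrite /h leqNgt tl andbF.
have -> : g (rcons s z) = ((rho^-1 ^+ ell.+1)%:C)%C * psi (last x s).
  rewrite gE // h0 ?size_rcons ?sl // !mulr0 subr0 add0r; congr (_ * _).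
  rewrite /par tparent_rcons -size_eq0 size_rcons /= {1}/h Vs' sl leqnn /=.
  by rewrite /chi big1 ?addr0 // => y _; rewrite h0 // !size_rcons sl.
rewrite sqnM sqn_real ler_wpM2r ?sqn_ge0 // lerXn2r ?nnegrE //.
- by case/andP: (rhoV ell.+1).
- by case/andP: (rhoV ell).
- by rewrite exprS ler_piMl //; [case/andP: (rhoV ell)|case/andP: (rhoV 1)].
Qed.

(** The two spheres contribute 3 D^2 and 3 D times rho^(-2 ell), together at most (4 D)^2 rho^(-2
    ell). *)
Lemma g_nrm : (0 < D)%N -> nrm g <= rho^-1 ^+ ell * (4 * D%:R).
Proof.
move=> D0; have /andP[r0 _] := rhoV ell.
have D1 : 1 <= D%:R :> R by rewrite ler1n.
have n0 : 0 <= rho^-1 ^+ ell * (4 * D%:R) by rewrite mulr_ge0 // mulr_ge0.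
rewrite -(ler_pXn2r (_ : 0 < 2)%N) ?nnegrE ?nrm_ge0 // (sqr_nrm (@dot_ge0 _ _ _)) dot_sqn.
apply: tot_le; first exact: l2t_summ.
move=> n; apply: (@le_trans _ _ (psum (fun s => sqn (g s)) ell.+2)).
  apply: psum_finite_le => [s|s sl]; first exact: sqn_ge0.
  by rewrite (g_high sl) [LHS]sqn0.
rewrite !psumS.
have gl k : (k <= ell)%N -> psum (fun s => sqn (g s)) k = 0.
  elim: k => [|k IH] kl; first by rewrite psum0.
  rewrite psumS IH ?(ltnW kl) // add0r (@eq_lev _ _ _ _ (fun=> 0)) ?lev0 // => s sk.
  have [Vs|nV] := boolP (V s); last by rewrite (l2t_off g nV) sqn0.
  by rewrite g_low ?sqn0 // sk.
rewrite gl // add0r.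
have psi0 y : 0 <= sqn (psi y) by apply: sqn_ge0.
have h1 : lev ell (fun s => sqn (g s)) <= rho^-1 ^+ ell ^+ 2 * D%:R * (3 * D%:R).
  pose G y := \sum_(z | adj y z) sqn (psi z).
  apply: (@le_trans _ _ (lev ell (fun s => rho^-1 ^+ ell ^+ 2 * D%:R *
      (if V s then G (last x s) else 0)))).
    by apply: lev_le => s; apply: g_mid.
  rewrite levZ ler_wpM2l ?(mulr_ge0 (sqr_ge0 _)) //.
  apply: le_trans (lev_walks (G := G) _) _; first by move=> y; apply: sumr_ge0.
  rewrite ler_pM2l // /G (exchange_big_dep xpredT) //=.
  rewrite -[leRHS]mulr1 -[X in _ <= _ * X]psi1 mulr_sumr; apply: ler_sum => z _.
  rewrite (eq_bigl (fun y => adj z y)); last by move=> y; rewrite asym.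
  by rewrite sum_adj ler_wpM2r // ler_nat deg_le_max.
have h2 : lev ell.+1 (fun s => sqn (g s)) <= rho^-1 ^+ ell ^+ 2 * (D%:R * 3).
  rewrite lev_rcons.
  apply: (@le_trans _ _ (lev ell (fun s => (rho^-1 ^+ ell ^+ 2 * D%:R) *
      (if V s then sqn (psi (last x s)) else 0)))).
    apply: lev_le => s sl.
    apply: le_trans (_ : \sum_z rho^-1 ^+ ell ^+ 2 *
        (if V (rcons s z) then sqn (psi (last x s)) else 0) <= _).
      by apply: ler_sum => z _; apply: g_top.
    rewrite -mulr_sumr -big_mkcond /= -mulrA ler_wpM2l ?sqr_ge0 //.
    rewrite sumr_const -[leLHS]mulr_natl; case: ifPn => [Vs|nV].
      by rewrite ler_wpM2r // ler_nat (leq_trans _ (nch_deg Vs)) // leq_addr.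
    rewrite mulr0 (_ : #|_| = 0%N) ?mul0r //; apply: eq_card0 => z; rewrite !inE.
    by apply/negP => /nbwalk_rconsW; apply/negP.
  rewrite levZ -mulrA ler_wpM2l ?sqr_ge0 // ler_wpM2l //.
  apply: le_trans (lev_walks (G := fun y => sqn (psi y)) _) _ => //.
  by rewrite psi1 mulr1.
apply: le_trans (lerD h1 h2) _.
rewrite exprMn (_ : _ + _ = rho^-1 ^+ ell ^+ 2 * (3 * D%:R ^+ 2 + 3 * D%:R)); last by ring.
by rewrite ler_wpM2l ?sqr_ge0 //; nra.
Qed.

(** This rho makes the conjugation error (rho - 1) D = de / 2, which half of the lower bound [de]
    absorbs. At the root the weight is 1, so u equals psi(x) there. *)
Lemma combes_thomas (de : R) : (0 < D)%N -> 0 < de -> rho = 1 + de / (2 * D%:R) ->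
  (forall u : l2t R V, de * nrm u <= nrm (Aop W x u - lam *: u)) ->
  sqn (psi x) <= (8 * D%:R / de * rho ^- ell) ^+ 2.
Proof.
move=> D0 de0 rE hde.
have Dp : 0 < D%:R :> R by rewrite ltr0n.
have h1 := hde u; have h2 := Bu_nrm; have h3 := g_nrm D0.
have h4 : nrm (Aop W x u - lam *: u) <= nrm g + nrm Bu.
  have -> : Aop W x u - lam *: u = g + Bu by rewrite /g subrK.
  exact: (nrmD (@dotC _ _ _) (@dotDl _ _ _) (@dotZl _ _ _) (@dot_ge0 _ _ _) (@dot_eq0 _ _ _)).
have e1 : (rho - 1) * D%:R = de / 2 by rewrite rE; field; rewrite gt_eqF.
rewrite e1 in h2.
have h5 : de / 2 * nrm u <= rho^-1 ^+ ell * (4 * D%:R) by lra.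
have h6 : nrm u <= 8 * D%:R / de * rho ^- ell.
  rewrite -(ler_pM2l (_ : 0 < de / 2)); last by rewrite divr_gt0.
  apply: le_trans h5 _; rewrite exprVn le_eqVlt; apply/orP; left; apply/eqP.
  by field; rewrite !gt_eqF ?exprn_gt0 ?(lt_le_trans ltr01 rho1).
apply: le_trans (_ : nrm u ^+ 2 <= _); last first.
  by rewrite lerXn2r ?nnegrE ?nrm_ge0 // (le_trans (nrm_ge0 _ _) h6).
rewrite (sqr_nrm (@dot_ge0 _ _ _)); apply: le_trans (sqn_le_dot u [::]).
by rewrite /= /u0 /h nbwalk_nil /= expr0 mul1r.
Qed.

End CombesThomas.

(** * Assembly of the two bounds *)

Unset Implicit Arguments.

Theorem theorem1p3 (R : realType) (T : finType) (adj : rel T) (W : T -> R)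
    (x0 : T) (lam : R) (psi : T -> R[i]) (ellG : nat) :
  symmetric adj -> irreflexive adj ->
  connected_graph adj -> min_deg_ge2 adj -> ~ is_cycle_graph adj ->
  (* psi is an eigenfunction of H_G = A_G + W with eigenvalue lam *)
  (forall x : T, \sum_(y | adj x y) psi y + (W x)%:C%C * psi x
                 = (lam%:C)%C * psi x) ->
  (* ||psi||_2 = 1 *)
  l2_norm_sq psi = 1 ->
  is_ellG adj ellG ->
  (* (1) bulk spectrum (the bound is vacuous when ell_G = 0) *)
  (forall z : R, bulk_spectrum adj W x0 lam -> is_z_lambda adj W lam z ->
     (0 < ellG)%N ->
     sup_norm psi
       <= 8 * (max_deg adj)%:R * z ^- 4 / Num.sqrt (ellG%:R)) /\
  (* (2) outside the spectrum of the universal cover *)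
  (~ spectrum adj W x0 lam ->
     sup_norm psi
       <= 8 * (max_deg adj)%:R / dist_spectrum adj W x0 lam
          * (1 + dist_spectrum adj W x0 lam / (2 * (max_deg adj)%:R)) ^- ellG).
Proof.
move=> asym airr conn mind ncyc psiE psi1 [hell _]; split.
  move=> z [_ hb] [[x1 [y1 [c1 [adj1 lim1 zE]]]] hz] ell0.
  have /choice[Zf hZf] (p : T * T) : exists c, adj p.1 p.2 ->
      zeta_limit adj W p.2 p.1 lam c /\ complex.Im c != 0.
    have [pa|] := boolP (adj p.1 p.2); last by exists 0.
    by have [|c hc] := hb p.2 p.1; [rewrite asym|exists c].
  pose Z u v := Zf (u, v).
  have hZ u v : adj u v -> zeta_limit adj W v u lam (Z u v) /\ complex.Im (Z u v) != 0.
    exact: (hZf (u, v)).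
  have Zim u v (uv : adj u v) := Z_im hZ uv.
  have zI u v : adj u v -> z <= - complex.Im (Z u v).
    move=> uv; rewrite -(ltr0_norm (Zim _ _ uv)).
    by apply: (hz v u); [rewrite asym|case: (hZ _ _ uv)].
  (* The minimum is attained, and by uniqueness of limits it is the modulus of one of the nonzero
     imaginary parts. *)
  have z0 : 0 < z.
    have adj1' : adj y1 x1 by rewrite asym.
    have [[_ limI] I0] := hZ _ _ adj1'.
    by rewrite zE (norm_cvg_unique lim1.2 limI) normr_gt0.
  apply: sup_norm_le => [|x].
    by rewrite mulr_ge0 ?invr_ge0 ?sqrtr_ge0 // mulr_ge0 // invr_ge0 exprn_ge0 // ltW.
  have Zr w v := Z_rec hZ (w := w) (v := v).
  exact: (psi_bound asym airr conn mind ncyc psiE psi1 hell ell0 Zr z0 zI).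
move=> ns; have sol0 : solvable adj W x0 lam by apply: contrapT.
have D0 : (0 < max_deg adj)%N.
  by rewrite (leq_trans _ (deg_le_max adj x0)) // (leq_trans _ (mind x0)).
have [de0 _] := dist_spectrumP sol0.
apply: sup_norm_le => [|x].
  rewrite mulr_ge0 ?divr_ge0 ?mulr_ge0 ?invr_ge0 ?(ltW de0) //.
  by rewrite exprn_ge0 // addr_ge0 // divr_ge0 ?mulr_ge0 // ltW.
(* The root is moved to the vertex x at which psi is estimated. *)
have sol := solvable_connect asym (conn x0 x) sol0.
have dE : dist_spectrum adj W x lam = dist_spectrum adj W x0 lam.
  by rewrite /dist_spectrum (spectrum_root W asym x x0 conn).
have [_ hx] := dist_spectrumP sol; rewrite /= dE in hx.
apply: (combes_thomas asym airr psiE psi1 (hell x) conn ncyc _ D0 de0 erefl hx).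
by rewrite lerDl divr_ge0 ?mulr_ge0 // ltW.
Qed.
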